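(* Let $\alpha\geq0$, let $n\geq2$ be an integer, and let $\varphi(s)=3/2-n^{-s}$. Let $d$ be the number of distinct prime factors of $n$. Then $\mathcal{C}_\varphi f=f\circ\varphi$ is bounded from $\mathcal{D}_\alpha$ to $\mathcal{D}_\beta$ if and only if $\beta\geq(2^\alpha-1)/d$. If $\alpha=0$, then $\mathcal{C}_\varphi$ is not compact on $\mathcal{H}^2=\mathcal{D}_0$. If $\alpha>0$, then $\mathcal{C}_\varphi:\mathcal{D}_\alpha\to\mathcal{D}_\beta$ is compact if and only if $\beta>(2^\alpha-1)/d$.
   Context: For $\alpha\in\mathbb{R}$, $\mathcal{D}_\alpha$ is the Hilbert space of Dirichlet series $f(s)=\sum_{m\ge1} a_mm^{-s}$ with $\|f\|_{\mathcal{D}_\alpha}^2=\sum|a_m|^2/[d(m)]^\alpha<\infty$, where $d(m)$ is the number of divisors of $m$; $\mathcal{D}_0=\mathcal{H}^2$ is the space of Dirichlet series with square-summable coefficients. These series converge in $\{\operatorname{Re}s>1/2\}$, and $\varphi$ maps $\{\operatorname{Re}s>0\}$ into $\{\operatorname{Re}s>1/2\}$, so $f\circ\varphi$ is a Dirichlet series. *)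

(* Defs.v *)
From Stdlib Require Import Reals Lra Lia List Arith.
From Coquelicot Require Import Coquelicot.
Import ListNotations.
Open Scope R_scope.

Definition ndiv (m : nat) : nat :=
  length (filter (fun k => Nat.eqb (m mod k) 0) (seq 1 m)).

Definition primeb (p : nat) : bool :=
  andb (Nat.leb 2 p) (forallb (fun k => negb (Nat.eqb (p mod k) 0)) (seq 2 (p - 2))).

Definition nprimefactors (n : nat) : nat :=
  length (filter (fun p => andb (primeb p) (Nat.eqb (n mod p) 0)) (seq 1 n)).

(** Complex powers: m^{-s} = exp(-s log m), for s = x + i y and m >= 1. *)
Definition cpow_neg (m : nat) (s : C) : C :=
  (Rpower (INR m) (- fst s) * cos (snd s * ln (INR m)),
   - (Rpower (INR m) (- fst s) * sin (snd s * ln (INR m)))).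

(** Dirichlet series with coefficient sequence a (a m is the coefficient of
    m^{-s}, m >= 1; the value a 0 is ignored). *)
Definition dterm (a : nat -> C) (s : C) (k : nat) : C :=
  Cmult (a (S k)) (cpow_neg (S k) s).

Definition dseries_sum (a : nat -> C) (s : C) (l : C) : Prop :=
  is_series (dterm a s) l.

Definition dweight (alpha : R) (a : nat -> C) (k : nat) : R :=
  (Cmod (a (S k)))^2 / Rpower (INR (ndiv (S k))) alpha.

Definition in_D (alpha : R) (a : nat -> C) : Prop :=
  ex_series (dweight alpha a).

Definition normD (alpha : R) (a : nat -> C) : R :=
  sqrt (Series (dweight alpha a)).

Definition phi_n (n : nat) (s : C) : C := Cminus (RtoC (3/2)) (cpow_neg n s).

(** b is (the coefficient sequence of) the Dirichlet series f o phi, where f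
    has coefficients a: on the half-plane Re s > 1/2 (common domain of
    convergence), the series of f converges at phi(s), the series of b
    converges at s, and the two sums coincide. *)
Definition comp_image (phi : C -> C) (a b : nat -> C) : Prop :=
  forall s : C, 1/2 < fst s ->
    exists l : C, dseries_sum a (phi s) l /\ dseries_sum b s l.

Definition comp_bounded (phi : C -> C) (alpha beta : R) : Prop :=
  exists K : R, forall a, in_D alpha a ->
    exists b, in_D beta b /\ comp_image phi a b /\ normD beta b <= K * normD alpha a.

Definition comp_compact (phi : C -> C) (alpha beta : R) : Prop :=
  (forall a, in_D alpha a -> exists b, in_D beta b /\ comp_image phi a b) /\
  (forall (a b : nat -> nat -> C) (M : R),
     (forall j, in_D alpha (a j) /\ normD alpha (a j) <= M /\
                in_D beta (b j) /\ comp_image phi (a j) (b j)) ->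
     exists (sigma : nat -> nat) (g : nat -> C),
       (forall j, (sigma j < sigma (S j))%nat) /\ in_D beta g /\
       is_lim_seq (fun j => normD beta (fun m => Cminus (b (sigma j) m) (g m))) 0).

(* Main.v *)
(** With f = sum a_m m^-s one has m^-(3/2 - w) = sum_k m^(-3/2) (log m)^k w^k / k!,
    so the only coefficients of f o phi that can be nonzero are those at n^k, namely
    b_k = sum_m a_m m^(-3/2) (log m)^k / k!.  The divisor count d(n^k) has order k^d,
    hence only the exponent d beta matters; put kappa = 2^alpha - 1.

    Boundedness when d beta = kappa.  By Cauchy-Schwarz with the Poisson weights
    p_m(k) = m^-1 (log m)^k / k!, which sum to 1 over k,
    |b_k|^2 <= S_k sum_m |a_m|^2 d(m)^-alpha p_m(k), where
    S_k = sum_m d(m)^alpha m^-2 (log m)^k / k!.  So it suffices that S_k = O(k^kappa).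
    Writing log m = sum_p v_p(m) log p gives k S_k <= sum_(i < k) S_i L_(k-1-i), where
    the L_i are Poisson averages over prime powers, bounded by Chebyshev's estimate.
    The remaining sum of the S_i is controlled by sum_m d(m)^alpha m^-(1 + 1/(2k)),
    which an Euler product compares with zeta^(2^alpha).

    A larger beta turns boundedness into compactness, since the weights then gain a
    factor tending to 0 along the powers of n.  Therefore everything else follows from
    non-compactness when d beta = kappa.  This is witnessed by the coefficients
    d(m)^alpha m^-(1/2 + delta), m <= N, normalized in D_alpha: their images tend to 0
    coefficientwise as delta -> 0, but evaluating them at n^-s = 1 - delta shows that
    their norms stay away from 0. *)
Require Import Defs.
From Stdlib Require Import Reals Lra ClassicalEpsilon.
From Coquelicot Require Import Coquelicot.
From HB Require Import structures.
From mathcomp Require Import all_boot.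
Set Implicit Arguments.
Unset Strict Implicit.
Unset Printing Implicit Defensive.
Open Scope R_scope.

(** * Finite real sums *)

(** The number [2^alpha] is [d(p)^alpha] at a prime [p], so the series of [d(m)^alpha m^(-s)] has a
    singularity of order [2^alpha] at [s = 1]. Such a singularity controls only the sums of the
    [S_i], whereas boundedness needs each single [S_k], with one power of [k] less. This is the
    obstacle: the recursion for [k S_k] is the Tauberian step that passes from the average to the
    individual term, and Chebyshev's bound is its only arithmetic input. The prime sum in the
    exponent of an Euler product is never evaluated. It is eliminated between the product for
    [alpha] and the one for exponent 0, whose size is known by telescoping. All estimates are proved
    for finite sums, uniformly in the truncation, and limits are taken only at the end. The test
    coefficients are truncated reproducing kernels of [D_alpha], the natural candidates for extremal
    behaviour near the line [Re s = 1/2]. As [comp_compact] quantifies over arbitrary images of the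
    given series, uniqueness of Dirichlet coefficients is needed to identify these images with the
    computed ones. *)

HB.instance Definition _ := Monoid.isComLaw.Build R 0 Rplus
  (fun x y z => esym (Rplus_assoc x y z)) Rplus_comm Rplus_0_l.
HB.instance Definition _ := Monoid.isComLaw.Build R 1 Rmult
  (fun x y z => esym (Rmult_assoc x y z)) Rmult_comm Rmult_1_l.
HB.instance Definition _ := Monoid.isMulLaw.Build R 0 Rmult Rmult_0_l Rmult_0_r.
HB.instance Definition _ := Monoid.isAddLaw.Build R Rmult Rplus
  Rmult_plus_distr_r Rmult_plus_distr_l.

Notation "\Rsum_ ( i <- r | P ) F" := (\big[Rplus/(IZR 0)]_(i <- r | P%B) F)
  (at level 41, F at level 41, i, r at level 50).
Notation "\Rsum_ ( i <- r ) F" := (\big[Rplus/(IZR 0)]_(i <- r) F)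
  (at level 41, F at level 41, i, r at level 50).
Notation "\Rprod_ ( i <- r ) F" := (\big[Rmult/(IZR 1)]_(i <- r) F)
  (at level 36, F at level 36, i, r at level 50).

Lemma Rsum_cat (I : Type) (s t : seq I) (F : I -> R) :
  \Rsum_(i <- s ++ t) F i = \Rsum_(i <- s) F i + \Rsum_(i <- t) F i.
Proof. exact: big_cat. Qed.

Lemma Rsum_split (I : Type) (r : seq I) (F G : I -> R) :
  \Rsum_(i <- r) (F i + G i) = \Rsum_(i <- r) F i + \Rsum_(i <- r) G i.
Proof. exact: big_split. Qed.

Lemma Rmult_sumr (I : Type) (r : seq I) (F : I -> R) x :
  x * (\Rsum_(i <- r) F i) = \Rsum_(i <- r) x * F i.
Proof. exact: big_distrr. Qed.

Lemma Rmult_suml (I : Type) (r : seq I) (F : I -> R) x :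
  (\Rsum_(i <- r) F i) * x = \Rsum_(i <- r) F i * x.
Proof. exact: big_distrl. Qed.

Lemma Rsum_iota1S (F : nat -> R) N :
  \Rsum_(m <- iota 1 N.+1) F m = \Rsum_(m <- iota 1 N) F m + F N.+1.
Proof.
have -> : iota 1 N.+1 = iota 1 N ++ [:: N.+1].
  by have := iotaD 1 N 1; rewrite addn1 add1n.
by rewrite Rsum_cat big_seq1.
Qed.

Lemma Rsum_iota0S (F : nat -> R) N :
  \Rsum_(m <- iota 0 N.+1) F m = \Rsum_(m <- iota 0 N) F m + F N.
Proof.
have -> : iota 0 N.+1 = iota 0 N ++ [:: N].
  by have := iotaD 0 N 1; rewrite addn1 add0n.
by rewrite Rsum_cat big_seq1.
Qed.

Lemma Rsum_pairs (I J : Type) (s : seq I) (t : seq J) (F : I -> J -> R) :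
  \Rsum_(i <- s) \Rsum_(j <- t) F i j =
  \Rsum_(x <- [seq (i, j) | i <- s, j <- t]) F x.1 x.2.
Proof. by rewrite big_allpairs_dep. Qed.

Lemma Rsum_ge0 (I : eqType) (r : seq I) (P : pred I) (F : I -> R) :
  (forall i, i \in r -> P i -> 0 <= F i) -> 0 <= \Rsum_(i <- r | P i) F i.
Proof.
move=> H; rewrite big_seq_cond; elim/big_ind: _; [lra|move=> x y; lra|].
by move=> i /andP[ir Pi]; apply: H.
Qed.

Lemma Rsum_le (I : eqType) (r : seq I) (P : pred I) (F G : I -> R) :
  (forall i, i \in r -> P i -> F i <= G i) ->
  \Rsum_(i <- r | P i) F i <= \Rsum_(i <- r | P i) G i.
Proof.
move=> H; rewrite big_seq_cond [X in _ <= X]big_seq_cond.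
elim/big_ind2: _; [lra|move=> x y z t; lra|].
by move=> i /andP[ir Pi]; apply: H.
Qed.

Lemma Rprod_gt0 (I : eqType) (r : seq I) (F : I -> R) :
  (forall i, i \in r -> 0 < F i) -> 0 < \Rprod_(i <- r) F i.
Proof.
move=> H; rewrite big_seq; elim/big_ind: _; [lra|exact: Rmult_lt_0_compat|].
exact: H.
Qed.

Lemma Rprod_le (I : eqType) (r : seq I) (F G : I -> R) :
  (forall i, i \in r -> 0 <= F i <= G i) ->
  0 <= \Rprod_(i <- r) F i <= \Rprod_(i <- r) G i.
Proof.
move=> H; rewrite big_seq [X in _ <= _ <= X]big_seq.
elim/big_ind2: _; [lra| |exact: H].
move=> x y z t [? ?] [? ?]; split; first by apply: Rmult_le_pos.
by apply: Rmult_le_compat.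
Qed.

Lemma Rsum_subset (I : eqType) (s t : seq I) (F : I -> R) :
  uniq s -> uniq t -> {subset s <= t} -> (forall i, i \in t -> 0 <= F i) ->
  \Rsum_(i <- s) F i <= \Rsum_(i <- t) F i.
Proof.
move=> us ut st F0.
have p : perm_eq t (s ++ [seq i <- t | i \notin s]).
  apply: uniq_perm => //.
    rewrite cat_uniq us filter_uniq // andbT; apply/hasPn => x.
    by rewrite mem_filter => /andP[].
  move=> x; rewrite mem_cat mem_filter.
  by case xs: (x \in s) => //=; rewrite (st x).
rewrite (perm_big _ p) /= big_cat /=.
suff : 0 <= \Rsum_(i <- [seq i <- t | i \notin s]) F i by lra.
by apply: Rsum_ge0 => i; rewrite mem_filter => /andP[_ it] _; exact: F0.
Qed.

Lemma Rsum_reindex_le (I J : eqType) (s : seq I) (t : seq J) (h : I -> J)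
    (F : J -> R) :
  uniq s -> uniq t -> {in s &, injective h} -> (forall i, i \in s -> h i \in t) ->
  (forall j, j \in t -> 0 <= F j) ->
  \Rsum_(i <- s) F (h i) <= \Rsum_(j <- t) F j.
Proof.
move=> us ut inj_h st F0; rewrite -(big_map h xpredT F).
apply: Rsum_subset => //; first by rewrite map_inj_in_uniq.
by move=> x /mapP[i /st ? ->].
Qed.

Lemma Rsum_sqr_ge0 (I : eqType) (r : seq I) (x : I -> R) :
  0 <= \Rsum_(i <- r) (x i)^2.
Proof. by apply: Rsum_ge0 => i _ _; nra. Qed.

Lemma Rsum_CauchySchwarz (I : eqType) (r : seq I) (x y : I -> R) :
  (\Rsum_(i <- r) x i * y i)^2 <=
  (\Rsum_(i <- r) (x i)^2) * (\Rsum_(i <- r) (y i)^2).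
Proof.
elim: r => [|a r IH]; first by rewrite !big_nil; nra.
rewrite !big_cons; have := Rsum_sqr_ge0 r x; have := Rsum_sqr_ge0 r y.
set X := \Rsum_(i <- r) (x i)^2; set Y := \Rsum_(i <- r) (y i)^2.
set S := \Rsum_(i <- r) x i * y i; rewrite -/X -/Y -/S in IH.
move: X Y S IH => X Y S SXY Y0 X0; set u := x a; set v := y a.
(* Only the cross terms are left. After squaring they follow from [S^2 <= X * Y] and the inequality
   between the arithmetic and geometric means of [X * v^2] and [Y * u^2]. *)
suff : 2 * S * u * v <= X * v^2 + Y * u^2 by nra.
have H1 : 0 <= X * v^2 by nra.
have H2 : 0 <= Y * u^2 by nra.
apply: Rle_trans (Rle_abs _) _; apply: Rsqr_incr_0; last lra; last exact: Rabs_pos.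
rewrite -Rsqr_abs /Rsqr.
have H3 : S^2 * (u * v)^2 <= X * Y * (u * v)^2.
  by apply: Rmult_le_compat_r SXY; exact: pow2_ge_0.
have := pow2_ge_0 (X * v^2 - Y * u^2).
by nra.
Qed.

Lemma sum_nE (a : nat -> R) N : sum_n a N = \Rsum_(k <- iota 0 N.+1) a k.
Proof.
elim: N => [|N IH]; first by rewrite sum_O Rsum_iota0S big_nil Rplus_0_l.
by rewrite sum_Sn IH [RHS]Rsum_iota0S.
Qed.

(** * The divisor function *)

Lemma modnE m k : Nat.modulo m k = (m %% k)%N.
Proof.
case: k => [|k]; first by rewrite modn0.
symmetry; apply: (Nat.mod_unique _ _ (m %/ k.+1)%N).
  by apply/ltP; rewrite ltn_mod.
by rewrite multE plusE mulnC -divn_eq.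
Qed.

Lemma eqb_eqn m k : Nat.eqb m k = (m == k).
Proof. by apply/idP/eqP => [/Nat.eqb_eq|->] //; apply: Nat.eqb_refl. Qed.

Lemma list_seqE i m : List.seq i m = iota i m.
Proof. by elim: m i => //= m IH i; rewrite IH. Qed.

Lemma list_filterE (T : Type) (P : pred T) s : List.filter P s = filter P s.
Proof. by elim: s => //= x s ->. Qed.

Lemma list_lengthE (T : Type) (s : seq T) : length s = size s.
Proof. by elim: s => //= x s ->. Qed.

Lemma ndivE m : (0 < m)%N -> ndiv m = size (divisors m).
Proof.
move=> m0; rewrite /ndiv list_seqE list_filterE list_lengthE.
apply: perm_size; apply: uniq_perm; rewrite ?divisors_uniq ?filter_uniq ?iota_uniq//.
move=> k; rewrite mem_filter mem_iota -dvdn_divisors // eqb_eqn modnE.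
rewrite -/(dvdn k m) add1n ltnS; case km: (k %| m)%N => //=.
by rewrite (dvdn_gt0 m0 km) (dvdn_leq m0 km).
Qed.

Lemma ndiv1 : ndiv 1 = 1%N. Proof. by []. Qed.

Lemma ndiv_gt0 m : (0 < m)%N -> (0 < ndiv m)%N.
Proof.
by move=> m0; rewrite ndivE // -has_predT; apply/hasP; exists 1%N; rewrite // -dvdn_divisors.
Qed.

Lemma logn_coprime_mul p j l : prime p -> ~~ (p %| l)%N -> (0 < l)%N ->
  logn p (p ^ j * l) = j.
Proof.
move=> pp pl l0; rewrite lognM // ?expn_gt0 ?prime_gt0 // pfactorK //.
by rewrite logn_coprime ?addn0 // prime_coprime.
Qed.

(** The divisors of [p ^ j * l] are the products [p ^ i * d] with [i <= j] and [d] dividing [l],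
    each obtained once because [logn p] recovers [i]. *)
Lemma ndivM p j l : prime p -> ~~ (p %| l)%N -> (0 < l)%N ->
  ndiv (p ^ j * l) = (j.+1 * ndiv l)%N.
Proof.
move=> pp pl l0; have p0 := prime_gt0 pp.
have pj0 i : (0 < p ^ i)%N by rewrite expn_gt0 p0.
have m0 : (0 < p ^ j * l)%N by rewrite muln_gt0 pj0.
rewrite !ndivE //.
have nd d : d \in divisors l -> ~~ (p %| d)%N /\ (0 < d)%N.
  rewrite -dvdn_divisors // => dl; split; last exact: dvdn_gt0 dl.
  by apply: contra pl => /dvdn_trans; apply.
transitivity (size [seq (p ^ i * d)%N | i <- iota 0 j.+1, d <- divisors l]); last first.
  by rewrite size_allpairs size_iota.
apply/perm_size/uniq_perm; rewrite ?divisors_uniq //.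
  apply: allpairs_uniq; rewrite ?iota_uniq ?divisors_uniq //.
  move=> [i d] [i' d'] /allpairsP[[a b] [_ /nd[h1 h2] [-> ->]]].
  move=> /allpairsP[[a' b'] [_ /nd[h3 h4] [-> ->]]].
  rewrite /= in h1 h2 h3 h4 *; move=> e.
  have := congr1 (logn p) e; rewrite !logn_coprime_mul // => ei; subst.
  by move/eqP: e; rewrite eqn_pmul2l // => /eqP ->.
move=> d; rewrite -dvdn_divisors //; apply/idP/idP => [dm|].
  have d0 := dvdn_gt0 m0 dm.
  have [d' pd' ed] := pfactor_coprime pp d0.
  apply/allpairsP; exists (logn p d, d'); split; last by rewrite mulnC.
    rewrite mem_iota add0n ltnS /=.
    by have := dvdn_leq_log p m0 dm; rewrite logn_coprime_mul.
  rewrite -dvdn_divisors //.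
  have : (d' %| p ^ j * l)%N by apply: dvdn_trans dm; rewrite ed dvdn_mulr.
  by rewrite Gauss_dvdr // coprimeXr // coprime_sym.
case/allpairsP=> [[i d'] [ij dl ->]]; move: ij dl.
by rewrite mem_iota ltnS -dvdn_divisors //= => ij dl; rewrite dvdn_mul // dvdn_exp2l.
Qed.

Lemma primebE p : primeb p = prime p.
Proof.
rewrite /primeb list_seqE; apply/idP/primeP.
  move=> /andP[/Nat.leb_le/leP p1 /List.forallb_forall H]; split=> // d dp.
  have p0 : (0 < p)%N by apply: leq_trans p1.
  have [d1|d1] := eqVneq d 1%N; first by rewrite d1.
  have [//|dnp] := eqVneq d p.
  have /H : List.In d (iota 2 (p - 2)).
    rewrite -list_seqE; apply/List.in_seq; split; apply/leP.
      by case: d d1 dp {dnp} => [|[|]] //; rewrite dvd0n => _ /eqP e; rewrite e in p0.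
    by rewrite plusE subnKC // ltn_neqAle dnp dvdn_leq.
  by rewrite eqb_eqn modnE -/(dvdn d p) dp.
move=> [p1 H]; apply/andP; split; first by apply/Nat.leb_le/leP.
apply/List.forallb_forall => d; rewrite -list_seqE => /List.in_seq[/leP d2 /leP].
rewrite minusE plusE subnKC // => dp; rewrite eqb_eqn modnE -/(dvdn d p).
apply/negP => /H /orP[/eqP d1|/eqP e]; first by rewrite d1 in d2.
by rewrite e ltnn in dp.
Qed.

Lemma nprimefactorsE n : (0 < n)%N -> nprimefactors n = size (primes n).
Proof.
move=> n0; rewrite /nprimefactors list_seqE list_filterE list_lengthE.
apply/perm_size/uniq_perm; rewrite ?primes_uniq ?filter_uniq ?iota_uniq //.
move=> p; rewrite mem_filter mem_iota mem_primes n0 primebE eqb_eqn modnE -/(dvdn p n).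
case: (boolP (prime p)) => //= pp; rewrite add1n ltnS prime_gt0 //=.
by case pn: (p %| n)%N => //=; rewrite dvdn_leq.
Qed.

Lemma ndiv_expn n k : (0 < n)%N ->
  ndiv (n ^ k) = (\prod_(p <- primes n) (k * logn p n).+1)%N.
Proof.
move=> n0.
(* The induction carries the fact that no prime outside [s] divides the product: this is what lets
   [ndivM] split off the next prime. *)
have H (s : seq nat) : uniq s -> all prime s ->
    [/\ (0 < \prod_(p <- s) p ^ (k * logn p n))%N,
        ndiv (\prod_(p <- s) p ^ (k * logn p n)) =
          (\prod_(p <- s) (k * logn p n).+1)%N &
        forall q, prime q -> q \notin s ->
          ~~ (q %| \prod_(p <- s) p ^ (k * logn p n))%N].
  elim: s => [_ _|p s IH /= /andP[ps us] /andP[pp as_]].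
    rewrite !big_nil; split=> // q qp _; rewrite dvdn1; apply/negP => /eqP e.
    by rewrite e in qp.
  have [h0 h1 h2] := IH us as_; rewrite !big_cons; split.
  - by rewrite muln_gt0 h0 expn_gt0 prime_gt0.
  - by rewrite ndivM ?h1 // h2.
  - move=> q qp; rewrite inE negb_or => /andP[qnp qs].
    rewrite Euclid_dvdM // negb_or h2 // andbT Euclid_dvdX // negb_and.
    by rewrite dvdn_prime2 // qnp.
have [|_ <- _] := H (primes n) (primes_uniq n).
  by apply/allP => p; rewrite mem_primes => /andP[].
congr ndiv; rewrite {1}(prod_prime_decomp n0) prime_decompE big_map /=.
rewrite (big_morph (fun x => x ^ k)%N (fun x y => expnMn x y k) (exp1n k)).
by apply: eq_bigr => p _; rewrite -expnM mulnC.
Qed.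

(** * Smooth numbers *)

Lemma INR_muln m k : INR (m * k)%N = INR m * INR k.
Proof. exact: mult_INR. Qed.

Lemma INR_expn m k : INR (m ^ k)%N = INR m ^ k.
Proof. by elim: k => [|k IH]; rewrite ?expn0 // expnS INR_muln IH. Qed.

Lemma INR_gt0 m : (0 < m)%N -> 0 < INR m.
Proof. by move=> /ltP; apply: lt_0_INR. Qed.

Lemma INR_leq m k : (m <= k)%N -> INR m <= INR k.
Proof. by move=> /leP; apply: le_INR. Qed.

Lemma INR_ge1 m : (0 < m)%N -> 1 <= INR m.
Proof. exact: (@INR_leq 1). Qed.

Lemma Rpower_gt0 x y : 0 < Rpower x y.
Proof. exact: exp_pos. Qed.

Lemma Rpower_ge1 x y : 1 <= x -> 0 <= y -> 1 <= Rpower x y.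
Proof.
move=> x1 y0; rewrite -(Rpower_O x); last lra.
by apply: Rle_Rpower.
Qed.

Lemma Rpower_pow_nat x y k : Rpower x y ^ k = Rpower x (INR k * y).
Proof.
by rewrite -Rpower_pow ?Rpower_mult; [rewrite Rmult_comm|exact: Rpower_gt0].
Qed.

Lemma exp_le x y : x <= y -> exp x <= exp y.
Proof. by case=> [/exp_increasing|->]; lra. Qed.

Lemma ln_le_sub1 t : 0 < t -> ln t <= t - 1.
Proof. by move=> t0; have := exp_ineq1_le (ln t); rewrite exp_ln //; lra. Qed.

(** From [ln t <= t - 1] at [t = e * y / (a + 1)]; dividing by [a + 1] instead of [a] also covers
    [a = 0]. *)
Lemma Rpower_le_exp a e : 0 <= a -> 0 < e ->
  exists2 K, 0 < K & forall y, 0 < y -> Rpower y a <= K * exp (e * y).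
Proof.
move=> a0 e0; exists (exp (a * ln ((a + 1) / e))); first exact: exp_pos.
move=> y y0; rewrite -exp_plus /Rpower; apply: exp_le.
have q0 : 0 < (a + 1) / e by apply: Rdiv_lt_0_compat; lra.
have t0 : 0 < e * y / (a + 1) by apply: Rdiv_lt_0_compat; nra.
have -> : y = (e * y / (a + 1)) * ((a + 1) / e) by field; lra.
rewrite ln_mult // -[X in _ <= _ + e * X]/(_ * _).
have -> : e * (e * y / (a + 1) * ((a + 1) / e)) = (a + 1) * (e * y / (a + 1)).
  by field; lra.
move: (e * y / (a + 1)) t0 => t t0; have := ln_le_sub1 t0; nra.
Qed.

Lemma Rsum_geom_le a J : \Rsum_(j <- iota a J) (2/3)^j <= 3 * (2/3)^a.
Proof.
suff : \Rsum_(j <- iota a J) (2/3)^j = 3 * (2/3)^a - 3 * (2/3)^(a + J)%N.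
  by move=> ->; have := pow_lt (2/3) (a + J)%N; lra.
elim: J a => [|J IH] a; first by rewrite big_nil addn0; lra.
by rewrite big_cons IH addSnnS /=; lra.
Qed.

(** This disposes of the part of an Euler factor from the square of the prime on. Letting the
    polynomial weight grow like [(4/3)^j] against [x <= 1/2] leaves a geometric series of ratio
    [2/3]. *)
Lemma Rsum_poly_geom a : 0 <= a ->
  exists2 K, 0 < K & forall J x, 0 <= x <= 1/2 ->
    \Rsum_(j <- iota 2 J) Rpower (INR j.+1) a * x^j <= K * x^2.
Proof.
move=> a0; have e0 : 0 < ln (4/3) by rewrite -ln_1; apply: ln_increasing; lra.
have [K K0 HK] := Rpower_le_exp a0 e0.
exists (16 * K); first lra.
move=> J x x01.
apply: Rle_trans (_ : \Rsum_(j <- iota 2 J) (16/3 * (K * x^2)) * (2/3)^j <= _); last first.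
  rewrite -Rmult_sumr; have := Rsum_geom_le 2 J.
  have : 0 <= K * x^2 by nra.
  rewrite Rmult_assoc; set A := K * _; set S := bigop _ _ _ => A0 SA; rewrite /= in SA.
  suff : A * S <= A * 3 by rewrite /A /=; lra.
  by apply: Rmult_le_compat_l => //; rewrite -/S; lra.
apply: Rsum_le => j; rewrite mem_iota => /andP[j2 _] _.
have := HK (INR j.+1) (INR_gt0 (ltn0Sn j)).
have -> : exp (ln (4/3) * INR j.+1) = (4/3)^j.+1.
  by rewrite -Rpower_pow ?/Rpower; [rewrite Rmult_comm|lra].
have -> : j = (j - 2).+2 by rewrite -(addn2 (j - 2)) subnK.
set i := (j - 2)%N; set P := Rpower _ _ => H.
have x2 : 0 <= x^2 by exact: pow2_ge_0.
have xi : 0 <= x^i <= (1/2)^i by split; [apply: pow_le|apply: pow_incr]; lra.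
have h4 : 0 < (4/3)^i by apply: pow_lt; lra.
have -> : x^i.+2 = x^2 * x^i by rewrite /=; ring.
have -> : (2/3)^i.+2 = 4/9 * ((4/3)^i * (1/2)^i).
  by rewrite -Rpow_mult_distr (_ : 4/3 * (1/2) = 2/3) /=; lra.
have {}H : P <= 64/27 * K * (4/3)^i by move: H; rewrite /=; lra.
have P0 : 0 < P by exact: Rpower_gt0.
apply: Rle_trans (_ : (64/27 * K * (4/3)^i) * (x^2 * (1/2)^i) <= _); last by lra.
apply: Rmult_le_compat => //; [lra| |].
  by apply: Rmult_le_pos; lra.
by apply: Rmult_le_compat_l; lra.
Qed.

Definition dpow (a : R) (m : nat) : R := Rpower (INR (ndiv m)) a.

Lemma dpow_gt0 a m : 0 < dpow a m. Proof. exact: Rpower_gt0. Qed.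

Lemma dpow1 a : dpow a 1 = 1.
Proof. by rewrite /dpow ndiv1 /Rpower ln_1 Rmult_0_r exp_0. Qed.

Lemma dpow0 m : (0 < m)%N -> dpow 0 m = 1.
Proof. by move=> m0; rewrite /dpow Rpower_O //; exact/INR_gt0/ndiv_gt0. Qed.

Lemma dpowM a p j l : prime p -> ~~ (p %| l)%N -> (0 < l)%N ->
  dpow a (p ^ j * l) = Rpower (INR j.+1) a * dpow a l.
Proof.
move=> pp pl l0; rewrite /dpow ndivM // INR_muln Rpower_mult_distr //.
  exact: INR_gt0.
exact/INR_gt0/ndiv_gt0.
Qed.

Lemma Rpower_INR_mul p j l s : (0 < p)%N -> (0 < l)%N ->
  Rpower (INR (p ^ j * l)) s = Rpower (INR p) s ^ j * Rpower (INR l) s.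
Proof.
move=> p0 l0; have h := INR_gt0 p0.
rewrite INR_muln INR_expn -Rpower_mult_distr; [|exact: pow_lt|exact: INR_gt0].
by rewrite Rpower_pow_nat -Rpower_pow // Rpower_mult.
Qed.

(** A finite model of the integers whose prime factors lie in [ps]: with exponents capped at [J], an
    Euler product is an identity between finite sums and products. *)
Fixpoint smooth (J : nat) (ps : seq nat) : seq nat :=
  if ps is p :: ps' then
    [seq (p ^ j * l)%N | j <- iota 0 J.+1, l <- smooth J ps']
  else [:: 1%N].

Lemma smooth_uniq J ps : uniq ps -> all prime ps ->
  uniq (smooth J ps) /\
  forall m, m \in smooth J ps ->
    (0 < m)%N /\ forall q, prime q -> q \notin ps -> ~~ (q %| m)%N.
Proof.
elim: ps => [_ _|p s IH /= /andP[ps us] /andP[pp as_]].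
  split=> // m; rewrite inE => /eqP ->; split=> // q qp _.
  by rewrite dvdn1; apply/negP => /eqP e; rewrite e in qp.
have [h0 h1] := IH us as_; split.
  apply: (@allpairs_uniq _ _ _ (fun j l => p ^ j * l)%N (iota 0 J.+1)) => //.
    exact: iota_uniq.
  move=> [i d] [i' d'] /allpairsP[[a b] [_ /h1[b0 /(_ p pp ps) pb] [-> ->]]].
  move=> /allpairsP[[a' b'] [_ /h1[b0' /(_ p pp ps) pb'] [-> ->]]].
  rewrite /= in b0 pb b0' pb' *; move=> e.
  have := congr1 (logn p) e; rewrite !logn_coprime_mul // => ei; subst.
  by move/eqP: e; rewrite eqn_pmul2l ?expn_gt0 ?prime_gt0 // => /eqP ->.
move=> m /(@allpairsP _ _ _ (fun j l => p ^ j * l)%N (iota 0 J.+1)).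
move=> [[j l] [_ /h1[l0 hl] ->]]; split=> /=.
  by rewrite muln_gt0 l0 expn_gt0 prime_gt0.
move=> q qp; rewrite inE negb_or => /andP[qnp qs].
rewrite Euclid_dvdM // negb_or hl // andbT Euclid_dvdX // negb_and.
by rewrite dvdn_prime2 // qnp.
Qed.

Lemma smooth_full J ps m : all prime ps -> (0 < m)%N -> (m <= J)%N ->
  (forall q, prime q -> (q %| m)%N -> q \in ps) -> m \in smooth J ps.
Proof.
elim: ps m => [|p s IH] m /=.
  move=> _ m0 _ H; rewrite inE; apply/eqP/esym/eqP; rewrite eqn_leq m0 /= leqNgt.
  by apply/negP => /pdivP[q qp /(H _ qp)].
move=> /andP[pp as_] m0 mJ H.
have [l pl em] := pfactor_coprime pp m0.
have l0 : (0 < l)%N by case: l em {pl} => // em; rewrite em in m0.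
apply/(@allpairsP _ _ _ (fun j l => p ^ j * l)%N (iota 0 J.+1)).
exists (logn p m, l); split=> /=; last by rewrite mulnC.
  rewrite -[_ :: _]/(iota 0 J.+1) mem_iota /= add0n ltnS.
  by apply: leq_trans mJ; apply/ltnW/ltn_logl.
apply: IH => //.
  by apply: leq_trans mJ; rewrite em leq_pmulr // expn_gt0 prime_gt0.
move=> q qp ql; have := H q qp; rewrite em dvdn_mulr // inE => /(_ isT) /orP[/eqP e|//].
by move: pl; rewrite prime_coprime // -e ql.
Qed.

(** The finite Euler product. By distributivity, it suffices that [h] splits off the exact power of
    one prime at a time. *)
Lemma smooth_sum (h : nat -> R) (e : nat -> nat -> R) J ps :
  uniq ps -> all prime ps -> h 1%N = 1 ->
  (forall p j l, prime p -> ~~ (p %| l)%N -> (0 < l)%N ->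
     h (p ^ j * l)%N = e p j * h l) ->
  \Rsum_(m <- smooth J ps) h m =
  \Rprod_(p <- ps) \Rsum_(j <- iota 0 J.+1) e p j.
Proof.
move=> + + h1 hm; elim: ps => [|p s IH]; first by rewrite big_seq1 big_nil.
move=> /andP[ps us] /andP[pp as_]; rewrite [smooth _ _]/smooth -/smooth.
rewrite big_allpairs_dep big_cons -IH // Rmult_suml.
apply: eq_bigr => j _; rewrite Rmult_sumr [LHS]big_seq [RHS]big_seq.
have [_ hs] := smooth_uniq J us as_.
by apply: eq_bigr => l /hs[l0 /(_ p pp ps) pl]; apply: hm.
Qed.

Definition primes_upto N := [seq p <- iota 1 N | prime p].

Lemma primes_upto_uniq N : uniq (primes_upto N).
Proof. by rewrite filter_uniq // iota_uniq. Qed.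

Lemma primes_upto_prime N : all prime (primes_upto N).
Proof. exact: filter_all. Qed.

Lemma mem_primes_upto N p : p \in primes_upto N -> prime p.
Proof. by rewrite mem_filter => /andP[]. Qed.

Lemma smooth_upto J N : (N <= J)%N -> {subset iota 1 N <= smooth J (primes_upto N)}.
Proof.
move=> NJ m; rewrite mem_iota add1n ltnS => /andP[m0 mN].
apply: (smooth_full (primes_upto_prime N)) => // [|q qp qm].
  exact: leq_trans mN NJ.
rewrite mem_filter qp mem_iota add1n ltnS prime_gt0 //=.
exact: leq_trans (dvdn_leq m0 qm) mN.
Qed.

Lemma smooth_bound J ps : uniq ps -> all prime ps ->
  exists M, {subset smooth J ps <= iota 1 M}.
Proof.
move=> us as_; exists (\max_(m <- smooth J ps) m) => m ms.
rewrite mem_iota add1n ltnS; have [_ /(_ m ms)[-> _]] := smooth_uniq J us as_.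
exact: leq_bigmax_seq.
Qed.

(** * Euler products *)

(** With [Rpower_add1_le], this compares each term of [zeta (1 + d)] with a telescoping difference.
    Both follow from [exp t >= 1 + t] and [ln t <= t - 1]. *)
Lemma Rpower_add1_ge x d : 0 < x -> 0 <= d ->
  Rpower x (- d) - Rpower (x + 1) (- d) <= d * Rpower x (- (1 + d)).
Proof.
move=> x0 d0; have -> : x + 1 = x * ((x + 1) / x) by field; lra.
have q0 : 0 < (x + 1) / x by apply: Rdiv_lt_0_compat; lra.
rewrite -Rpower_mult_distr // (_ : - (1 + d) = - d + Ropp 1); last ring.
rewrite Rpower_plus (Rpower_Ropp _ 1) Rpower_1 //.
have h := Rpower_gt0 x (- d).
suff : 1 - d * / x <= Rpower ((x + 1) / x) (- d) by move: (Rpower _ _) h => A; nra.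
rewrite /Rpower; have := exp_ineq1_le (- d * ln ((x + 1) / x)).
have := ln_le_sub1 q0.
have -> : (x + 1) / x - 1 = / x by field; lra.
nra.
Qed.

Lemma Rpower_add1_le x d : 0 < x -> 0 <= d ->
  d * Rpower (x + 1) (- (1 + d)) <= Rpower x (- d) - Rpower (x + 1) (- d).
Proof.
move=> x0 d0; have {2}-> : x = (x + 1) * (x / (x + 1)) by field; lra.
have q0 : 0 < x / (x + 1) by apply: Rdiv_lt_0_compat; lra.
have y0 : 0 < x + 1 by lra.
rewrite -Rpower_mult_distr // (_ : - (1 + d) = - d + Ropp 1); last ring.
rewrite Rpower_plus (Rpower_Ropp _ 1) Rpower_1 //.
have h := Rpower_gt0 (x + 1) (- d).
suff : 1 + d * / (x + 1) <= Rpower (x / (x + 1)) (- d) by move: (Rpower _ _) h => A; nra.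
rewrite /Rpower; have := exp_ineq1_le (- d * ln (x / (x + 1))).
have := ln_le_sub1 q0.
have -> : x / (x + 1) - 1 = - / (x + 1) by field; lra.
nra.
Qed.

Lemma zeta_sum_upper d N : 0 < d ->
  \Rsum_(m <- iota 1 N) Rpower (INR m) (- (1 + d)) <= 1 + 1 / d.
Proof.
move=> d0; case: N => [|N].
  rewrite big_nil; have : 0 < 1 / d by apply: Rdiv_lt_0_compat; lra.
  by lra.
(* Keeping the telescoped remainder makes the bound inductive. *)
suff : \Rsum_(m <- iota 1 N.+1) Rpower (INR m) (- (1 + d)) <=
    1 + (1 - Rpower (INR N.+1) (- d)) / d.
  move=> H; apply: Rle_trans H _; apply: Rplus_le_compat_l.
  apply: Rmult_le_compat_r; first by apply/Rlt_le/Rinv_0_lt_compat.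
  by have := Rpower_gt0 (INR N.+1) (- d); lra.
elim: N => [|N IH].
  by rewrite [iota 1 1]/= big_seq1 [INR 1]/= /Rpower ln_1 !Rmult_0_r exp_0; lra.
rewrite Rsum_iota1S; have := Rpower_add1_le (INR_gt0 (ltn0Sn N)) (Rlt_le _ _ d0).
rewrite -S_INR; move: IH.
set S := bigop _ _ _; set C := Rpower (INR N.+1) (- d); set A := Rpower (INR N.+2) (- (1 + d)).
set B := Rpower (INR N.+2) (- d) => IH H.
have H' : A <= (C - B) / d.
  apply: (Rmult_le_reg_l d) => //; rewrite (_ : d * ((C - B) / d) = C - B) //.
  by field; lra.
move: IH H'; lra.
Qed.

Lemma zeta_sum_lower d N : 0 < d ->
  (1 - Rpower (INR N.+1) (- d)) / d <=
  \Rsum_(m <- iota 1 N) Rpower (INR m) (- (1 + d)).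
Proof.
move=> d0; elim: N => [|N IH].
  by rewrite big_nil /= /Rpower ln_1 Rmult_0_r exp_0; lra.
rewrite Rsum_iota1S; have := Rpower_add1_ge (INR_gt0 (ltn0Sn N)) (Rlt_le _ _ d0).
rewrite -S_INR; move: IH.
set S := bigop _ _ _; set A := Rpower (INR N.+1) (- d); set B := Rpower (INR N.+2) (- d).
set C := Rpower (INR N.+1) (- (1 + d)) => IH H.
have H' : (A - B) / d <= C.
  apply: (Rmult_le_reg_l d) => //; rewrite (_ : d * ((A - B) / d) = A - B) //.
  by field; lra.
move: IH H'; lra.
Qed.

Lemma Rprod_exp (I : Type) (r : seq I) (F : I -> R) :
  \Rprod_(i <- r) exp (F i) = exp (\Rsum_(i <- r) F i).
Proof. by elim: r => [|i r IH]; rewrite ?big_nil ?exp_0 // !big_cons IH exp_plus. Qed.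

(** Since [ln (1 + y) >= 1 - 1 / (1 + y) >= y - y^2]. It bounds an Euler factor below by an
    exponential, with a quadratic loss that is summable over the primes. *)
Lemma exp_le_1add y : 0 <= y -> exp (y - y^2) <= 1 + y.
Proof.
move=> y0; rewrite -[X in _ <= X]exp_ln; last lra.
apply: exp_le; have q0 : 0 < / (1 + y) by apply: Rinv_0_lt_compat; lra.
have := ln_le_sub1 q0; rewrite ln_Rinv; last lra.
suff : / (1 + y) <= 1 - y + y^2 by lra.
apply: (Rmult_le_reg_l (1 + y)); first lra.
rewrite Rinv_r; last lra.
have : 0 <= y^3 by apply: pow_le.
by rewrite /=; nra.
Qed.

Definition prime_zeta s N := \Rsum_(p <- primes_upto N) Rpower (INR p) (- s).

Lemma prime_Rpower_bound p s : prime p -> 1 <= s ->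
  0 <= Rpower (INR p) (- s) <= 1/2.
Proof.
move=> pp s1; split; first exact/Rlt_le/Rpower_gt0.
have p2 : 2 <= INR p by apply: (@INR_leq 2); exact: prime_gt1.
apply: Rle_trans (_ : Rpower (INR p) (Ropp 1) <= _); first by apply: Rle_Rpower; lra.
rewrite Rpower_Ropp Rpower_1; last lra.
by rewrite Rdiv_1_l; apply: Rinv_le_contravar; lra.
Qed.

(** The quadratic errors in the logarithm of an Euler product stay bounded up to [s = 1]. The 2 is
    [1 + 1 / d] at [d = 1]. *)
Lemma prime_zeta_sqr s N : 1 <= s ->
  \Rsum_(p <- primes_upto N) (Rpower (INR p) (- s))^2 <= 2.
Proof.
move=> s1; apply: Rle_trans (_ : \Rsum_(m <- iota 1 N) Rpower (INR m) (- (1 + 1)) <= _); last first.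
  by have := zeta_sum_upper N Rlt_0_1; lra.
apply: Rle_trans (_ : \Rsum_(m <- primes_upto N) Rpower (INR m) (- (1 + 1)) <= _); last first.
  apply: Rsum_subset; rewrite ?primes_upto_uniq ?iota_uniq //.
    by move=> p; rewrite mem_filter => /andP[].
  by move=> i _; apply/Rlt_le/Rpower_gt0.
apply: Rsum_le => p /mem_primes_upto pp _; rewrite Rpower_pow_nat.
apply: Rle_Rpower; first exact/INR_ge1/prime_gt0.
by rewrite /=; lra.
Qed.

Definition dterm_pos a s m := dpow a m * Rpower (INR m) (- s).

Lemma dterm_pos_gt0 a s m : 0 < dterm_pos a s m.
Proof. by apply: Rmult_lt_0_compat; [exact: dpow_gt0|exact: Rpower_gt0]. Qed.

Lemma dterm_pos_smooth_sum a s J ps : uniq ps -> all prime ps ->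
  \Rsum_(m <- smooth J ps) dterm_pos a s m =
  \Rprod_(p <- ps) \Rsum_(j <- iota 0 J.+1) Rpower (INR j.+1) a * Rpower (INR p) (- s) ^ j.
Proof.
move=> us as_; apply: smooth_sum => //.
  by rewrite /dterm_pos dpow1 /= /Rpower ln_1 Rmult_0_r exp_0 Rmult_1_l.
move=> p j l pp pl l0; rewrite /dterm_pos dpowM // Rpower_INR_mul ?(prime_gt0 pp) //; ring.
Qed.

Lemma iota0SS J : iota 0 J.+2 = 0%N :: 1%N :: iota 2 J. Proof. by []. Qed.

(** The Euler factor at [p] is [1 + 2^a p^(-s) + O(p^(-2s))], so the logarithm of the product is
    [2^a] times the prime sum up to a bounded error. What matters is that [K] depends on neither [s]
    nor [N]. *)
Lemma dseries_prime_upper a : 0 <= a -> exists2 K, 0 < K & forall s N, 1 <= s ->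
  \Rsum_(m <- iota 1 N) dterm_pos a s m <= K * exp (Rpower 2 a * prime_zeta s N).
Proof.
move=> a0; have [K K0 HK] := Rsum_poly_geom a0.
exists (exp (K * 2)); first exact: exp_pos.
move=> s N s1; have us := primes_upto_uniq N; have ap := primes_upto_prime N.
apply: Rle_trans (_ : \Rsum_(m <- smooth N.+1 (primes_upto N)) dterm_pos a s m <= _).
  apply: Rsum_subset; rewrite ?iota_uniq //.
  - by have [] := smooth_uniq N.+1 us ap.
  - exact: smooth_upto.
  - by move=> m _; apply/Rlt_le/dterm_pos_gt0.
rewrite dterm_pos_smooth_sum //.
apply: Rle_trans (_ : \Rprod_(p <- primes_upto N)
  exp (Rpower 2 a * Rpower (INR p) (- s) + K * Rpower (INR p) (- s) ^ 2) <= _).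
  apply: (proj2 (Rprod_le _)) => p /mem_primes_upto pp.
  have x01 := prime_Rpower_bound pp s1; split.
    apply: Rsum_ge0 => j _ _; apply: Rmult_le_pos; first exact/Rlt_le/Rpower_gt0.
    by apply: pow_le; lra.
  rewrite iota0SS !big_cons; have := HK N _ x01.
  set S := bigop _ _ _; set x := Rpower (INR p) _.
  have := exp_ineq1_le (Rpower 2 a * x + K * x^2).
  rewrite [INR 1]/= [INR 2]/= pow_O pow_1.
  have -> : Rpower 1 a = 1 by rewrite /Rpower ln_1 Rmult_0_r exp_0.
  rewrite (_ : 1 + 1 = 2) //.
  by lra.
rewrite Rprod_exp Rsum_split -!Rmult_sumr exp_plus -/(prime_zeta s N) Rmult_comm.
apply: Rmult_le_compat_r; first exact/Rlt_le/exp_pos.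
by apply: exp_le; apply: Rmult_le_compat_l; [lra|exact: prime_zeta_sqr].
Qed.

Lemma dseries_prime_lower a : 0 <= a -> exists2 c, 0 < c & forall s N, 1 <= s ->
  exists M, c * exp (Rpower 2 a * prime_zeta s N) <=
    \Rsum_(m <- iota 1 M) dterm_pos a s m.
Proof.
move=> a0; exists (exp (- (Rpower 2 a ^ 2 * 2))); first exact: exp_pos.
move=> s N s1; have us := primes_upto_uniq N; have ap := primes_upto_prime N.
(* Squarefree integers suffice from below: exponents 0 and 1 give the factor [1 + 2^a p^(-s)]. *)
have [M HM] := smooth_bound 1 us ap; exists M.
apply: Rle_trans (_ : \Rsum_(m <- smooth 1 (primes_upto N)) dterm_pos a s m <= _); last first.
  apply: Rsum_subset; rewrite ?iota_uniq //.
    by have [] := smooth_uniq 1 us ap.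
  by move=> m _; apply/Rlt_le/dterm_pos_gt0.
rewrite dterm_pos_smooth_sum //.
apply: Rle_trans (_ : \Rprod_(p <- primes_upto N)
  exp (Rpower 2 a * Rpower (INR p) (- s) + - Rpower 2 a ^ 2 * Rpower (INR p) (- s) ^ 2) <= _); last first.
  apply: (proj2 (Rprod_le _)) => p /mem_primes_upto pp.
  have x01 := prime_Rpower_bound pp s1; split; first exact/Rlt_le/exp_pos.
  rewrite iota0SS !big_cons big_nil [INR 1]/= [INR 2]/= pow_O pow_1.
  set x := Rpower (INR p) _ in x01 *.
  have -> : Rpower 1 a = 1 by rewrite /Rpower ln_1 Rmult_0_r exp_0.
  rewrite (_ : 1 + 1 = 2) // Rplus_0_r Rmult_1_l.
  have h : 0 <= Rpower 2 a * x.
    by apply: Rmult_le_pos; [exact/Rlt_le/Rpower_gt0|lra].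
  apply: Rle_trans (exp_le_1add h); apply: exp_le; rewrite Rpow_mult_distr; lra.
rewrite Rprod_exp Rsum_split -!Rmult_sumr exp_plus -/(prime_zeta s N) Rmult_comm.
apply: Rmult_le_compat_l; first exact/Rlt_le/exp_pos.
apply: exp_le; have := prime_zeta_sqr N s1; set S := bigop _ _ _ => HS.
have := pow2_ge_0 (Rpower 2 a); rewrite /= in HS *; nra.
Qed.

Lemma dterm_pos0 s m : (0 < m)%N -> dterm_pos 0 s m = Rpower (INR m) (- s).
Proof. by move=> m0; rewrite /dterm_pos dpow0 // Rmult_1_l. Qed.

Lemma dterm_pos0_sum s N :
  \Rsum_(m <- iota 1 N) dterm_pos 0 s m = \Rsum_(m <- iota 1 N) Rpower (INR m) (- s).
Proof.
rewrite big_seq [RHS]big_seq; apply: eq_bigr => m; rewrite mem_iota => /andP[m0 _].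
exact: dterm_pos0.
Qed.

Lemma Rpower2_0 : Rpower 2 0 = 1. Proof. by rewrite Rpower_O; lra. Qed.

Lemma Rpower_exp x y : Rpower (exp x) y = exp (y * x).
Proof. by rewrite /Rpower ln_exp. Qed.

Lemma Rpower_base_le x y z : 0 <= z -> 0 < x <= y -> Rpower x z <= Rpower y z.
Proof. by move=> z0 h; apply: Rle_Rpower_l. Qed.

(** The lower Euler product bound for exponent 0 gives [exp (prime_zeta s N) <= (1 + 1 / d) / c];
    raising it to the power [2^a] removes the prime sum from the upper bound for [a].
    [dseries_lower] exchanges the roles of the two bounds. *)
Lemma dseries_upper a : 0 <= a -> exists2 K, 0 < K & forall d N, 0 < d ->
  \Rsum_(m <- iota 1 N) dterm_pos a (1 + d) m <= K * Rpower (1 + 1 / d) (Rpower 2 a).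
Proof.
move=> a0; have [K K0 HK] := dseries_prime_upper a0.
have [c c0 Hc] := dseries_prime_lower (Rle_refl 0).
exists (K * Rpower (/ c) (Rpower 2 a)).
  by apply: Rmult_lt_0_compat => //; exact: Rpower_gt0.
move=> d N d0; have s1 : 1 <= 1 + d by lra.
apply: Rle_trans (HK _ _ s1) _; rewrite Rmult_assoc; apply: Rmult_le_compat_l; first lra.
have [M] := Hc _ N s1; rewrite Rpower2_0 Rmult_1_l dterm_pos0_sum => h.
have {}h := Rle_trans _ _ _ h (zeta_sum_upper M d0).
have q0 : 0 < 1 / d by apply: Rdiv_lt_0_compat; lra.
rewrite Rpower_mult_distr; [|exact: Rinv_0_lt_compat|lra].
rewrite -Rpower_exp; apply: Rpower_base_le; first exact/Rlt_le/Rpower_gt0.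
split; first exact: exp_pos.
apply: (Rmult_le_reg_l c) => //; rewrite -Rmult_assoc Rinv_r; lra.
Qed.

Lemma dseries_lower a : 0 <= a -> exists2 c, 0 < c & forall d, 0 < d ->
  exists M, c * Rpower (1 / d) (Rpower 2 a) <= \Rsum_(m <- iota 1 M) dterm_pos a (1 + d) m.
Proof.
move=> a0; have [c c0 Hc] := dseries_prime_lower a0.
have [K K0 HK] := dseries_prime_upper (Rle_refl 0).
exists (c * Rpower (/ (2 * K)) (Rpower 2 a)).
  by apply: Rmult_lt_0_compat => //; exact: Rpower_gt0.
move=> d d0; have s1 : 1 <= 1 + d by lra.
(* Then [(N + 1)^(-d) <= 1/2], so the first [N] terms of [zeta (1 + d)] already amount to
   [1 / (2 * d)]. *)
have [N HN] := INR_unbounded (exp (ln 2 / d)).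
have [M HM] := Hc _ N s1; exists M; apply: Rle_trans HM.
rewrite Rmult_assoc; apply: Rmult_le_compat_l; first lra.
have := HK _ N s1; rewrite Rpower2_0 Rmult_1_l dterm_pos0_sum => h.
have {}h := Rle_trans _ _ _ (zeta_sum_lower N d0) h.
have q0 : 0 < 1 / d by apply: Rdiv_lt_0_compat; lra.
have k0 : 0 < / (2 * K) by apply: Rinv_0_lt_compat; lra.
rewrite Rpower_mult_distr //.
rewrite -Rpower_exp; apply: Rpower_base_le; first exact/Rlt_le/Rpower_gt0.
split; first exact: Rmult_lt_0_compat.
have h2 : Rpower (INR N.+1) (- d) <= 1/2.
  have -> : 1/2 = exp (- ln 2) by rewrite exp_Ropp exp_ln; lra.
  apply: exp_le; have : ln 2 / d <= ln (INR N.+1).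
    rewrite -[X in X <= _]ln_exp; apply: Rlt_le; apply: ln_increasing; first exact: exp_pos.
    by rewrite S_INR; lra.
  move=> H; have := Rmult_le_compat_l d _ _ (Rlt_le _ _ d0) H.
  by rewrite (_ : d * (ln 2 / d) = ln 2); [lra|field; lra].
apply: (Rmult_le_reg_l K) => //; apply: Rle_trans h.
rewrite (_ : K * (/ (2 * K) * (1 / d)) = 1/2 / d); last by field; lra.
by apply: Rmult_le_compat_r; [exact/Rlt_le/Rinv_0_lt_compat|lra].
Qed.

Lemma prod_primes_dvd (s : seq nat) m : uniq s -> all prime s ->
  (forall p, p \in s -> (p %| m)%N) -> (\prod_(p <- s) p %| m)%N.
Proof.
elim: s => [|p s IH] /=; first by rewrite big_nil dvd1n.
move=> /andP[ps us] /andP[pp as_] H; rewrite big_cons Gauss_dvd.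
  rewrite H ?inE ?eqxx //= IH // => q qs; apply: H; by rewrite inE qs orbT.
rewrite prime_coprime //; apply/negP => pd.
have : p \in s.
  elim: s as_ pd {IH us H ps} => [_|q s IH /= /andP[qp as_]].
    by rewrite big_nil dvdn1 => /eqP e; rewrite e in pp.
  rewrite big_cons Euclid_dvdM // dvdn_prime2 // inE => /orP[->//|/(IH as_) ->].
  by rewrite orbT.
by rewrite (negbTE ps).
Qed.

Lemma bin_le_exp2 m k : ('C(m, k) <= 2 ^ m)%N.
Proof.
elim: m k => [|m IH] [|k] //; first by rewrite bin0 expn_gt0.
by rewrite binS expnS mul2n -addnn leq_add.
Qed.

Lemma INR_prod (s : seq nat) : INR (\prod_(p <- s) p)%N = \Rprod_(p <- s) INR p.
Proof. by elim: s => [|p s IH]; rewrite ?big_nil // !big_cons INR_muln IH. Qed.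

(* The primes in (n, 2n] all divide the central binomial coefficient. *)
Lemma sum_ln_primes n :
  \Rsum_(p <- [seq p <- iota n.+1 n | prime p]) ln (INR p) <= INR (2 * n) * ln 2.
Proof.
set s := [seq _ <- _ | _].
have us : uniq s by rewrite filter_uniq // iota_uniq.
have as_ : all prime s by exact: filter_all.
have dv : (\prod_(p <- s) p %| 'C(2 * n, n))%N.
  apply: prod_primes_dvd => // p; rewrite mem_filter mem_iota => /and3P[pp np pn].
  have := bin_fact (leq_pmull n (isT : 0 < 2)%N); rewrite mul2n -addnn addnK => e.
  have : (p %| (n + n)`!)%N by apply: dvdn_fact; rewrite prime_gt0 //= -ltnS -addSn.
  rewrite -e Euclid_dvdM // => /orP[//|].
  have nf : ~~ (p %| n`!)%N.
    elim: n np {pn e s us as_} => [|k IH] np; first by rewrite fact0 dvdn1; apply/negP => /eqP h; rewrite h in pp.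
    rewrite factS Euclid_dvdM // negb_or IH ?andbT; last exact: ltnW.
    by rewrite gtnNdvd.
  by rewrite Euclid_dvdM // (negbTE nf).
have le : INR (\prod_(p <- s) p)%N <= 2 ^ (2 * n).
  rewrite -(INR_expn 2); apply: INR_leq; apply: leq_trans (bin_le_exp2 _ n).
  by apply: dvdn_leq dv; rewrite bin_gt0 leq_pmull.
have -> : \Rsum_(p <- s) ln (INR p) = ln (INR (\prod_(p <- s) p)%N).
  rewrite INR_prod; elim: s us as_ {dv le} => [|p s IH] /=; first by rewrite !big_nil ln_1.
  move=> /andP[_ us] /andP[pp as_]; rewrite !big_cons IH // ln_mult //.
    exact/INR_gt0/prime_gt0.
  by apply: Rprod_gt0 => q qs; apply/INR_gt0/prime_gt0/(allP as_).
have p0 : 0 < INR (\prod_(p <- s) p)%N.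
  rewrite INR_prod; apply: Rprod_gt0 => q qs; apply/INR_gt0/prime_gt0/(allP as_)=> //.
rewrite -ln_pow; last lra.
by case: le => [/(ln_increasing _ _ p0)/Rlt_le//|->]; apply: Rle_refl.
Qed.

(** * Chebyshev's estimate and Poisson averages *)

(** The Poisson weight without its factor [exp (- x)], which for [x = ln m] is [1 / m] and is merged
    with the other powers of [m]. *)
Definition pois (k : nat) (x : R) : R := x ^ k / INR (Factorial.fact k).

Lemma pois_ge0 k x : 0 <= x -> 0 <= pois k x.
Proof.
move=> x0; apply: Rmult_le_pos; first exact: pow_le.
by apply/Rlt_le/Rinv_0_lt_compat/INR_fact_lt_0.
Qed.

Lemma pois0 x : pois 0 x = 1. Proof. by rewrite /pois /=; field. Qed.

Lemma INR_factS k : INR (Factorial.fact k.+1) = INR k.+1 * INR (Factorial.fact k).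
Proof. exact: mult_INR. Qed.

Lemma pois_S k x : INR k.+1 * pois k.+1 x = x * pois k x.
Proof.
rewrite /pois INR_factS -tech_pow_Rmult.
by field; split; [exact: INR_fact_neq_0|exact: not_0_INR].
Qed.

Lemma pois_le k x y : 0 <= x <= y -> pois k x <= pois k y.
Proof.
move=> h; apply: Rmult_le_compat_r; last exact: pow_incr.
by apply/Rlt_le/Rinv_0_lt_compat/INR_fact_lt_0.
Qed.

Lemma pois_scale k c x : pois k (c * x) = c ^ k * pois k x.
Proof. by rewrite /pois Rpow_mult_distr /Rdiv Rmult_assoc. Qed.

Lemma pois_add k x y :
  pois k (x + y) = \Rsum_(i <- iota 0 k.+1) pois (k - i) x * pois i y.
Proof.
rewrite /pois Rplus_comm Binomial.binomial -sum_n_Reals sum_nE [LHS]/Rdiv Rmult_suml big_seq [RHS]big_seq.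
apply: eq_bigr => i _; rewrite /Binomial.C ?minusE; change Init.Nat.sub with subn.
by field; repeat split; exact: INR_fact_neq_0.
Qed.

Lemma pois_sum_le_exp n x : 0 <= x -> \Rsum_(k <- iota 0 n) pois k x <= exp x.
Proof.
move=> x0; case: n => [|n]; first by rewrite big_nil; exact/Rlt_le/exp_pos.
by rewrite -sum_nE sum_n_Reals; exact: exp_ge_taylor.
Qed.

Lemma pois_le_exp k x : 0 <= x -> pois k x <= exp x.
Proof.
move=> x0; apply: Rle_trans (pois_sum_le_exp k.+1 x0); rewrite Rsum_iota0S.
have : 0 <= \Rsum_(j <- iota 0 k) pois j x by apply: Rsum_ge0 => *; exact: pois_ge0.
by lra.
Qed.

(** As a function of [u], this is the integral of the gamma density [exp (- v) v^k / k!] over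
    [v >= u]. *)
Definition pois_tail k u := exp (- u) * \Rsum_(j <- iota 0 k.+1) pois j u.

Lemma pois_tail_bound k u : 0 <= u -> 0 <= pois_tail k u <= 1.
Proof.
move=> u0; have e0 := exp_pos (- u); split.
  apply: Rmult_le_pos; first lra.
  by apply: Rsum_ge0 => *; exact: pois_ge0.
have -> : 1 = exp (- u) * exp u by rewrite -exp_plus Rplus_opp_l exp_0.
by apply: Rmult_le_compat_l; [lra|exact: pois_sum_le_exp].
Qed.

Lemma is_derive_pois k u : is_derive (pois k.+1) u (pois k u).
Proof.
rewrite /pois; auto_derive => //.
change (1 * (INR k.+1 * u ^ k) * / INR (Factorial.fact k.+1) = pois k u); rewrite INR_factS /pois.
by field; split; [exact: INR_fact_neq_0|exact: not_0_INR].
Qed.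

Lemma is_derive_pois_tail k u : is_derive (pois_tail k) u (- (exp (- u) * pois k u)).
Proof.
elim: k => [|k IH].
  apply: (is_derive_ext (fun u => exp (- u))).
    by move=> t; rewrite /pois_tail [iota 0 1]/= big_seq1 pois0 Rmult_1_r.
  by auto_derive => //; rewrite pois0; ring.
apply: (is_derive_ext (fun u => pois_tail k u + exp (- u) * pois k.+1 u)).
  by move=> t; rewrite /pois_tail [in RHS]Rsum_iota0S Rmult_plus_distr_l.
have -> : - (exp (- u) * pois k.+1 u) = - (exp (- u) * pois k u) +
   (- exp (- u) * pois k.+1 u + exp (- u) * pois k u) by ring.
apply: is_derive_plus => //; apply: is_derive_mult.
- by auto_derive => //; ring.
- exact: is_derive_pois.
- by move=> *; apply: Rmult_comm.
Qed.

(** By the mean value theorem: between [u] and [u + h] the factor [v^k / k!] only increases and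
    [exp (- v)] loses at most [exp (- h)]. *)
Lemma pois_tail_step k u h : 0 <= u -> 0 < h ->
  h * (exp (- u) * pois k u) <= exp h * (pois_tail k u - pois_tail k (u + h)).
Proof.
move=> u0 h0.
have [c] := MVT_gen (pois_tail k) u (u + h) (fun v => - (exp (- v) * pois k v))
  (fun x _ => is_derive_pois_tail k x)
  (fun x _ => ltac:(apply/derivable_continuous_pt; eexists; apply/is_derive_Reals/is_derive_pois_tail)).
rewrite Rmin_left ?Rmax_right; try lra; move=> [[uc cu] e].
have -> : pois_tail k u - pois_tail k (u + h) = h * (exp (- c) * pois k c) by lra.
have -> : exp h * (h * (exp (- c) * pois k c)) = h * (exp (h - c) * pois k c).
  by rewrite /Rminus exp_plus; ring.
apply: Rmult_le_compat_l; first lra.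
apply: Rmult_le_compat; [exact/Rlt_le/exp_pos|exact: pois_ge0| |].
  by apply: exp_le; lra.
exact: pois_le.
Qed.

Lemma ln_INR_ge0 m : (0 < m)%N -> 0 <= ln (INR m).
Proof. by move=> m0; rewrite -ln_1; apply: ln_le; [lra|exact: INR_ge1]. Qed.

Lemma INR_exp2 r : INR (2 ^ r) = exp (INR r * ln 2).
Proof. by rewrite INR_expn -Rpower_pow //=; lra. Qed.

(* On the dyadic block (2^r, 2^(r+1)] the density exp (-u) u^k / k! varies by a
   bounded factor, so Chebyshev's bound compares the sum with the integral of this
   density, which is 1. *)
Lemma chebyshev_pois k N :
  \Rsum_(p <- primes_upto N) ln (INR p) * Rpower (INR p) (-2) * pois k (ln (INR p)) <= 8.
Proof.
pose F p := ln (INR p) * Rpower (INR p) (-2) * pois k (ln (INR p)).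
have F0 p : (0 < p)%N -> 0 <= F p.
  move=> p0; have l0 := ln_INR_ge0 p0; apply: Rmult_le_pos; last exact: pois_ge0.
  by apply: Rmult_le_pos => //; exact/Rlt_le/Rpower_gt0.
have ln20 : 0 < ln 2 by have := ln_lt_2; lra.
(* The dyadic block whose logarithms end at [u] is charged to the interval from [u] to [u + ln 2],
   so that the blocks telescope. *)
suff H R : \Rsum_(p <- primes_upto (2 ^ R)) F p <=
    8 * (pois_tail k (ln 2) - pois_tail k (INR R.+1 * ln 2)).
  apply: Rle_trans (_ : \Rsum_(p <- primes_upto (2 ^ N)) F p <= _).
    apply: Rsum_subset; rewrite ?primes_upto_uniq //.
      move=> p; rewrite !mem_filter !mem_iota !add1n !ltnS => /and3P[-> -> pN] /=.
      by apply: leq_trans pN _; apply/ltnW/ltn_expl.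
    by move=> p /mem_primes_upto /prime_gt0; exact: F0.
  have [_ h1] := pois_tail_bound k (Rlt_le _ _ ln20).
  have [h2 _] : 0 <= pois_tail k (INR N.+1 * ln 2) <= 1.
    by apply: pois_tail_bound; apply: Rmult_le_pos; [exact: pos_INR|lra].
  by have := H N; lra.
elim: R => [|r IH]; first by rewrite (_ : primes_upto _ = [::]) // big_nil Rmult_1_l; lra.
have -> : primes_upto (2 ^ r.+1) =
    primes_upto (2 ^ r) ++ [seq p <- iota (2 ^ r).+1 (2 ^ r) | prime p].
  by rewrite /primes_upto expnS mul2n -addnn iotaD filter_cat add1n.
rewrite Rsum_cat.
set u := INR r.+1 * ln 2; rewrite -/u in IH.
have u0 : 0 <= u by apply: Rmult_le_pos; [exact: pos_INR|lra].
have -> : INR r.+2 * ln 2 = u + ln 2 by rewrite (S_INR r.+1) /u; ring.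
suff : \Rsum_(p <- [seq p <- iota (2 ^ r).+1 (2 ^ r) | prime p]) F p <=
  8 * (pois_tail k u - pois_tail k (u + ln 2)) by lra.
have q0 := pois_ge0 k u0.
(* The constant 8 is [4 * 2]: bounding [p^(-2)] by its value at the lower end of the block costs 4,
   and [pois_tail_step] costs [exp (ln 2) = 2]. *)
apply: Rle_trans (_ : 4 * (ln 2 * (exp (- u) * pois k u)) <= _); last first.
  have := pois_tail_step k u0 ln20; rewrite exp_ln; lra.
apply: Rle_trans (_ : \Rsum_(p <- [seq p <- iota (2 ^ r).+1 (2 ^ r) | prime p])
   ln (INR p) * (exp (- 2 * (INR r * ln 2)) * pois k u) <= _).
  apply: Rsum_le => p; rewrite mem_filter mem_iota => /and3P[pp rp pr] _.
  have p0 := prime_gt0 pp; have l0 := ln_INR_ge0 p0; have ip := INR_gt0 p0.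
  rewrite /F Rmult_assoc; apply: Rmult_le_compat_l => //.
  apply: Rmult_le_compat; [exact/Rlt_le/Rpower_gt0|exact: pois_ge0| |].
    apply: exp_le; suff : INR r * ln 2 <= ln (INR p) by lra.
    rewrite -[X in X <= _]ln_exp -INR_exp2; apply: ln_le; last exact/INR_leq/ltnW.
    by apply: INR_gt0; rewrite expn_gt0.
  apply: pois_le; split => //.
  rewrite -[u]ln_exp -INR_exp2; apply: ln_le => //; apply: INR_leq.
  by move: pr; rewrite addSn ltnS addnn -mul2n -expnS.
rewrite -Rmult_suml; have := sum_ln_primes (2 ^ r).
rewrite -expnS INR_exp2 -/u => h.
apply: Rle_trans (Rmult_le_compat_r _ _ _ _ h) _.
  by apply: Rmult_le_pos => //; exact/Rlt_le/exp_pos.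
have -> : exp (- 2 * (INR r * ln 2)) = 4 * exp (- 2 * u).
  have -> : 4 = exp (2 * ln 2) by rewrite (_ : 2 * ln 2 = ln 2 + ln 2) ?exp_plus ?exp_ln; lra.
  by rewrite -exp_plus; congr exp; rewrite /u S_INR; ring.
have -> : exp u * ln 2 * (4 * exp (-2 * u) * pois k u) =
   4 * (ln 2 * ((exp u * exp (-2 * u)) * pois k u)) by ring.
rewrite -exp_plus (_ : u + -2 * u = - u); last ring.
exact: Rle_refl.
Qed.

Lemma ln_le_sqrt x : 0 < x -> ln x <= 2 * Rpower x (1/2).
Proof.
move=> x0; have := ln_le_sub1 (Rpower_gt0 x (1/2)).
by rewrite [ln (Rpower _ _)]ln_exp; lra.
Qed.

(** After [ln p <= 2 * sqrt p], the bound is [2 * (1 + 1 / d)] at [d = 1/2]. *)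
Lemma prime_ln_sum N :
  \Rsum_(p <- primes_upto N) ln (INR p) * (/ INR p)^2 <= 6.
Proof.
apply: Rle_trans (_ : \Rsum_(m <- primes_upto N) 2 * Rpower (INR m) (- (1 + 1/2)) <= _).
  apply: Rsum_le => p /mem_primes_upto /prime_gt0 p0 _; have ip := INR_gt0 p0.
  rewrite (_ : - (1 + 1/2) = 1/2 + - INR 2); last by rewrite /=; lra.
  rewrite Rpower_plus Rpower_Ropp Rpower_pow // pow_inv -Rmult_assoc.
  apply: Rmult_le_compat_r; last exact: ln_le_sqrt.
  by apply/Rlt_le/Rinv_0_lt_compat/pow_lt.
rewrite -Rmult_sumr; have := @zeta_sum_upper (1/2) N ltac:(lra).
suff : \Rsum_(m <- primes_upto N) Rpower (INR m) (- (1 + 1/2)) <=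
   \Rsum_(m <- iota 1 N) Rpower (INR m) (- (1 + 1/2)) by lra.
apply: Rsum_subset; rewrite ?primes_upto_uniq ?iota_uniq //.
  by move=> p; rewrite mem_filter => /andP[].
by move=> i _; apply/Rlt_le/Rpower_gt0.
Qed.

(** The weight [dterm_pos a 2 (p ^ j)] times [j * ln p], the share of [p] in [ln m] when [j] is the
    exact exponent of [p] in [m]. *)
Definition prime_pow_weight a p j :=
  Rpower (INR j.+1) a * Rpower (INR p) (-2) ^ j * (INR j * ln (INR p)).

Lemma prime_pow_weight_ge0 a p j : (0 < p)%N -> 0 <= prime_pow_weight a p j.
Proof.
move=> p0; repeat apply: Rmult_le_pos.
- exact/Rlt_le/Rpower_gt0.
- exact/pow_le/Rlt_le/Rpower_gt0.
- exact: pos_INR.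
- exact: ln_INR_ge0.
Qed.

(** The quantity [L_k] of the overview, truncated to primes up to [N] and exponents below [J]. *)
Definition mangoldt_pois a k J N :=
  \Rsum_(p <- primes_upto N) \Rsum_(j <- iota 0 J)
     prime_pow_weight a p j * pois k (INR j * ln (INR p)).

(** For [j = 1] the crude bound [pois k x <= exp x] would leave the divergent sum of [ln p / p];
    this is where Chebyshev's estimate enters. For [j >= 2] the crude bound is enough: it turns
    [p^(-2j)] into [p^(-j)], and the factor [j] is absorbed by raising the exponent [a] to
    [a + 1]. *)
Lemma mangoldt_pois_bound a : 0 <= a ->
  exists2 K, 0 < K & forall k J N, mangoldt_pois a k J.+2 N <= K.
Proof.
move=> a0; have a1 : 0 <= a + 1 by lra.
have [K K0 HK] := Rsum_poly_geom a1.
exists (Rpower 2 a * 8 + K * 6); first by have := Rpower_gt0 2 a; lra.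
move=> k J N.
apply: Rle_trans (_ : \Rsum_(p <- primes_upto N)
  (Rpower 2 a * (ln (INR p) * Rpower (INR p) (-2) * pois k (ln (INR p))) +
   K * (ln (INR p) * (/ INR p)^2)) <= _); last first.
  rewrite Rsum_split -!Rmult_sumr; apply: Rplus_le_compat.
    by apply: Rmult_le_compat_l; [exact/Rlt_le/Rpower_gt0|exact: chebyshev_pois].
  by apply: Rmult_le_compat_l; [lra|exact: prime_ln_sum].
apply: Rsum_le => p /mem_primes_upto pp _; have p0 := prime_gt0 pp.
have ip := INR_gt0 p0; have l0 := ln_INR_ge0 p0.
rewrite iota0SS !big_cons /prime_pow_weight [INR 0]/= [INR 1]/= [INR 2]/= pow_1 (_ : 1 + 1 = 2) //.
rewrite !(Rmult_0_l, Rmult_0_r, Rmult_1_l, Rplus_0_l); apply: Rplus_le_compat.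
  by rewrite !Rmult_assoc; apply: Req_le; ring.
have p2 : 2 <= INR p by apply: (@INR_leq 2); exact: prime_gt1.
have ip2 : 0 <= / INR p <= 1/2.
  split; first exact/Rlt_le/Rinv_0_lt_compat.
  by rewrite Rdiv_1_l; apply: Rinv_le_contravar; lra.
have := Rmult_le_compat_l _ _ _ l0 (HK J _ ip2); rewrite Rmult_sumr => h.
apply: Rle_trans (Rle_trans _ _ _ h (Req_le _ _ _)); last by ring.
apply: Rsum_le => j _ _; have j0 := pos_INR j.
have jl : 0 <= INR j * ln (INR p) by exact: Rmult_le_pos.
have -> : Rpower (INR p) (-2) ^ j = (/ INR p) ^ j * (/ INR p) ^ j.
  rewrite -Rpow_mult_distr; congr pow.
  rewrite (_ : -2 = Ropp 1 + Ropp 1); last lra.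
  by rewrite Rpower_plus Rpower_Ropp Rpower_1.
have := pois_le_exp k jl.
have -> : exp (INR j * ln (INR p)) = INR p ^ j by rewrite -Rpower_pow.
move=> h1.
have jp := pow_lt _ j (Rinv_0_lt_compat _ ip).
have h2 : (/ INR p) ^ j * pois k (INR j * ln (INR p)) <= 1.
  apply: Rle_trans (Rmult_le_compat_l _ _ _ (Rlt_le _ _ jp) h1) _.
  by rewrite -Rpow_mult_distr Rinv_l ?pow1; lra.
rewrite Rpower_plus Rpower_1; last exact: INR_gt0.
have ra := Rpower_gt0 (INR j.+1) a.
set P := pois _ _ in h1 h2 *; set q := (/ INR p) ^ j in jp h2 *.
set A := Rpower _ a in ra *; set l := ln _ in l0 jl *.
have -> : A * (q * q) * (INR j * l) * P = (A * q * (INR j * l)) * (q * P) by ring.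
apply: Rle_trans (_ : (A * q * (INR j * l)) * 1 <= _).
  by apply: Rmult_le_compat_l => //; repeat apply: Rmult_le_pos => //; lra.
rewrite S_INR; have : 0 <= A * q * l by repeat apply: Rmult_le_pos => //; lra.
by lra.
Qed.

Lemma ln_INR_prime_sum m N : (0 < m)%N -> (m <= N)%N ->
  ln (INR m) <= \Rsum_(p <- primes_upto N) INR (logn p m) * ln (INR p).
Proof.
move=> m0 mN; apply: Rle_trans (_ : \Rsum_(p <- primes m) INR (logn p m) * ln (INR p) <= _); last first.
  apply: Rsum_subset; rewrite ?primes_upto_uniq ?primes_uniq //.
    move=> p; rewrite mem_primes mem_filter mem_iota m0 add1n ltnS /= => /andP[pp pm].
    by rewrite pp prime_gt0 //=; apply: leq_trans mN; apply: dvdn_leq.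
  move=> p /mem_primes_upto /prime_gt0 p0; apply: Rmult_le_pos; first exact: pos_INR.
  exact: ln_INR_ge0.
apply: Req_le; rewrite {1}(prod_prime_decomp m0) prime_decompE big_map /=.
have : all prime (primes m) by apply/allP => p; rewrite mem_primes => /andP[].
elim: (primes m) => [|p s IH] /=; first by rewrite !big_nil ln_1.
move=> /andP[pp as_]; rewrite !big_cons INR_muln INR_expn.
have ip := INR_gt0 (prime_gt0 pp).
rewrite ln_mult ?IH ?ln_pow //; first exact: pow_lt.
apply: INR_gt0; rewrite big_seq; apply: prodn_cond_gt0 => q qs.
by rewrite expn_gt0 prime_gt0 // (allP as_).
Qed.

(** The quantity [S_k] of the overview, truncated at [N]. *)
Definition dpois a k N := \Rsum_(m <- iota 1 N) dterm_pos a 2 m * pois k (ln (INR m)).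

(* log m <= sum_p v_p(m) log p; splitting m = p^j l and dropping the condition
   that p does not divide l only increases the right-hand side. *)
Lemma dpois_rec a k N : INR k.+1 * dpois a k.+1 N <=
  \Rsum_(i <- iota 0 k.+1) mangoldt_pois a (k - i) N.+2 N * dpois a i N.
Proof.
pose T p j l := prime_pow_weight a p j *
   (dterm_pos a 2 l * pois k (INR j * ln (INR p) + ln (INR l))).
apply: Rle_trans (_ : \Rsum_(p <- primes_upto N) \Rsum_(j <- iota 0 N.+2)
   \Rsum_(l <- iota 1 N) T p j l <= _); last first.
  (* The binomial formula [pois_add] separates [p ^ j] from [l]; the rest of this block moves the
     sum over [i] outwards. *)
  apply: Req_le; rewrite /mangoldt_pois /dpois.
  transitivity (\Rsum_(p <- primes_upto N) \Rsum_(j <- iota 0 N.+2)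
     \Rsum_(l <- iota 1 N) \Rsum_(i <- iota 0 k.+1)
       prime_pow_weight a p j * pois (k - i) (INR j * ln (INR p)) *
       (dterm_pos a 2 l * pois i (ln (INR l)))).
    apply: eq_bigr => p _; apply: eq_bigr => j _; apply: eq_bigr => l _.
    by rewrite /T pois_add !Rmult_sumr; apply: eq_bigr => i _; ring.
  transitivity (\Rsum_(p <- primes_upto N) \Rsum_(j <- iota 0 N.+2)
     \Rsum_(i <- iota 0 k.+1) \Rsum_(l <- iota 1 N)
       prime_pow_weight a p j * pois (k - i) (INR j * ln (INR p)) *
       (dterm_pos a 2 l * pois i (ln (INR l)))).
    by apply: eq_bigr => p _; apply: eq_bigr => j _; apply: exchange_big.
  transitivity (\Rsum_(p <- primes_upto N) \Rsum_(i <- iota 0 k.+1)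
     \Rsum_(j <- iota 0 N.+2) \Rsum_(l <- iota 1 N)
       prime_pow_weight a p j * pois (k - i) (INR j * ln (INR p)) *
       (dterm_pos a 2 l * pois i (ln (INR l)))).
    by apply: eq_bigr => p _; apply: exchange_big.
  rewrite exchange_big; apply: eq_bigr => i _; rewrite Rmult_suml.
  apply: eq_bigr => p _; rewrite Rmult_suml; apply: eq_bigr => j _.
  by rewrite Rmult_sumr.
apply: Rle_trans (_ : \Rsum_(m <- iota 1 N) \Rsum_(p <- primes_upto N)
    INR (logn p m) * ln (INR p) * (dterm_pos a 2 m * pois k (ln (INR m))) <= _).
  rewrite /dpois Rmult_sumr; apply: Rsum_le => m; rewrite mem_iota add1n ltnS => /andP[m0 mN] _.
  rewrite -Rmult_suml.
  rewrite (_ : INR k.+1 * (dterm_pos a 2 m * pois k.+1 (ln (INR m))) =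
    dterm_pos a 2 m * (INR k.+1 * pois k.+1 (ln (INR m)))); last by ring.
  rewrite pois_S (_ : dterm_pos a 2 m * (ln (INR m) * pois k (ln (INR m))) =
    ln (INR m) * (dterm_pos a 2 m * pois k (ln (INR m)))); last by ring.
  apply: Rmult_le_compat_r; last exact: ln_INR_prime_sum.
  apply: Rmult_le_pos; first exact/Rlt_le/dterm_pos_gt0.
  exact/pois_ge0/ln_INR_ge0.
rewrite exchange_big; apply: Rsum_le => p /mem_primes_upto pp _.
have p0 := prime_gt0 pp; have ip := INR_gt0 p0.
rewrite Rsum_pairs.
(* A pair [(j, l)] gives back [m = p ^ j * l], so [h] is injective; the pairs outside its image
   contribute nonnegative terms. *)
pose h m := (logn p m, m %/ p ^ logn p m)%N.
have hm m : (0 < m)%N -> exists2 l, ~~ (p %| l)%N & m = (p ^ logn p m * l)%N /\ h m = (logn p m, l).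
  move=> m0; have [l pl em] := pfactor_coprime pp m0; exists l.
    by rewrite -prime_coprime.
  split; first by rewrite mulnC.
  by rewrite /h {2}em mulnK // expn_gt0 p0.
rewrite big_seq_cond.
rewrite (eq_bigr (fun m => T p (h m).1 (h m).2)).
  rewrite -big_seq_cond; apply: (@Rsum_reindex_le _ _ _ _ h (fun x => T p x.1 x.2)).
  - exact: iota_uniq.
  - apply: allpairs_uniq; rewrite ?iota_uniq //.
    by move=> [? ?] [? ?] _ _ [-> ->].
  - move=> m m'; rewrite !mem_iota => /andP[m0 _] /andP[m0' _].
    have [l _ [e ->]] := hm m m0; have [l' _ [e' ->]] := hm m' m0'.
    by move=> [e1 e2]; rewrite e e' e1 e2.
  - move=> m; rewrite mem_iota add1n ltnS => /andP[m0 mN].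
    have [l pl [e ->]] := hm m m0; apply/allpairsP; exists (logn p m, l); split=> //=.
      rewrite -[_ :: _]/(iota 0 N.+2) mem_iota /= add0n ltnS.
      by apply: leq_trans (leqW mN); apply/ltnW/ltn_logl.
    have l0 : (0 < l)%N by case: l e {pl} => // e; rewrite e muln0 in m0.
    rewrite mem_iota l0 add1n ltnS; apply: leq_trans mN; rewrite e.
    by rewrite leq_pmull // expn_gt0 p0.
  - move=> x /allpairsP[[j l] [_ + ->]]; rewrite mem_iota => /andP[l0 _] /=.
    apply: Rmult_le_pos; first exact: prime_pow_weight_ge0.
    apply: Rmult_le_pos; first exact/Rlt_le/dterm_pos_gt0.
    apply: pois_ge0; apply: Rplus_le_le_0_compat; last exact: ln_INR_ge0.
    by apply: Rmult_le_pos; [exact: pos_INR|exact: ln_INR_ge0].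
move=> m; rewrite mem_iota andbT => /andP[m0 _].
have [l pl [e ->]] := hm m m0.
have l0 : (0 < l)%N by case: l e {pl} => // e; rewrite e muln0 in m0.
rewrite /T /prime_pow_weight /= {2 3}e.
have -> : dterm_pos a 2 (p ^ logn p m * l) =
   Rpower (INR (logn p m).+1) a * Rpower (INR p) (-2) ^ logn p m * dterm_pos a 2 l.
  by change (-2) with (Ropp 2); rewrite /dterm_pos dpowM // Rpower_INR_mul //; ring.
have -> : ln (INR (p ^ logn p m * l)) = INR (logn p m) * ln (INR p) + ln (INR l).
  by rewrite INR_muln INR_expn ln_mult ?ln_pow //; [exact: pow_lt|exact: INR_gt0].
by move: (INR (logn p m)) (Rpower _ a) => *; ring.
Qed.

Lemma bernoulli_sub d i : 0 <= d <= 1 -> 1 - INR i * d <= (1 - d) ^ i.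
Proof.
move=> h; elim: i => [|i IH]; first by rewrite /=; lra.
rewrite S_INR -tech_pow_Rmult; have := Rmult_le_compat_l (1 - d) _ _ ltac:(lra) IH.
have := pos_INR i; have : 0 <= INR i * d * d.
  by repeat apply: Rmult_le_pos; try lra; exact: pos_INR.
by nra.
Qed.

Lemma dpois_ge0 a k N : 0 <= dpois a k N.
Proof.
apply: Rsum_ge0 => m; rewrite mem_iota => /andP[m0 _] _.
by apply: Rmult_le_pos; [exact/Rlt_le/dterm_pos_gt0|exact/pois_ge0/ln_INR_ge0].
Qed.

(* Damping by (1 - d)^i >= 1/2 resums the exponential series, at the cost of
   moving the point of evaluation from 2 to 1 + d. *)
Lemma dpois_partial_sum a d k N : 0 < d -> INR k * d <= 1/2 -> d <= 1 ->
  \Rsum_(i <- iota 0 k.+1) dpois a i N <= 2 * \Rsum_(m <- iota 1 N) dterm_pos a (1 + d) m.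
Proof.
move=> d0 kd d1.
apply: Rle_trans (_ : \Rsum_(i <- iota 0 k.+1) 2 * ((1 - d) ^ i * dpois a i N) <= _).
  apply: Rsum_le => i; rewrite mem_iota ltnS => /andP[_ ik] _.
  have di : 0 <= d <= 1 by lra.
  have := bernoulli_sub i di; have : INR i * d <= 1/2.
    by apply: Rle_trans kd; apply: Rmult_le_compat_r; [lra|exact: INR_leq].
  by have := dpois_ge0 a i N; move: (dpois _ _ _) => S; nra.
rewrite -Rmult_sumr; apply: Rmult_le_compat_l; first lra.
have -> : \Rsum_(i <- iota 0 k.+1) (1 - d) ^ i * dpois a i N =
   \Rsum_(m <- iota 1 N) dterm_pos a 2 m *
     \Rsum_(i <- iota 0 k.+1) pois i ((1 - d) * ln (INR m)).
  transitivity (\Rsum_(i <- iota 0 k.+1) \Rsum_(m <- iota 1 N)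
     dterm_pos a 2 m * pois i ((1 - d) * ln (INR m))).
    apply: eq_bigr => i _; rewrite /dpois Rmult_sumr; apply: eq_bigr => m _.
    by rewrite pois_scale; ring.
  by rewrite exchange_big; apply: eq_bigr => m _; rewrite Rmult_sumr.
apply: Rsum_le => m; rewrite mem_iota => /andP[m0 _] _.
have l0 := ln_INR_ge0 m0.
have h := @pois_sum_le_exp k.+1 ((1 - d) * ln (INR m)) ltac:(nra).
apply: Rle_trans (Rmult_le_compat_l _ _ _ (Rlt_le _ _ (dterm_pos_gt0 a 2 m)) h) _.
apply: Req_le; rewrite /dterm_pos Rmult_assoc; congr (_ * _).
by rewrite /Rpower -exp_plus; congr exp; ring.
Qed.

(** The partial sums of the [S_i] are [O(k^(2^a))]. The recursion bounds [(k + 1) S_(k+1)] by such a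
    partial sum, and dividing by [k + 1] lowers the exponent to [2^a - 1]. *)
Lemma dpois_bound a : 0 <= a -> exists2 K, 0 < K & forall k N,
  dpois a k N <= K * Rpower (INR k.+1) (Rpower 2 a - 1).
Proof.
move=> a0; have [L L0 HL] := mangoldt_pois_bound a0.
have [K K0 HK] := dseries_upper a0.
set q := Rpower 2 a; have q0 : 0 < q by exact: Rpower_gt0.
(* The first summand serves index 0. At an index [k >= 1] the 3 comes from
   [1 + 2 * k <= 3 * (k + 1)], and the 4 from the factor 2 in [dpois_partial_sum] together with
   [k + 1 <= 2 * k]. *)
pose M := K * Rpower 2 q + 4 * L * K * Rpower 3 q.
have h2 := Rpower_gt0 2 q; have h3 := Rpower_gt0 3 q.
have t1 : 0 < K * Rpower 2 q by exact: Rmult_lt_0_compat.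
have t2 : 0 < 4 * L * K * Rpower 3 q by repeat apply: Rmult_lt_0_compat => //; lra.
exists M; first by rewrite /M; lra.
move=> [|k] N.
  have := HK 1 N Rlt_0_1; rewrite (_ : 1 + 1 / 1 = 2); last by field.
  rewrite (_ : 1 + 1 = 2); last lra.
  have -> : dpois a 0 N = \Rsum_(m <- iota 1 N) dterm_pos a 2 m.
    by apply: eq_bigr => m _; rewrite pois0 Rmult_1_r.
  have -> : Rpower (INR 1) (q - 1) = 1 by rewrite /Rpower ln_1 Rmult_0_r exp_0.
  by rewrite -/q /M; lra.
set d := 1 / (2 * INR k.+1).
have k0 : 1 <= INR k.+1 by exact: INR_ge1.
have d0 : 0 < d by apply: Rdiv_lt_0_compat; lra.
have e : INR k.+1 * d = 1/2 by rewrite /d; field; lra.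
have kd : INR k * d <= 1/2 by move: e; rewrite S_INR; lra.
have d1 : d <= 1 by nra.
have h1 := Rle_trans _ _ _ (dpois_partial_sum a N d0 kd d1)
   (Rmult_le_compat_l 2 _ _ ltac:(lra) (HK d N d0)).
have {}h1 : INR k.+1 * dpois a k.+1 N <= L * (2 * (K * Rpower (1 + 1 / d) q)).
  apply: Rle_trans (dpois_rec a k N) _.
  apply: Rle_trans (Rmult_le_compat_l _ _ _ (Rlt_le _ _ L0) h1).
  rewrite Rmult_sumr; apply: Rsum_le => i _ _.
  by apply: Rmult_le_compat_r; [exact: dpois_ge0|exact: HL].
have k2 := S_INR k.+1.
have h4 : Rpower (1 + 1 / d) q <= Rpower 3 q * Rpower (INR k.+2) q.
  rewrite Rpower_mult_distr; try lra; apply: Rpower_base_le; first lra.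
  have -> : 1 / d = 2 * INR k.+1 by rewrite /d; field; lra.
  by lra.
have h5 : Rpower (INR k.+2) q = INR k.+2 * Rpower (INR k.+2) (q - 1).
  by rewrite -[X in X * _]Rpower_1 -?Rpower_plus; [congr Rpower; ring|lra].
set P := Rpower (INR k.+2) (q - 1) in h5 *.
have P0 : 0 < P by exact: Rpower_gt0.
have LK : 0 < L * K by exact: Rmult_lt_0_compat.
apply: Rle_trans (_ : 4 * L * K * Rpower 3 q * P <= _); last first.
  by apply: Rmult_le_compat_r; rewrite /M; lra.
apply: (Rmult_le_reg_l (INR k.+1)); first lra.
apply: Rle_trans h1 _; rewrite h5 in h4.
apply: Rle_trans (_ : L * (2 * (K * (Rpower 3 q * (INR k.+2 * P)))) <= _).
  by repeat (apply: Rmult_le_compat_l; first lra).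
have g : 0 < L * K * (Rpower 3 q * P) by apply: Rmult_lt_0_compat => //; exact: Rmult_lt_0_compat.
move: (Rpower 3 q) g => A g; rewrite k2.
have : 0 <= (L * K * (A * P)) * (2 * INR k.+1 - 2) by apply: Rmult_le_pos; lra.
by lra.
Qed.

(** * Weights along the powers of n *)

Lemma nprimefactors_gt0 n : (2 <= n)%N -> (0 < nprimefactors n)%N.
Proof.
move=> n2; have n0 : (0 < n)%N by exact: ltnW.
rewrite nprimefactorsE // -has_predT; apply/hasP; exists (pdiv n) => //.
by rewrite mem_primes pdiv_prime // n0 pdiv_dvd.
Qed.

(** For each prime [p] of [n], with exponent [v >= 1], one has [k + 1 <= k * v + 1 <= v * (k + 1)];
    the witness is the product of these exponents. *)
Lemma ndiv_expn_bounds n : (2 <= n)%N -> exists2 K, (0 < K)%N & forall k,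
  (k.+1 ^ nprimefactors n <= ndiv (n ^ k) <= K * k.+1 ^ nprimefactors n)%N.
Proof.
move=> n2; have n0 : (0 < n)%N by exact: ltnW.
have lp p : p \in primes n -> (0 < logn p n)%N by rewrite logn_gt0.
exists (\prod_(p <- primes n) logn p n)%N.
  by rewrite big_seq; apply: prodn_cond_gt0.
move=> k; rewrite ndiv_expn // nprimefactorsE //.
elim: (primes n) lp => [|p s IH] H; first by rewrite !big_nil.
have {IH}/andP[h1 h2] : (k.+1 ^ size s <= \prod_(p <- s) (k * logn p n).+1 <=
    (\prod_(p <- s) logn p n) * k.+1 ^ size s)%N.
  by apply: IH => q qs; apply: H; rewrite inE qs orbT.
have lp : (0 < logn p n)%N by apply: H; rewrite inE eqxx.
rewrite !big_cons [size _]/= !expnS; apply/andP; split.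
  by apply: leq_mul => //; rewrite ltnS leq_pmulr.
rewrite mulnACA; apply: leq_mul => //.
by rewrite mulnS mulnC -addn1 addnC leq_add2r.
Qed.

Definition critical_exp a n := (Rpower 2 a - 1) / INR (nprimefactors n).

Lemma Rpower2_ge1 a : 0 <= a -> 1 <= Rpower 2 a.
Proof. by move=> a0; apply: Rpower_ge1; lra. Qed.

Lemma critical_exp_ge0 a n : 0 <= a -> (2 <= n)%N -> 0 <= critical_exp a n.
Proof.
move=> a0 n2; apply: Rmult_le_pos; first by have := Rpower2_ge1 a0; lra.
by apply/Rlt_le/Rinv_0_lt_compat/INR_gt0/nprimefactors_gt0.
Qed.

(** At the critical exponent the number of prime factors cancels, and the weights at [n ^ k] match
    the growth of [dpois]. *)
Lemma dpow_expn_bounds a n : 0 <= a -> (2 <= n)%N -> exists2 K, 0 < K & forall k,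
  Rpower (INR k.+1) (Rpower 2 a - 1) <= dpow (critical_exp a n) (n ^ k)
    <= K * Rpower (INR k.+1) (Rpower 2 a - 1).
Proof.
move=> a0 n2; have [K K0 HK] := ndiv_expn_bounds n2.
have c0 := critical_exp_ge0 a0 n2.
exists (Rpower (INR K) (critical_exp a n)); first exact: Rpower_gt0.
move=> k; have /andP[/INR_leq h1 /INR_leq h2] := HK k.
have k0 : 0 < INR k.+1 by exact: INR_gt0.
have pd : 0 < INR k.+1 ^ nprimefactors n by exact: pow_lt.
have -> : Rpower (INR k.+1) (Rpower 2 a - 1) =
    Rpower (INR (k.+1 ^ nprimefactors n)) (critical_exp a n).
  rewrite INR_expn -Rpower_pow // Rpower_mult; congr Rpower; rewrite /critical_exp.
  by field; apply/Rgt_not_eq/INR_gt0/nprimefactors_gt0.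
split; first by apply: Rpower_base_le => //; rewrite INR_expn in h1 *; lra.
rewrite Rpower_mult_distr -?INR_muln; [|exact: INR_gt0|by rewrite INR_expn].
apply: Rpower_base_le => //; rewrite INR_expn in h1; lra.
Qed.

(** One of the two factors [(1 - d)^k] absorbs [(d * (k + 1))^b] through an exponential bound; the
    other sums to at most [1 / d]. *)
Lemma geometric_weight_sum b : 0 <= b -> exists2 K, 0 < K & forall d N, 0 < d < 1 ->
  \Rsum_(k <- iota 0 N) ((1 - d) ^ k) ^ 2 * Rpower (INR k.+1) b <= K * Rpower (1 / d) (b + 1).
Proof.
move=> b0; have [K K0 HK] := Rpower_le_exp b0 Rlt_0_1.
have e1 := exp_pos 1.
exists (K * exp 1); first exact: Rmult_lt_0_compat.
move=> d N d01; have q0 : 0 < 1 / d by apply: Rdiv_lt_0_compat; lra.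
have R0 := Rpower_gt0 (1 / d) b.
have KR : 0 < K * exp 1 * Rpower (1 / d) b by repeat apply: Rmult_lt_0_compat.
apply: Rle_trans (_ : \Rsum_(k <- iota 0 N) K * exp 1 * Rpower (1 / d) b * (1 - d) ^ k <= _).
  apply: Rsum_le => k _ _; have k0 : 0 < INR k.+1 by exact: INR_gt0.
  have x0 : 0 < (1 - d) ^ k by apply: pow_lt; lra.
  have -> : Rpower (INR k.+1) b = Rpower (1 / d) b * Rpower (d * INR k.+1) b.
    by rewrite Rpower_mult_distr //; [congr Rpower; field; lra|nra].
  have h := HK (d * INR k.+1) ltac:(nra).
  have h1 : (1 - d) ^ k * exp (1 * (d * INR k.+1)) <= exp 1.
    have hx : (1 - d) ^ k <= exp (- d * INR k).
      rewrite Rmult_comm -[- d]ln_exp -[exp (_ * ln _)]/(Rpower _ _) Rpower_pow; last exact: exp_pos.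
      by apply: pow_incr; have := exp_ineq1_le (- d); lra.
    apply: Rle_trans (Rmult_le_compat_r _ _ _ (Rlt_le _ _ (exp_pos _)) hx) _.
    by rewrite -exp_plus; apply: exp_le; rewrite S_INR; lra.
  set x := (1 - d) ^ k in x0 h1 *; set P := Rpower (d * _) b in h *.
  set E := exp (1 * _) in h h1; set R := Rpower (1 / d) b in R0 *.
  have -> : x ^ 2 * (R * P) = (R * x) * (x * P) by ring.
  have -> : K * exp 1 * R * x = (R * x) * (K * exp 1) by ring.
  apply: Rmult_le_compat_l; first exact/Rlt_le/Rmult_lt_0_compat.
  apply: Rle_trans (Rmult_le_compat_l _ _ _ (Rlt_le _ _ x0) h) _.
  have := Rmult_le_compat_l _ _ _ (Rlt_le _ _ K0) h1; lra.
rewrite -Rmult_sumr Rpower_plus Rpower_1 // Rmult_assoc -[X in _ <= X]Rmult_assoc.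
rewrite -Rmult_assoc; apply: Rmult_le_compat_l; first lra.
have : \Rsum_(k <- iota 0 N) (1 - d) ^ k = (1 - (1 - d) ^ N) / d.
  elim: N => [|N IH]; first by rewrite big_nil /=; field; lra.
  by rewrite Rsum_iota0S IH /=; field; lra.
move=> ->; apply: Rmult_le_compat_r; first exact/Rlt_le/Rinv_0_lt_compat/(proj1 d01).
by have : 0 < (1 - d) ^ N by [apply: pow_lt; lra]; lra.
Qed.

(** * Complex exponential and double series *)

Lemma is_seriesE (a : nat -> R) (l : R) :
  is_series a l <-> is_lim_seq (fun N => \Rsum_(k <- iota 0 N) a k) l.
Proof.
rewrite (is_lim_seq_incr_1 (fun N => \Rsum_(k <- iota 0 N) a k)).
by split; apply: filterlim_ext => N; rewrite sum_nE.
Qed.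

Lemma is_lim_seq_Rsum (I : Type) (s : seq I) (g : I -> nat -> R) (l : I -> R) :
  (forall i, is_lim_seq (g i) (l i)) ->
  is_lim_seq (fun K => \Rsum_(i <- s) g i K) (\Rsum_(i <- s) l i).
Proof.
move=> H; elim: s => [|i s IH].
  rewrite big_nil; apply: (is_lim_seq_ext (fun _ => 0)); last exact: is_lim_seq_const.
  by move=> K; rewrite big_nil.
rewrite big_cons; apply: (is_lim_seq_ext (fun K => g i K + \Rsum_(i <- s) g i K)).
  by move=> K; rewrite big_cons.
exact: is_lim_seq_plus'.
Qed.

(** Monotonicity of the sums of the nonnegative [v + u] and [v - u]. *)
Lemma Rsum_subset_abs (I : eqType) (s t : seq I) (u v : I -> R) :
  uniq s -> uniq t -> {subset s <= t} -> (forall i, Rabs (u i) <= v i) ->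
  Rabs (\Rsum_(i <- t) u i - \Rsum_(i <- s) u i) <=
  \Rsum_(i <- t) v i - \Rsum_(i <- s) v i.
Proof.
move=> us ut st uv.
have h1 : \Rsum_(i <- s) (v i + u i) <= \Rsum_(i <- t) (v i + u i).
  by apply: Rsum_subset => // i _; have := uv i; split_Rabs; lra.
have h2 : \Rsum_(i <- s) (v i + -1 * u i) <= \Rsum_(i <- t) (v i + -1 * u i).
  by apply: Rsum_subset => // i _; have := uv i; split_Rabs; lra.
by move: h1 h2; rewrite !Rsum_split -!Rmult_sumr; split_Rabs; lra.
Qed.

Lemma pairs_subset (I J : eqType) (s s' : seq I) (t t' : seq J) :
  {subset s <= s'} -> {subset t <= t'} ->
  {subset [seq (i, j) | i <- s, j <- t] <= [seq (i, j) | i <- s', j <- t']}.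
Proof.
move=> ss tt x /allpairsP[[i j] [/ss i' /tt j' ->]].
by apply/allpairsP; exists (i, j).
Qed.

Lemma pairs_uniq (I J : eqType) (s : seq I) (t : seq J) :
  uniq s -> uniq t -> uniq [seq (i, j) | i <- s, j <- t].
Proof. by move=> us ut; apply: allpairs_uniq => // [[? ?] [? ?] _ _ [-> ->]]. Qed.

Lemma iota0_subset M N : (M <= N)%N -> {subset iota 0 M <= iota 0 N}.
Proof. by move=> MN i; rewrite !mem_iota /= !add0n => /leq_trans; apply. Qed.

Lemma is_lim_seq_Rabs_le (u : nat -> R) (l x e : R) (N : nat) :
  is_lim_seq u l -> (forall n, (N <= n)%N -> Rabs (u n - x) <= e) -> Rabs (l - x) <= e.
Proof.
move=> ul H.
have h : is_lim_seq (fun n => Rabs (u n - x)) (Rabs (l - x)).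
  apply: (is_lim_seq_abs _ (Rbar.Finite (l - x))); apply: (is_lim_seq_minus' _ _ _ _ ul); exact: is_lim_seq_const.
have := is_lim_seq_le_loc _ _ _ _ _ h (is_lim_seq_const e); apply.
by exists N => n /leP; apply: H.
Qed.

(** Rectangular sums of [u] move no more than those of [v], which are monotone and bounded. Letting
    one side of the rectangle tend to infinity in the resulting Cauchy estimate gives both iterated
    sums the same limit. *)
Lemma series_fubini (u v : nat -> nat -> R) (U c : nat -> R) (B : R) :
  (forall m k, Rabs (u m k) <= v m k) ->
  (forall M K, \Rsum_(m <- iota 0 M) \Rsum_(k <- iota 0 K) v m k <= B) ->
  (forall m, is_series (u m) (U m)) -> (forall k, is_series (u^~ k) (c k)) ->
  exists l, is_series U l /\ is_series c l.
Proof.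
move=> uv vB rows cols.
pose S M K := \Rsum_(m <- iota 0 M) \Rsum_(k <- iota 0 K) u m k.
pose V M K := \Rsum_(m <- iota 0 M) \Rsum_(k <- iota 0 K) v m k.
have SV M K M' K' : (M <= M')%N -> (K <= K')%N ->
    Rabs (S M' K' - S M K) <= V M' K' - V M K.
  move=> MM KK; rewrite /S /V !Rsum_pairs.
  apply: (@Rsum_subset_abs _ _ _ (fun x => u x.1 x.2) (fun x => v x.1 x.2)) => //;
    rewrite ?pairs_uniq ?iota_uniq //.
  by apply: pairs_subset; apply: iota0_subset.
have key (e : R) : 0 < e -> exists N x, forall M K, (N <= M)%N -> (N <= K)%N ->
    Rabs (S M K - x) <= e.
  move=> e0; have [||s [s1 s2]] := completeness (fun x => exists M K, x = V M K).
  - by exists B => x [M [K ->]]; exact: vB.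
  - by exists (V 0%N 0%N), 0%N, 0%N.
  have [M0 [K0 h0]] : exists M0 K0, s - e < V M0 K0.
    apply: Classical_Prop.NNPP => h; suff : s <= s - e by lra.
    apply: s2 => x [M [K ->]]; apply: Rnot_lt_le => h'; apply: h; by exists M, K.
  exists (maxn M0 K0), (S M0 K0) => M K; rewrite !geq_max => /andP[h1 _] /andP[_ h2].
  apply: Rle_trans (SV _ _ _ _ h1 h2) _.
  by have : V M K <= s by [apply: s1; exists M, K]; lra.
have limU M : is_lim_seq (S M) (\Rsum_(m <- iota 0 M) U m).
  by apply: is_lim_seq_Rsum => m; apply/is_seriesE.
have limc K : is_lim_seq (S^~ K) (\Rsum_(k <- iota 0 K) c k).
  apply: (is_lim_seq_ext (fun M => \Rsum_(k <- iota 0 K) \Rsum_(m <- iota 0 M) u m k)).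
    by move=> M; rewrite exchange_big.
  by apply: is_lim_seq_Rsum => k; apply/is_seriesE; apply: cols.
have keyU (e : R) : 0 < e -> exists N x,
   (forall M, (N <= M)%N -> Rabs (\Rsum_(m <- iota 0 M) U m - x) <= e) /\
   (forall K, (N <= K)%N -> Rabs (\Rsum_(k <- iota 0 K) c k - x) <= e).
  move=> /key[N [x H]]; exists N, x; split=> [M|K] h.
    by apply: (is_lim_seq_Rabs_le (N := N) (limU M)) => K; apply: H.
  by apply: (is_lim_seq_Rabs_le (N := N) (limc K)) => M h'; apply: H.
have cauchy (w : nat -> R) : (forall e : R, 0 < e -> exists N x,
    forall M, (N <= M)%N -> Rabs (w M - x) <= e) -> ex_finite_lim_seq w.
  move=> H; apply/ex_lim_seq_cauchy_corr => e.
  have [|N [x HN]] := H (e / 3); first by have := cond_pos e; lra.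
  exists N => i j /leP/HN h1 /leP/HN h2; have := cond_pos e.
  by move: h1 h2; split_Rabs; lra.
have [|l1 h1] := cauchy (fun M => \Rsum_(m <- iota 0 M) U m).
  by move=> e /keyU[N [x [h _]]]; exists N, x.
have [|l2 h2] := cauchy (fun K => \Rsum_(k <- iota 0 K) c k).
  by move=> e /keyU[N [x [_ h]]]; exists N, x.
exists l1; split; first by apply/is_seriesE.
suff -> : l1 = l2 by apply/is_seriesE.
apply: cond_eq => e e0; have [|N [x [k1 k2]]] := keyU (e / 3); first lra.
have := is_lim_seq_Rabs_le h1 k1; have := is_lim_seq_Rabs_le h2 k2.
by split_Rabs; lra.
Qed.

Lemma fst_sum_n (a : nat -> C) N : fst (sum_n a N) = sum_n (fun k => fst (a k)) N.
Proof. by elim: N => [|N IH]; rewrite ?sum_O // !sum_Sn -IH. Qed.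

Lemma snd_sum_n (a : nat -> C) N : snd (sum_n a N) = sum_n (fun k => snd (a k)) N.
Proof. by elim: N => [|N IH]; rewrite ?sum_O // !sum_Sn -IH. Qed.

Lemma is_series_C (a : nat -> C) (l : C) :
  @is_series C_AbsRing C_NormedModule a l <->
  is_series (fun k => fst (a k)) (fst l) /\ is_series (fun k => snd (a k)) (snd l).
Proof.
split.
  move=> /filterlim_locally H; split; apply/filterlim_locally => e.
    have [N HN] := H e; exists N => n /HN [h _]; rewrite -fst_sum_n; exact: h.
  have [N HN] := H e; exists N => n /HN [_ h]; rewrite -snd_sum_n; exact: h.
move=> [/filterlim_locally H1 /filterlim_locally H2]; apply/filterlim_locally => e.
have [N HN] := H1 e; have [M HM] := H2 e; exists (maxn N M) => n /leP.
rewrite geq_max => /andP[/leP/HN h1 /leP/HM h2]; split.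
  by rewrite -fst_sum_n in h1.
by rewrite -snd_sum_n in h2.
Qed.

Definition cexp (z : C) : C := (exp (fst z) * cos (snd z), exp (fst z) * sin (snd z)).

Lemma cexp_add z w : cexp (z + w)%C = (cexp z * cexp w)%C.
Proof.
rewrite /cexp /Cmult /= exp_plus cos_plus sin_plus.
by congr pair; ring.
Qed.

Lemma cpow_negE m s : cpow_neg m s = cexp (- fst s * ln (INR m), - snd s * ln (INR m)).
Proof.
rewrite /cpow_neg /cexp /= -/(Rpower _ _); congr pair.
  by rewrite [- snd s * _]Ropp_mult_distr_l_reverse cos_neg.
by rewrite [- snd s * _]Ropp_mult_distr_l_reverse sin_neg; ring.
Qed.

Lemma Cmod_cexp z : Cmod (cexp z) = exp (fst z).
Proof.
rewrite /Cmod /cexp /= !Rmult_1_r.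
have -> : exp (fst z) * cos (snd z) * (exp (fst z) * cos (snd z)) +
  exp (fst z) * sin (snd z) * (exp (fst z) * sin (snd z)) =
  (exp (fst z))² * (Rsqr (sin (snd z)) + Rsqr (cos (snd z))) by rewrite /Rsqr; ring.
by rewrite sin2_cos2 Rmult_1_r sqrt_Rsqr //; exact/Rlt_le/exp_pos.
Qed.

Lemma Cmod_cpow_neg m s : Cmod (cpow_neg m s) = Rpower (INR m) (- fst s).
Proof. by rewrite cpow_negE Cmod_cexp. Qed.

Lemma fst_le_Cmod z : Rabs (fst z) <= Cmod z.
Proof. exact: Rle_trans (Rmax_l _ _) (Rmax_Cmod z). Qed.

Lemma snd_le_Cmod z : Rabs (snd z) <= Cmod z.
Proof. exact: Rle_trans (Rmax_r _ _) (Rmax_Cmod z). Qed.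

Lemma deriv_nonneg_le (f df : R -> R) : (forall t, is_derive f t (df t)) ->
  (forall t, 0 <= t <= 1 -> 0 <= df t) -> f 0 = 0 -> forall t, 0 <= t <= 1 -> 0 <= f t.
Proof.
move=> Hf Hdf f0 t t01.
have [c] := MVT_gen f 0 t df (fun x _ => Hf x)
  (fun x _ => ltac:(apply/derivable_continuous_pt; eexists; apply/is_derive_Reals/Hf)).
rewrite Rmin_left ?Rmax_right; try lra; move=> [h e].
have : 0 <= df c * (t - 0) by apply: Rmult_le_pos; [apply: Hdf; lra|lra].
by lra.
Qed.

Lemma deriv_abs_le (f df g dg : R -> R) :
  (forall t, is_derive f t (df t)) -> (forall t, is_derive g t (dg t)) ->
  (forall t, 0 <= t <= 1 -> Rabs (df t) <= dg t) -> f 0 = 0 -> g 0 = 0 ->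
  forall t, 0 <= t <= 1 -> Rabs (f t) <= g t.
Proof.
move=> Hf Hg H f0 g0 t t01.
have h1 : 0 <= g t - f t.
  apply: (deriv_nonneg_le (f := fun t => g t - f t) (df := fun t => dg t - df t)) => //.
  - by move=> x; apply: is_derive_minus.
  - by move=> x /H; split_Rabs; lra.
  - by rewrite f0 g0; lra.
have h2 : 0 <= g t + f t.
  apply: (deriv_nonneg_le (f := fun t => g t + f t) (df := fun t => dg t + df t)) => //.
  - by move=> x; apply: is_derive_plus.
  - by move=> x /H; split_Rabs; lra.
  - by rewrite f0 g0; lra.
by split_Rabs; lra.
Qed.

Lemma is_derive_Rsum_pois (w : nat -> R) N t :
  is_derive (fun t => \Rsum_(k <- iota 0 N.+1) pois k t * w k) t
    (\Rsum_(k <- iota 0 N) pois k t * w k.+1).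
Proof.
elim: N => [|N IH].
  rewrite big_nil; apply: (is_derive_ext (fun _ => w 0%N)); last exact: is_derive_const.
  by move=> x; rewrite Rsum_iota0S big_nil pois0 Rplus_0_l Rmult_1_l.
rewrite Rsum_iota0S.
apply: (is_derive_ext (fun t => \Rsum_(k <- iota 0 N.+1) pois k t * w k + pois N.+1 t * w N.+1)).
  by move=> x; rewrite [in RHS]Rsum_iota0S.
apply: is_derive_plus => //.
apply: (is_derive_ext (fun t => w N.+1 * pois N.+1 t)); first by move=> ?; apply: Rmult_comm.
rewrite Rmult_comm; apply: is_derive_scal; exact: is_derive_pois.
Qed.

Lemma pois_at0 k : pois k.+1 0 = 0.
Proof. by rewrite /pois pow_i ?/Rdiv ?Rmult_0_l //; apply/ltP. Qed.

Lemma Rsum_pois_at0 (w : nat -> R) N : \Rsum_(k <- iota 0 N.+1) pois k 0 * w k = w 0%N.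
Proof.
elim: N => [|N IH]; first by rewrite Rsum_iota0S big_nil pois0; ring.
by rewrite Rsum_iota0S IH pois_at0; ring.
Qed.

(* Differentiating the Taylor remainder of t |-> exp (t z) gives z times the
   previous remainder; integrating from 0 to 1 gives the factorial decay. *)
Lemma cexp_remainder z N t : 0 <= t <= 1 ->
  Rabs (exp (t * fst z) * cos (t * snd z) -
     \Rsum_(k <- iota 0 N) pois k t * fst (Cpow z k)) <=
    exp (Rabs (fst z)) * (Rabs (fst z) + Rabs (snd z)) ^ N * pois N t /\
  Rabs (exp (t * fst z) * sin (t * snd z) -
     \Rsum_(k <- iota 0 N) pois k t * snd (Cpow z k)) <=
    exp (Rabs (fst z)) * (Rabs (fst z) + Rabs (snd z)) ^ N * pois N t.
Proof.
set x := fst z; set y := snd z; set A := Rabs x + Rabs y.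
have A0 : 0 <= A by apply: Rplus_le_le_0_compat; exact: Rabs_pos.
elim: N t => [|N IH] t t01.
  rewrite !big_nil pois0 pow_O !Rmult_1_r !Rminus_0_r !Rabs_mult.
  have e : Rabs (exp (t * x)) <= exp (Rabs x).
    rewrite Rabs_pos_eq; last exact/Rlt_le/exp_pos.
    apply: exp_le; apply: Rle_trans (Rle_abs _) _; rewrite Rabs_mult Rabs_pos_eq; last lra.
    by have := Rabs_pos x; nra.
  have c := COS_bound (t * y); have s := SIN_bound (t * y).
  have e0 := Rabs_pos (exp (t * x)).
  have c1 : Rabs (cos (t * y)) <= 1 by split_Rabs; lra.
  have s1 : Rabs (sin (t * y)) <= 1 by split_Rabs; lra.
  by split; apply: Rle_trans (Rmult_le_compat_l _ _ _ e0 _) _; eauto; lra.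
pose r N t := exp (t * x) * cos (t * y) - \Rsum_(k <- iota 0 N) pois k t * fst (Cpow z k).
pose i N t := exp (t * x) * sin (t * y) - \Rsum_(k <- iota 0 N) pois k t * snd (Cpow z k).
pose G N t := exp (Rabs x) * A ^ N * pois N t.
have dr t' : is_derive (r N.+1) t' (x * r N t' - y * i N t').
  have -> : x * r N t' - y * i N t' = (x * (exp (t' * x) * cos (t' * y)) - y * (exp (t' * x) * sin (t' * y)))
      - \Rsum_(k <- iota 0 N) pois k t' * fst (Cpow z k.+1).
    have -> : \Rsum_(k <- iota 0 N) pois k t' * fst (Cpow z k.+1) =
       x * (\Rsum_(k <- iota 0 N) pois k t' * fst (Cpow z k)) +
       - y * (\Rsum_(k <- iota 0 N) pois k t' * snd (Cpow z k)).
      by rewrite !Rmult_sumr -Rsum_split; apply: eq_bigr => k _; rewrite Cpow_S /= -/x -/y; ring.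
    by rewrite /r /i; ring.
  apply: is_derive_minus; last exact: is_derive_Rsum_pois.
  by auto_derive => //; ring.
have di t' : is_derive (i N.+1) t' (y * r N t' + x * i N t').
  have -> : y * r N t' + x * i N t' = (y * (exp (t' * x) * cos (t' * y)) + x * (exp (t' * x) * sin (t' * y)))
      - \Rsum_(k <- iota 0 N) pois k t' * snd (Cpow z k.+1).
    have -> : \Rsum_(k <- iota 0 N) pois k t' * snd (Cpow z k.+1) =
       y * (\Rsum_(k <- iota 0 N) pois k t' * fst (Cpow z k)) +
       x * (\Rsum_(k <- iota 0 N) pois k t' * snd (Cpow z k)).
      by rewrite !Rmult_sumr -Rsum_split; apply: eq_bigr => k _; rewrite Cpow_S /= -/x -/y; ring.
    by rewrite /r /i; ring.
  apply: is_derive_minus; last exact: is_derive_Rsum_pois.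
  by auto_derive => //; ring.
have dG t' : is_derive (G N.+1) t' (A * G N t').
  rewrite (_ : A * G N t' = exp (Rabs x) * A ^ N.+1 * pois N t'); last by rewrite /G /=; ring.
  by apply: is_derive_scal; exact: is_derive_pois.
have G0 : G N.+1 0 = 0 by rewrite /G pois_at0 Rmult_0_r.
have r0 : r N.+1 0 = 0 by rewrite /r Rsum_pois_at0 !Rmult_0_l exp_0 cos_0 /=; ring.
have i0 : i N.+1 0 = 0 by rewrite /i Rsum_pois_at0 !Rmult_0_l exp_0 sin_0 /=; ring.
split; [apply: (deriv_abs_le dr dG _ r0 G0 t01)|apply: (deriv_abs_le di dG _ i0 G0 t01)];
  move=> t' /IH [h1 h2]; rewrite /A Rmult_plus_distr_r.
- rewrite /Rminus; apply: Rle_trans (Rabs_triang _ _) _; rewrite Rabs_Ropp !Rabs_mult.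
  by apply: Rplus_le_compat; apply: Rmult_le_compat_l => //; exact: Rabs_pos.
- apply: Rle_trans (Rabs_triang _ _) _; rewrite !Rabs_mult Rplus_comm.
  by apply: Rplus_le_compat; apply: Rmult_le_compat_l => //; exact: Rabs_pos.
Qed.

Lemma pois1 k : pois k 1 = / INR (Factorial.fact k).
Proof. by rewrite /pois pow1 Rdiv_1_l. Qed.

Lemma cexp_series z :
  is_series (fun k => / INR (Factorial.fact k) * fst (Cpow z k)) (fst (cexp z)) /\
  is_series (fun k => / INR (Factorial.fact k) * snd (Cpow z k)) (snd (cexp z)).
Proof.
set A := Rabs (fst z) + Rabs (snd z).
have lim0 : is_lim_seq (fun N => exp (Rabs (fst z)) * A ^ N * pois N 1) 0.
  apply: (is_lim_seq_ext (fun N => exp (Rabs (fst z)) * (A ^ N / INR (Factorial.fact N)))).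
    by move=> N; rewrite pois1 Rmult_assoc.
  rewrite -(Rmult_0_r (exp (Rabs (fst z)))); apply: is_lim_seq_mult'; first exact: is_lim_seq_const.
  exact/is_lim_seq_Reals/cv_speed_pow_fact.
have gen (w : nat -> R) (l : R) : (forall N, Rabs (l - \Rsum_(k <- iota 0 N) pois k 1 * w k) <=
    exp (Rabs (fst z)) * A ^ N * pois N 1) -> is_series (fun k => / INR (Factorial.fact k) * w k) l.
  move=> H; apply/is_seriesE.
  apply: (is_lim_seq_ext (fun N => l - (l - \Rsum_(k <- iota 0 N) pois k 1 * w k))).
    move=> N; rewrite (_ : forall u v, u - (u - v) = v); last by move=> *; ring.
    by apply: eq_bigr => k _; rewrite pois1.
  have -> : Rbar.Finite l = Rbar.Finite (l - 0) by rewrite Rminus_0_r.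
  apply: is_lim_seq_minus'; first exact: is_lim_seq_const.
  have lim0' := proj1 (is_lim_seq_opp _ _) lim0; rewrite /= Ropp_0 in lim0'.
  apply: (is_lim_seq_le_le _ _ _ _ _ lim0' lim0) => N.
  by have := H N; split_Rabs; lra.
have H N := @cexp_remainder z N 1 ltac:(lra).
by split; apply: gen => N; have [h1 h2] := H N; rewrite !Rmult_1_l in h1 h2.
Qed.

(** * The coefficients of the image *)

Lemma Rsum_shift (F : nat -> R) N :
  \Rsum_(j <- iota 0 N) F j.+1 = \Rsum_(m <- iota 1 N) F m.
Proof. by rewrite -[1%N]/(1 + 0)%N iotaDl big_map. Qed.

Lemma ex_series_bounded (u : nat -> R) (B : R) : (forall j, 0 <= u j) ->
  (forall N, \Rsum_(j <- iota 0 N) u j <= B) -> ex_series u /\ 0 <= Series u <= B.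
Proof.
move=> u0 uB.
have [l hl] : ex_finite_lim_seq (fun N => \Rsum_(j <- iota 0 N) u j).
  apply: (ex_finite_lim_seq_incr _ B) => // N; rewrite Rsum_iota0S.
  by have := u0 N; lra.
have sl : is_series u l by apply/is_seriesE.
split; first by exists l.
rewrite (is_series_unique _ _ sl); split.
  have := is_lim_seq_le _ _ _ _ _ (is_lim_seq_const 0) hl; apply=> N.
  by apply: Rsum_ge0.
have := is_lim_seq_le _ _ _ _ _ hl (is_lim_seq_const B); apply; exact: uB.
Qed.

Lemma partial_le_Series (u : nat -> R) N : (forall j, 0 <= u j) -> ex_series u ->
  \Rsum_(j <- iota 0 N) u j <= Series u.
Proof.
move=> u0 /Series_correct/is_seriesE h.
apply: (is_lim_seq_incr_compare _ _ h) => n; rewrite Rsum_iota0S.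
by have := u0 n; lra.
Qed.

Lemma ex_series_dominated (u v : nat -> R) (B : R) : (forall j, Rabs (u j) <= v j) ->
  (forall N, \Rsum_(j <- iota 0 N) v j <= B) -> ex_series u.
Proof.
move=> uv vB; apply: (ex_series_le (K := R_AbsRing) (V := R_CompleteNormedModule) u v) => //.
apply: (proj1 (ex_series_bounded _ vB)) => j.
exact: Rle_trans (Rabs_pos _) (uv j).
Qed.

Definition wsum (b : R) (a : nat -> C) (N : nat) :=
  \Rsum_(m <- iota 1 N) (Cmod (a m)) ^ 2 / dpow b m.

Lemma dweight_ge0 b a k : 0 <= dweight b a k.
Proof.
apply: Rmult_le_pos; first exact: pow2_ge_0.
exact/Rlt_le/Rinv_0_lt_compat/Rpower_gt0.
Qed.

Lemma wsumE b a N : wsum b a N = \Rsum_(j <- iota 0 N) dweight b a j.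
Proof. by rewrite /wsum -Rsum_shift. Qed.

Lemma in_D_wsum b a M : 0 <= M -> (forall N, wsum b a N <= M ^ 2) ->
  in_D b a /\ normD b a <= M.
Proof.
move=> M0 H; have [|h1 [h2 h3]] := ex_series_bounded (dweight_ge0 b a) (B := M ^ 2).
  by move=> N; rewrite -wsumE.
by split=> //; rewrite /normD -(sqrt_pow2 M) //; apply: sqrt_le_1_alt.
Qed.

Lemma wsum_le_normD b a N : in_D b a -> wsum b a N <= normD b a ^ 2.
Proof.
move=> aD; rewrite wsumE; apply: Rle_trans (partial_le_Series N (dweight_ge0 b a) aD) _.
rewrite /normD pow2_sqrt; first exact: Rle_refl.
by have := partial_le_Series 0 (dweight_ge0 b a) aD; rewrite big_nil.
Qed.

Lemma normD_ge0 b a : 0 <= normD b a.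
Proof. exact: sqrt_pos. Qed.

Lemma coef_sum_CS a c (w : nat -> R) N :
  (\Rsum_(m <- iota 1 N) Cmod (c m) * w m) ^ 2 <=
  wsum a c N * \Rsum_(m <- iota 1 N) dpow a m * (w m) ^ 2.
Proof.
have h m : 0 < sqrt (dpow a m) by apply/sqrt_lt_R0/dpow_gt0.
have e m : sqrt (dpow a m) ^ 2 = dpow a m by rewrite pow2_sqrt //; exact/Rlt_le/dpow_gt0.
have := Rsum_CauchySchwarz (iota 1 N) (fun m => Cmod (c m) / sqrt (dpow a m))
   (fun m => sqrt (dpow a m) * w m).
rewrite [X in X ^ 2 <= _](eq_bigr (fun m => Cmod (c m) * w m)); last first.
  by move=> m _; field; apply/Rgt_not_eq/h.
rewrite [X in _ <= X * _](eq_bigr (fun m => Cmod (c m) ^ 2 / dpow a m)); last first.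
  by move=> m _; rewrite -[in RHS]e; field; apply/Rgt_not_eq/h.
rewrite [X in _ <= _ * X](eq_bigr (fun m => dpow a m * w m ^ 2)) //.
by move=> m _; rewrite Rpow_mult_distr e.
Qed.

(** Absolute convergence for [Re s > 1/2]: Cauchy-Schwarz leaves the sum of [d(m)^a m^(-2s)], which
    [dseries_upper] bounds at [d = 2 * s - 1]. *)
Lemma coef_abs_sum a c s : 0 <= a -> in_D a c -> 1/2 < s -> exists B, forall N,
  \Rsum_(m <- iota 1 N) Cmod (c m) * Rpower (INR m) (- s) <= B.
Proof.
move=> a0 cD s1; have [K K0 HK] := dseries_upper a0.
set R := Rpower (1 + 1 / (2 * s - 1)) (Rpower 2 a).
exists (sqrt (normD a c ^ 2 * (K * R))) => N.
have S0 : 0 <= \Rsum_(m <- iota 1 N) Cmod (c m) * Rpower (INR m) (- s).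
  by apply: Rsum_ge0 => *; apply: Rmult_le_pos; [exact: Cmod_ge_0|exact/Rlt_le/Rpower_gt0].
rewrite -[X in X <= _](sqrt_pow2 _ S0); apply: sqrt_le_1_alt.
apply: Rle_trans (coef_sum_CS a c _ N) _.
apply: Rmult_le_compat; [| |exact: wsum_le_normD|].
- by rewrite wsumE; apply: Rsum_ge0 => *; exact: dweight_ge0.
- apply: Rsum_ge0 => *; apply: Rmult_le_pos; [exact/Rlt_le/dpow_gt0|exact: pow2_ge_0].
apply: Rle_trans (HK (2 * s - 1) N _); last lra.
apply: Req_le; apply: eq_bigr => m _; rewrite /dterm_pos Rpower_pow_nat.
by congr (_ * Rpower _ _); rewrite /=; ring.
Qed.

(* The coefficient of w^k in m^{-(3/2 - w)}. *)
Definition image_kernel k m := Rpower (INR m) (- (3/2)) * pois k (ln (INR m)).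

Lemma image_kernel_ge0 k m : (0 < m)%N -> 0 <= image_kernel k m.
Proof. by move=> m0; apply: Rmult_le_pos; [exact/Rlt_le/Rpower_gt0|exact/pois_ge0/ln_INR_ge0]. Qed.

(** Halving the logarithm before using [pois_le_exp] costs only [m^(1/2)], and the remaining
    exponent 1 lies in the range of [coef_abs_sum]. *)
Lemma image_kernel_le k m : (0 < m)%N -> image_kernel k m <= 2 ^ k * Rpower (INR m) (- 1).
Proof.
move=> m0; have l0 := ln_INR_ge0 m0.
have h : pois k (ln (INR m)) <= 2 ^ k * Rpower (INR m) (1/2).
  have -> : ln (INR m) = 2 * (1/2 * ln (INR m)) by field.
  rewrite pois_scale; apply: Rmult_le_compat_l; first by apply: pow_le; lra.
  by apply: pois_le_exp; lra.
apply: Rle_trans (Rmult_le_compat_l _ _ _ (Rlt_le _ _ (Rpower_gt0 _ _)) h) _.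
rewrite -Rmult_assoc [_ * 2 ^ k]Rmult_comm Rmult_assoc -Rpower_plus.
by apply: Req_le; congr (_ * Rpower _ _); lra.
Qed.

(* The coefficient of n^{-ks} in f(3/2 - n^{-s}), for f with coefficients c. *)
Definition image_coef (c : nat -> C) k : C :=
  (Series (fun j => fst (c j.+1) * image_kernel k j.+1),
   Series (fun j => snd (c j.+1) * image_kernel k j.+1)).

Lemma image_coef_series a c k : 0 <= a -> in_D a c ->
  is_series (fun j => fst (c j.+1) * image_kernel k j.+1) (fst (image_coef c k)) /\
  is_series (fun j => snd (c j.+1) * image_kernel k j.+1) (snd (image_coef c k)).
Proof.
move=> a0 cD; have s1 : 1/2 < 1 by lra.
have [B HB] := coef_abs_sum a0 cD s1.
have H N : \Rsum_(j <- iota 0 N) 2 ^ k * (Cmod (c j.+1) * Rpower (INR j.+1) (- 1)) <= 2 ^ k * B.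
  rewrite -Rmult_sumr (Rsum_shift (fun m => Cmod (c m) * Rpower (INR m) (- 1))).
  by apply: Rmult_le_compat_l; [apply: pow_le; lra|exact: HB].
have K j := image_kernel_le k (ltn0Sn j); have K0 j := image_kernel_ge0 k (ltn0Sn j).
split; apply: Series_correct; apply: (ex_series_dominated (B := 2 ^ k * B)) H => j;
  rewrite Rabs_mult [Rabs (image_kernel _ _)]Rabs_pos_eq //.
- have h1 := fst_le_Cmod (c j.+1); have h2 := Rabs_pos (fst (c j.+1)).
  by apply: Rle_trans (Rmult_le_compat _ _ _ _ h2 (K0 j) h1 (K j)) _; lra.
- have h1 := snd_le_Cmod (c j.+1); have h2 := Rabs_pos (snd (c j.+1)).
  by apply: Rle_trans (Rmult_le_compat _ _ _ _ h2 (K0 j) h1 (K j)) _; lra.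
Qed.

(* [trunc_log n 0 = 0], so [0] is not a power and [phi_image n c 0 = 0]. *)
Definition is_power (n m : nat) := m == (n ^ trunc_log n m)%N.

Definition phi_image (n : nat) (c : nat -> C) (m : nat) : C :=
  if is_power n m then image_coef c (trunc_log n m) else RtoC 0.

Lemma is_power_expn n k : (1 < n)%N -> is_power n (n ^ k).
Proof. by move=> n1; rewrite /is_power trunc_expnK. Qed.

Lemma image_expn n c k : (1 < n)%N -> phi_image n c (n ^ k) = image_coef c k.
Proof. by move=> n1; rewrite /phi_image is_power_expn // trunc_expnK. Qed.

Lemma Rsum_powers (G : nat -> R) n N : (1 < n)%N ->
  (forall m, ~~ is_power n m -> G m = 0) ->
  \Rsum_(m <- iota 1 N.+1) G m =
  \Rsum_(k <- iota 0 (trunc_log n N.+1).+1) G (n ^ k)%N.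
Proof.
move=> n1 H; elim: N => [|N IH].
  by rewrite trunc_log1 [iota 1 1]/= [iota 0 1]/= !big_seq1 expn0.
rewrite Rsum_iota1S IH.
have /andP[b1 b2] := trunc_log_bounds n1 (ltn0Sn N).
set t := trunc_log n N.+1 in b1 b2 *.
(* The truncated logarithm increases at [N.+2] exactly when [N.+2] is itself the next power of
   [n]. *)
case: (leqP (n ^ t.+1) N.+2) => h.
  have e : N.+2 = (n ^ t.+1)%N by apply/eqP; rewrite eqn_leq h b2.
  by rewrite [in trunc_log _ _]e trunc_expnK // [RHS]Rsum_iota0S -e.
have e : trunc_log n N.+2 = t.
  by apply: trunc_log_eq => //; rewrite h andbT; apply: leq_trans b1 _.
rewrite e H ?Rplus_0_r // /is_power e; apply: contraL b1 => /eqP ep.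
by rewrite -ep -ltnNge.
Qed.

Lemma trunc_log_unbounded n T : (1 < n)%N -> exists N, forall M, (N <= M)%N -> (T <= trunc_log n M)%N.
Proof.
move=> n1; exists (n ^ T)%N => M h.
by rewrite -(trunc_expnK T n1); apply: leq_trunc_log.
Qed.

(** The partial sums over [m] are those over [k], taken along an index that tends to infinity
    slowly. *)
Lemma is_series_powers (G : nat -> R) (l : R) n : (1 < n)%N ->
  (forall m, ~~ is_power n m -> G m = 0) ->
  is_series (fun k => G (n ^ k)%N) l -> is_series (fun j => G j.+1) l.
Proof.
move=> n1 H /is_seriesE h; apply/is_seriesE/is_lim_seq_incr_1.
apply: (is_lim_seq_ext (fun N => \Rsum_(k <- iota 0 (trunc_log n N.+1).+1) G (n ^ k)%N)).
  by move=> N; rewrite (Rsum_shift G) -Rsum_powers.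
apply: (is_lim_seq_subseq _ _ (fun N => (trunc_log n N.+1).+1)) h.
move=> P [T HT]; have [N HN] := trunc_log_unbounded T n1.
exists N => M /leP NM; apply: HT; apply/leP/leqW/HN; exact: leqW.
Qed.

Lemma is_series_Rplus (u v : nat -> R) (x y : R) : is_series u x -> is_series v y ->
  is_series (fun k => u k + v k) (x + y).
Proof. exact: is_series_plus. Qed.

Lemma is_series_Rscal (t : R) (u : nat -> R) (x : R) : is_series u x ->
  is_series (fun k => t * u k) (t * x).
Proof. exact: (is_series_scal t u x). Qed.

Lemma is_series_Cscal (z : C) (u : nat -> C) (x : C) :
  is_series (fun k => fst (u k)) (fst x) -> is_series (fun k => snd (u k)) (snd x) ->
  is_series (fun k => fst (z * u k)%C) (fst (z * x)%C) /\
  is_series (fun k => snd (z * u k)%C) (snd (z * x)%C).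
Proof.
move=> h1 h2; split.
  apply: (is_series_ext (fun k => fst z * fst (u k) + - snd z * snd (u k))).
    by move=> k /=; ring.
  rewrite (_ : fst (z * x)%C = fst z * fst x + - snd z * snd x); last by rewrite /=; ring.
  by apply: is_series_Rplus; apply: is_series_Rscal.
apply: (is_series_ext (fun k => fst z * snd (u k) + snd z * fst (u k))).
  by move=> k /=; ring.
rewrite (_ : snd (z * x)%C = fst z * snd x + snd z * fst x); last by rewrite /=; ring.
by apply: is_series_Rplus; apply: is_series_Rscal.
Qed.

Lemma cexp_pois_series (l : R) (w : C) :
  is_series (fun k => fst (RtoC (pois k l) * Cpow w k)%C) (fst (cexp (RtoC l * w)%C)) /\
  is_series (fun k => snd (RtoC (pois k l) * Cpow w k)%C) (snd (cexp (RtoC l * w)%C)).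
Proof.
have [h1 h2] := cexp_series (RtoC l * w)%C.
have e k : Cpow (RtoC l * w)%C k = (RtoC (l ^ k) * Cpow w k)%C.
  by rewrite Cpow_mult_l RtoC_pow.
split.
  by apply: is_series_ext h1 => k; rewrite e /= /pois; field; exact: INR_fact_neq_0.
by apply: is_series_ext h2 => k; rewrite e /= /pois; field; exact: INR_fact_neq_0.
Qed.

Lemma cpow_neg_phi n s m : (0 < m)%N ->
  cpow_neg m (phi_n n s) =
  (RtoC (Rpower (INR m) (- (3/2))) * cexp (RtoC (ln (INR m)) * cpow_neg n s))%C.
Proof.
move=> m0; rewrite /phi_n [cpow_neg m _]cpow_negE; move: (cpow_neg n s) => w.
have -> : RtoC (Rpower (INR m) (- (3/2))) = cexp (- (3/2) * ln (INR m), 0).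
  by rewrite /cexp /= cos_0 sin_0 Rmult_1_r Rmult_0_r.
by rewrite -cexp_add; congr cexp; rewrite /Cplus /Cmult /=; congr pair; ring.
Qed.

Lemma cpow_neg_expn n k s : (0 < n)%N -> cpow_neg (n ^ k) s = Cpow (cpow_neg n s) k.
Proof.
move=> n0; rewrite !cpow_negE INR_expn ln_pow; last exact: INR_gt0.
elim: k => [|k IH].
  by rewrite /cexp /= !Rmult_0_l !Rmult_0_r exp_0 cos_0 sin_0 /RtoC; congr pair; ring.
rewrite Cpow_S -IH -cexp_add; congr cexp; rewrite S_INR /Cplus /=; congr pair; ring.
Qed.

(** With [rho = |n^(-s)| < 1], summing the absolute values of the double series over [k] first gives
    at most [|c_m| m^(-(3/2 - rho))], which is summable as [3/2 - rho > 1/2]. Summing in either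
    order then gives the two sides. *)
Lemma image_comp_image a n c : 0 <= a -> (1 < n)%N -> in_D a c ->
  comp_image (phi_n n) c (phi_image n c).
Proof.
move=> a0 n1 cD s hs; have n0 := ltnW n1.
set w := cpow_neg n s; set rho := Cmod w.
have rho0 : 0 <= rho by exact: Cmod_ge_0.
have rho1 : rho < 1.
  rewrite /rho Cmod_cpow_neg -(Rpower_O (INR n)); last exact: INR_gt0.
  by apply: Rpower_lt; [apply: (@lt_INR 1); apply/ltP|lra].
pose t j k := (c j.+1 * (RtoC (image_kernel k j.+1) * Cpow w k))%C.
pose v j k := Cmod (c j.+1) * (image_kernel k j.+1 * rho ^ k).
have tv j k : Cmod (t j k) = v j k.
  rewrite /t !Cmod_mult Cmod_R Cmod_pow Rabs_pos_eq //; exact: image_kernel_ge0.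
have s1 : 1/2 < 3/2 - rho by lra.
have [B HB] := coef_abs_sum a0 cD s1.
have vB M K : \Rsum_(j <- iota 0 M) \Rsum_(k <- iota 0 K) v j k <= B.
  apply: Rle_trans (HB M).
  rewrite -(Rsum_shift (fun m => Cmod (c m) * Rpower (INR m) (- (3/2 - rho)))).
  apply: Rsum_le => j _ _; rewrite -Rmult_sumr; apply: Rmult_le_compat_l.
    exact: Cmod_ge_0.
  have l0 := ln_INR_ge0 (ltn0Sn j).
  have -> : - (3/2 - rho) = - (3/2) + rho by ring.
  rewrite Rpower_plus.
  have -> : \Rsum_(k <- iota 0 K) image_kernel k j.+1 * rho ^ k =
      Rpower (INR j.+1) (- (3/2)) * \Rsum_(k <- iota 0 K) pois k (rho * ln (INR j.+1)).
    rewrite Rmult_sumr; apply: eq_bigr => k _; rewrite pois_scale /image_kernel; ring.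
  apply: Rmult_le_compat_l; first exact/Rlt_le/Rpower_gt0.
  by apply: pois_sum_le_exp; apply: Rmult_le_pos.
have rows j : is_series (fun k => fst (t j k)) (fst (dterm c (phi_n n s) j)) /\
    is_series (fun k => snd (t j k)) (snd (dterm c (phi_n n s) j)).
  rewrite /dterm cpow_neg_phi // -/w.
  have [h1 h2] := cexp_pois_series (ln (INR j.+1)) w.
  have [h3 h4] := is_series_Cscal (RtoC (Rpower (INR j.+1) (- (3/2)))) h1 h2.
  have [h5 h6] := is_series_Cscal (c j.+1) h3 h4.
  split; [apply: is_series_ext h5|apply: is_series_ext h6] => k;
    by rewrite /t /image_kernel RtoC_mult -Cmult_assoc.
have cols k : is_series (fun j => fst (t j k)) (fst (image_coef c k * Cpow w k)%C) /\
    is_series (fun j => snd (t j k)) (snd (image_coef c k * Cpow w k)%C).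
  have [h1 h2] := image_coef_series k a0 cD.
  have [h3 h4] := @is_series_Cscal (Cpow w k) (fun j => (fst (c j.+1) * image_kernel k j.+1,
     snd (c j.+1) * image_kernel k j.+1)) (image_coef c k) h1 h2.
  rewrite [(image_coef c k * _)%C]Cmult_comm.
  split; [apply: is_series_ext h3|apply: is_series_ext h4] => j;
    by rewrite /t /=; ring.
have [l1 [r1 c1]] := series_fubini (u := fun j k => fst (t j k)) (v := v)
   (fun j k => Rle_trans _ _ _ (fst_le_Cmod _) (Req_le _ _ (tv j k))) vB
   (fun j => proj1 (rows j)) (fun k => proj1 (cols k)).
have [l2 [r2 c2]] := series_fubini (u := fun j k => snd (t j k)) (v := v)
   (fun j k => Rle_trans _ _ _ (snd_le_Cmod _) (Req_le _ _ (tv j k))) vB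
   (fun j => proj2 (rows j)) (fun k => proj2 (cols k)).
exists (l1, l2); split; first exact/is_series_C.
apply/is_series_C; split.
  apply: (is_series_powers (n := n) (G := fun m => fst (phi_image n c m * cpow_neg m s)%C)) => //.
    by move=> m /negbTE h; rewrite /phi_image h /=; ring.
  by apply: is_series_ext c1 => k; rewrite image_expn // cpow_neg_expn.
apply: (is_series_powers (n := n) (G := fun m => snd (phi_image n c m * cpow_neg m s)%C)) => //.
  by move=> m /negbTE h; rewrite /phi_image h /=; ring.
by apply: is_series_ext c2 => k; rewrite image_expn // cpow_neg_expn.
Qed.

(** * Boundedness at the critical exponent *)

Lemma wsum_ge0 b a N : 0 <= wsum b a N.
Proof. by rewrite wsumE; apply: Rsum_ge0 => *; exact: dweight_ge0. Qed.

Lemma Cmod_sqr z : Cmod z ^ 2 = fst z ^ 2 + snd z ^ 2.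
Proof.
rewrite /Cmod pow2_sqrt //; have := pow2_ge_0 (fst z); have := pow2_ge_0 (snd z); lra.
Qed.

(** The kernel is the Poisson weight times [m^(-1/2)]. Each factor of Cauchy-Schwarz receives a
    square root of the Poisson weight; the one that also takes [m^(-1/2)] squares to [dpois]. *)
Lemma image_kernel_CS a (x : nat -> R) k N :
  (\Rsum_(m <- iota 1 N) x m * image_kernel k m) ^ 2 <=
  (\Rsum_(m <- iota 1 N) x m ^ 2 / dpow a m * (/ INR m * pois k (ln (INR m)))) * dpois a k N.
Proof.
pose p m := / INR m * pois k (ln (INR m)).
have d0 m := dpow_gt0 a m.
have s0 m : 0 < sqrt (dpow a m) by apply/sqrt_lt_R0/d0.
have s2 m : sqrt (dpow a m) ^ 2 = dpow a m by rewrite pow2_sqrt //; exact/Rlt_le/d0.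
have p0 m : (0 < m)%N -> 0 <= p m.
  move=> m0; apply: Rmult_le_pos; last exact/pois_ge0/ln_INR_ge0.
  exact/Rlt_le/Rinv_0_lt_compat/INR_gt0.
have := Rsum_CauchySchwarz (iota 1 N) (fun m => x m / sqrt (dpow a m) * sqrt (p m))
   (fun m => sqrt (dpow a m) * sqrt (p m) * Rpower (INR m) (- (1/2))).
have pos m : m \in iota 1 N -> (0 < m)%N by rewrite mem_iota => /andP[].
have -> : \Rsum_(m <- iota 1 N) x m / sqrt (dpow a m) * sqrt (p m) *
    (sqrt (dpow a m) * sqrt (p m) * Rpower (INR m) (- (1/2))) =
    \Rsum_(m <- iota 1 N) x m * image_kernel k m.
  rewrite big_seq [RHS]big_seq; apply: eq_bigr => m /pos m0.
  transitivity (x m * (sqrt (p m) ^ 2 * Rpower (INR m) (- (1/2)))).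
    by field; exact/Rgt_not_eq.
  rewrite pow2_sqrt ?/p; last exact: p0.
  rewrite /image_kernel (_ : - (3/2) = Ropp 1 + - (1/2)); last lra.
  by rewrite Rpower_plus (Rpower_Ropp _ 1) Rpower_1; [ring|exact: INR_gt0].
have -> : \Rsum_(m <- iota 1 N) (x m / sqrt (dpow a m) * sqrt (p m)) ^ 2 =
   \Rsum_(m <- iota 1 N) x m ^ 2 / dpow a m * p m.
  rewrite big_seq [RHS]big_seq; apply: eq_bigr => m /pos m0.
  rewrite Rpow_mult_distr pow2_sqrt; last exact: p0.
  by rewrite -[in RHS]s2; field; exact/Rgt_not_eq.
have -> // : \Rsum_(m <- iota 1 N) (sqrt (dpow a m) * sqrt (p m) * Rpower (INR m) (- (1/2))) ^ 2 =
   dpois a k N.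
rewrite /dpois big_seq [RHS]big_seq; apply: eq_bigr => m /pos m0.
rewrite !Rpow_mult_distr s2 pow2_sqrt; last exact: p0.
rewrite /dterm_pos /p Rpower_pow_nat (_ : Ropp 2 = Ropp 1 + INR 2 * - (1/2)); last by rewrite /=; lra.
by rewrite Rpower_plus (Rpower_Ropp _ 1) Rpower_1; [ring|exact: INR_gt0].
Qed.

(** Finite and real, so that [image_coef_bound] can apply it to real and imaginary parts and let [N]
    tend to infinity with [T] fixed. *)
Lemma image_kernel_bound a n : 0 <= a -> (2 <= n)%N -> exists2 K, 0 < K & forall x T N,
  \Rsum_(k <- iota 0 T) (\Rsum_(m <- iota 1 N) x m * image_kernel k m) ^ 2 /
     dpow (critical_exp a n) (n ^ k) <= K * \Rsum_(m <- iota 1 N) x m ^ 2 / dpow a m.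
Proof.
move=> a0 n2; have [K K0 HK] := dpois_bound a0; have [E _ HD] := dpow_expn_bounds a0 n2.
exists K => // x T N.
have pos m : m \in iota 1 N -> (0 < m)%N by rewrite mem_iota => /andP[].
have xd m : 0 <= x m ^ 2 / dpow a m.
  apply: Rmult_le_pos; first exact: pow2_ge_0.
  exact/Rlt_le/Rinv_0_lt_compat/dpow_gt0.
apply: Rle_trans (_ : \Rsum_(k <- iota 0 T) K *
   (\Rsum_(m <- iota 1 N) x m ^ 2 / dpow a m * (/ INR m * pois k (ln (INR m)))) <= _).
  apply: Rsum_le => k _ _; have [h1 _] := HD k; have D0 := dpow_gt0 (critical_exp a n) (n ^ k).
  have S0 : 0 <= \Rsum_(m <- iota 1 N) x m ^ 2 / dpow a m * (/ INR m * pois k (ln (INR m))).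
    apply: Rsum_ge0 => m /pos m0 _; apply: Rmult_le_pos => //.
    apply: Rmult_le_pos; last exact/pois_ge0/ln_INR_ge0.
    exact/Rlt_le/Rinv_0_lt_compat/INR_gt0.
  apply: (Rmult_le_reg_r (dpow (critical_exp a n) (n ^ k))) => //.
  rewrite /Rdiv Rmult_assoc Rinv_l; last exact: Rgt_not_eq.
  rewrite Rmult_1_r; apply: Rle_trans (image_kernel_CS a x k N) _.
  rewrite [K * _]Rmult_comm Rmult_assoc; apply: Rmult_le_compat_l => //.
  apply: Rle_trans (HK k N) _; apply: Rmult_le_compat_l => //; lra.
rewrite -Rmult_sumr; apply: Rmult_le_compat_l; first lra.
rewrite exchange_big; apply: Rsum_le => m /pos m0 _; rewrite -Rmult_sumr.
rewrite -[X in _ <= X]Rmult_1_r; apply: Rmult_le_compat_l => //.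
rewrite -Rmult_sumr -(Rinv_l (INR m)); last exact/Rgt_not_eq/INR_gt0.
apply: Rmult_le_compat_l; first exact/Rlt_le/Rinv_0_lt_compat/INR_gt0.
rewrite -[X in _ <= X]exp_ln; last exact: INR_gt0.
exact/pois_sum_le_exp/ln_INR_ge0.
Qed.

Lemma image_coef_bound a n : 0 <= a -> (2 <= n)%N -> exists2 K, 0 < K & forall c T,
  in_D a c -> \Rsum_(k <- iota 0 T) Cmod (image_coef c k) ^ 2 /
     dpow (critical_exp a n) (n ^ k) <= K * normD a c ^ 2.
Proof.
move=> a0 n2; have [K K0 HK] := image_kernel_bound a0 n2.
exists K => // c T cD.
pose S f N k := \Rsum_(m <- iota 1 N) f (c m) * image_kernel k m.
pose D k := dpow (critical_exp a n) (n ^ k).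
have fin N : \Rsum_(k <- iota 0 T) (S fst N k ^ 2 / D k + S snd N k ^ 2 / D k) <= K * normD a c ^ 2.
  rewrite Rsum_split.
  apply: Rle_trans (Rplus_le_compat _ _ _ _ (HK (fun m => fst (c m)) T N) (HK (fun m => snd (c m)) T N)) _.
  rewrite -Rmult_plus_distr_l -Rsum_split; apply: Rmult_le_compat_l; first lra.
  apply: Rle_trans (wsum_le_normD N cD); apply: Req_le; apply: eq_bigr => m _.
  by rewrite Cmod_sqr; field; exact/Rgt_not_eq/dpow_gt0.
have lim (f : C -> R) k : is_series (fun j => f (c j.+1) * image_kernel k j.+1) (f (image_coef c k)) ->
    is_lim_seq (fun N => S f N k ^ 2 / D k) (f (image_coef c k) ^ 2 / D k).
  move=> /is_seriesE h.
  have {}h : is_lim_seq (fun N => S f N k) (f (image_coef c k)).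
    by apply: is_lim_seq_ext h => N; rewrite /S -Rsum_shift.
  have h2 := is_lim_seq_mult' _ _ _ _ h h.
  have := is_lim_seq_mult' _ _ _ _ h2 (is_lim_seq_const (/ D k)).
  rewrite (_ : forall x, x ^ 2 / D k = x * x * / D k) ?/Rdiv; last by move=> x /=; ring.
  by apply: is_lim_seq_ext => N /=; rewrite /Rdiv; ring.
have L : is_lim_seq (fun N => \Rsum_(k <- iota 0 T) (S fst N k ^ 2 / D k + S snd N k ^ 2 / D k))
   (\Rsum_(k <- iota 0 T) (fst (image_coef c k) ^ 2 / D k + snd (image_coef c k) ^ 2 / D k)).
  apply: is_lim_seq_Rsum => k; have [h1 h2] := image_coef_series k a0 cD.
  by apply: is_lim_seq_plus'; [apply: (lim fst)|apply: (lim snd)].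
have := is_lim_seq_le _ _ _ _ fin L (is_lim_seq_const _); rewrite /Rbar_le => h.
apply: Rle_trans h; apply: Req_le; apply: eq_bigr => k _.
by rewrite Cmod_sqr -/(D k); field; exact/Rgt_not_eq/dpow_gt0.
Qed.

Lemma wsum_image b n c N : (2 <= n)%N -> wsum b (phi_image n c) N.+1 =
  \Rsum_(k <- iota 0 (trunc_log n N.+1).+1) Cmod (image_coef c k) ^ 2 / dpow b (n ^ k).
Proof.
move=> n2; rewrite /wsum (Rsum_powers (n := n)) //.
  by apply: eq_bigr => k _; rewrite image_expn.
by move=> m /negbTE h; rewrite /phi_image h Cmod_0 /=; lra.
Qed.

Lemma image_bounded a n : 0 <= a -> (2 <= n)%N -> exists K, forall c, in_D a c ->
  in_D (critical_exp a n) (phi_image n c) /\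
  normD (critical_exp a n) (phi_image n c) <= K * normD a c.
Proof.
move=> a0 n2; have [K K0 HK] := image_coef_bound a0 n2.
exists (sqrt K) => c cD; apply: in_D_wsum.
  by apply: Rmult_le_pos; [exact: sqrt_pos|exact: normD_ge0].
move=> N; rewrite Rpow_mult_distr pow2_sqrt; last lra.
case: N => [|N]; last by rewrite wsum_image //; exact: HK.
rewrite /wsum big_nil; apply: Rmult_le_pos; first lra; exact: pow2_ge_0.
Qed.

Lemma comp_bounded_critical a n : 0 <= a -> (2 <= n)%N ->
  comp_bounded (phi_n n) a (critical_exp a n).
Proof.
move=> a0 n2; have [K HK] := image_bounded a0 n2.
exists K => c cD; exists (phi_image n c); have [h1 h2] := HK c cD; split=> //; split=> //.
exact: image_comp_image a0 _ cD.
Qed.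

(** * Uniqueness of Dirichlet coefficients *)

(** The first nonzero coefficient would dominate for large [s]. Convergence at 1 gives
    [|x_i| <= M i]; at [s = 3 + T] one unit of the 3 absorbs this growth and the other two leave the
    summable [i^(-2)], so the terms after [p + 1] add up to [O((p + 2)^(-T))]. *)
Lemma real_dseries_zero (x : nat -> R) :
  (forall s, 1/2 < s -> is_series (fun j => x j.+1 * Rpower (INR j.+1) (- s)) 0) ->
  forall m, (0 < m)%N -> x m = 0.
Proof.
move=> H; have [M0 HM] : exists M, forall i, (0 < i)%N -> Rabs (x i) <= M * INR i.
  have l0 := ex_series_lim_0 _ (ex_intro _ _ (H 1 ltac:(lra))).
  have [M HM] := filterlim_bounded _ (ex_intro _ 0 l0).
  exists M => i i0; have := HM i.-1; rewrite prednK // /norm /= /abs /= Rabs_mult => h.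
  have ip := INR_gt0 i0.
  rewrite Rpower_Ropp Rpower_1 // [Rabs (/ _)]Rabs_pos_eq in h; last exact/Rlt_le/Rinv_0_lt_compat.
  have := Rmult_le_compat_r _ _ _ (Rlt_le _ _ ip) h.
  by rewrite Rmult_assoc Rinv_l; [rewrite Rmult_1_r|exact: Rgt_not_eq].
have M0' : 0 <= M0 by have := HM 1%N isT; rewrite /= Rmult_1_r; have := Rabs_pos (x 1%N); lra.
elim/ltn_ind=> -[//|p] IH _.
pose m := INR p.+1; have m0 : 0 < m by exact: INR_gt0.
have bound T : Rabs (x p.+1) * Rpower m (- (3 + INR T)) <= M0 * (2 * Rpower (INR p.+2) (- INR T)).
  pose t i := x i * Rpower (INR i) (- (3 + INR T)).
  have h := proj1 (is_seriesE _ _) (H (3 + INR T) ltac:(have := pos_INR T; lra)).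
  have := @is_lim_seq_Rabs_le _ 0 (t p.+1) (M0 * (2 * Rpower (INR p.+2) (- INR T))) p.+1 h.
  rewrite Rminus_0_l Rabs_Ropp /t Rabs_mult [Rabs (Rpower _ _)]Rabs_pos_eq; last exact/Rlt_le/Rpower_gt0.
  apply=> N pN; rewrite (Rsum_shift t).
  have eN : N = (p + (1 + (N - p.+1)))%N by rewrite addnA addn1 subnKC.
  rewrite eN; move: (N - p.+1)%N => r {N pN eN}; rewrite !iotaD !Rsum_cat.
  have -> : \Rsum_(i <- iota 1 p) t i = 0.
    rewrite big_seq big1 // => i; rewrite mem_iota add1n => /andP[i0 ip].
    by rewrite /t IH // Rmult_0_l.
  rewrite [iota _ 1]/= big_seq1 add1n.
  rewrite (_ : 0 + (t p.+1 + _) - t p.+1 = \Rsum_(i <- iota (p.+1 + 1) r) t i); last by ring.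
  have abs (s : seq nat) : Rabs (\Rsum_(i <- s) t i) <= \Rsum_(i <- s) Rabs (t i).
    elim: s => [|i s IHs]; first by rewrite !big_nil Rabs_R0; lra.
    by rewrite !big_cons; apply: Rle_trans (Rabs_triang _ _) _; lra.
  apply: Rle_trans (abs _) _.
  apply: Rle_trans (_ : \Rsum_(i <- iota (p.+1 + 1) r) M0 * Rpower (INR p.+2) (- INR T) * Rpower (INR i) (- (1 + 1)) <= _).
    apply: Rsum_le => i; rewrite mem_iota addn1 => /andP[pi _] _.
    have i0 : (0 < i)%N by apply: leq_trans pi.
    rewrite /t Rabs_mult [Rabs (Rpower _ _)]Rabs_pos_eq; last exact/Rlt_le/Rpower_gt0.
    apply: Rle_trans (Rmult_le_compat_r _ _ _ (Rlt_le _ _ (Rpower_gt0 _ _)) (HM i i0)) _.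
    rewrite !Rmult_assoc; apply: Rmult_le_compat_l => //.
    have -> : - (3 + INR T) = (- (1 + 1) + - INR T) + Ropp 1 by ring.
    rewrite !Rpower_plus Rpower_Ropp Rpower_Ropp [Rpower _ (Ropp 1)]Rpower_Ropp Rpower_1; last exact: INR_gt0.
    rewrite (_ : INR i * (_ * / INR i) = / Rpower (INR i) (1 + 1) * / Rpower (INR i) (INR T)); last first.
      by field; repeat split; apply/Rgt_not_eq; try exact: INR_gt0; exact: Rpower_gt0.
    rewrite Rmult_comm -?Rpower_plus; apply: Rmult_le_compat_r.
      exact/Rlt_le/Rinv_0_lt_compat/Rpower_gt0.
    rewrite [X in _ <= X]Rpower_Ropp; apply: Rinv_le_contravar; first exact: Rpower_gt0.
    apply: Rpower_base_le; first exact: pos_INR.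
    by split; [exact: INR_gt0|exact: INR_leq].
  rewrite -Rmult_sumr Rmult_assoc; apply: Rmult_le_compat_l => //.
  rewrite [2 * _]Rmult_comm; apply: Rmult_le_compat_l; first exact/Rlt_le/Rpower_gt0.
  have := zeta_sum_upper (p.+1 + r) Rlt_0_1; rewrite iotaD Rsum_cat.
  have : 0 <= \Rsum_(i <- iota 1 p.+1) Rpower (INR i) (- (1 + 1)).
    by apply: Rsum_ge0 => *; exact/Rlt_le/Rpower_gt0.
  by rewrite addn1 add1n; lra.
have em : INR p.+2 = m + 1 by exact: S_INR.
rewrite em in bound; clearbody m.
(* Multiplying by [m^(3 + T)] turns the comparison of consecutive integers into geometric decay in
   [T]. *)
pose q := m / (m + 1).
have q01 : 0 < q < 1.
  split; first by apply: Rdiv_lt_0_compat; lra.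
  have -> : q = 1 - / (m + 1) by rewrite /q; field; lra.
  have m1 : 0 < / (m + 1) by apply: Rinv_0_lt_compat; lra.
  by lra.
have b2 T : Rabs (x p.+1) <= 2 * M0 * m ^ 3 * q ^ T.
  have := bound T; rewrite Ropp_plus_distr Rpower_plus !Rpower_Ropp !Rpower_pow //; last lra.
  have -> : Rpower m 3 = m ^ 3 by rewrite -Rpower_pow //; congr Rpower; rewrite /=; ring.
  rewrite /q /Rdiv Rpow_mult_distr pow_inv => h.
  have m3 : 0 < m ^ 3 by exact: pow_lt.
  have mT : 0 < m ^ T by exact: pow_lt.
  have m1T : 0 < (m + 1) ^ T by apply: pow_lt; lra.
  have := Rmult_le_compat_r (m ^ 3 * m ^ T) _ _ ltac:(nra) h.
  rewrite (_ : Rabs (x p.+1) * (/ m ^ 3 * / m ^ T) * (m ^ 3 * m ^ T) = Rabs (x p.+1)); last first.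
    by field; repeat split; exact: Rgt_not_eq.
  by move=> h'; apply: Rle_trans h' _; apply: Req_le; ring.
have lim : is_lim_seq (fun T => 2 * M0 * m ^ 3 * q ^ T) (2 * M0 * m ^ 3 * 0).
  apply: is_lim_seq_mult'; first exact: is_lim_seq_const.
  by apply: is_lim_seq_geom; rewrite Rabs_pos_eq; lra.
have := is_lim_seq_le _ _ _ _ b2 (is_lim_seq_const _) lim; rewrite /Rbar_le Rmult_0_r.
have := Rabs_pos (x p.+1); move=> h1 h2; apply: Rabs_eq_0; lra.
Qed.

(** For real [s] the powers [m^(-s)] are real, so real and imaginary parts of the coefficients
    separate. *)
Lemma dseries_unique (b b' : nat -> C) :
  (forall s : C, 1/2 < fst s -> exists l, dseries_sum b s l /\ dseries_sum b' s l) ->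
  forall m, (0 < m)%N -> b m = b' m.
Proof.
move=> H m m0.
have real_s j (s : R) (z : C) : (z * cpow_neg j (s, IZR 0))%C =
    (fst z * Rpower (INR j) (- s), snd z * Rpower (INR j) (- s)).
  rewrite /cpow_neg /= !Rmult_0_l cos_0 sin_0 /Cmult /=; congr pair; ring.
have K (s : R) : 1/2 < s ->
   is_series (fun j => (fst (b j.+1) - fst (b' j.+1)) * Rpower (INR j.+1) (- s)) 0 /\
   is_series (fun j => (snd (b j.+1) - snd (b' j.+1)) * Rpower (INR j.+1) (- s)) 0.
  move=> s1; have [l [/is_series_C[h1 h2] /is_series_C[h3 h4]]] := H (s, IZR 0) s1.
  split.
    have := is_series_Rplus h1 (@is_series_Rscal (-1) _ _ h3).
    rewrite (_ : fst l + -1 * fst l = 0); last ring.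
    by apply: is_series_ext => j; rewrite /dterm !real_s /=; ring.
  have := is_series_Rplus h2 (@is_series_Rscal (-1) _ _ h4).
  rewrite (_ : snd l + -1 * snd l = 0); last ring.
  by apply: is_series_ext => j; rewrite /dterm !real_s /=; ring.
have e1 := @real_dseries_zero (fun i => fst (b i) - fst (b' i)) (fun s h => proj1 (K s h)) m m0.
have e2 := @real_dseries_zero (fun i => snd (b i) - snd (b' i)) (fun s h => proj2 (K s h)) m m0.
by move: e1 e2; case: (b m) (b' m) => [u v] [u' v'] /= e1 e2; congr pair; lra.
Qed.

(** * Compactness above the critical exponent *)

Lemma INR_ndiv_ge1 m : (0 < m)%N -> 1 <= INR (ndiv m).
Proof. by move=> m0; apply/INR_ge1/ndiv_gt0. Qed.

Lemma wsum_mono b b' c N : b <= b' -> wsum b' c N <= wsum b c N.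
Proof.
move=> bb; apply: Rsum_le => m; rewrite mem_iota => /andP[m0 _] _.
apply: Rmult_le_compat_l; first exact: pow2_ge_0.
apply: Rinv_le_contravar; first exact: dpow_gt0.
by apply: Rle_Rpower => //; exact: INR_ndiv_ge1.
Qed.

Lemma in_D_mono b b' c : b <= b' -> in_D b c -> in_D b' c /\ normD b' c <= normD b c.
Proof.
move=> bb cD; apply: in_D_wsum; first exact: normD_ge0.
by move=> N; apply: Rle_trans (wsum_mono c N bb) _; exact: wsum_le_normD.
Qed.

Lemma wsum_ext b c c' N : (forall m, (0 < m)%N -> c m = c' m) -> wsum b c N = wsum b c' N.
Proof.
move=> H; rewrite /wsum big_seq [RHS]big_seq; apply: eq_bigr => m.
by rewrite mem_iota => /andP[m0 _]; rewrite H.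
Qed.

Lemma in_D_ext b c c' : (forall m, (0 < m)%N -> c m = c' m) -> in_D b c -> in_D b c'.
Proof. by move=> H; apply: ex_series_ext => k; rewrite /dweight H. Qed.

Lemma normD_ext b c c' : (forall m, (0 < m)%N -> c m = c' m) -> normD b c = normD b c'.
Proof.
by move=> H; rewrite /normD; congr sqrt; apply: Series_ext => k; rewrite /dweight H.
Qed.

Lemma Cmod_minus_sqr z w : Cmod (z - w)%C ^ 2 <= 2 * Cmod z ^ 2 + 2 * Cmod w ^ 2.
Proof.
rewrite !Cmod_sqr /=; have := pow2_ge_0 (fst z + fst w).
have := pow2_ge_0 (snd z + snd w); nra.
Qed.

Lemma wsum_minus b c c' N :
  wsum b (fun m => (c m - c' m)%C) N <= 2 * wsum b c N + 2 * wsum b c' N.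
Proof.
rewrite /wsum !Rmult_sumr -Rsum_split; apply: Rsum_le => m _ _.
have h := Rinv_0_lt_compat _ (dpow_gt0 b m); rewrite /Rdiv.
have := Rmult_le_compat_r _ _ _ (Rlt_le _ _ h) (Cmod_minus_sqr (c m) (c' m)); lra.
Qed.

Lemma in_D_minus b c c' : in_D b c -> in_D b c' -> in_D b (fun m => (c m - c' m)%C).
Proof.
move=> cD cD'; set B := 2 * normD b c ^ 2 + 2 * normD b c' ^ 2.
have B0 : 0 <= B by have := pow2_ge_0 (normD b c); have := pow2_ge_0 (normD b c'); rewrite /B; lra.
apply: (proj1 (@in_D_wsum b _ (sqrt B) (sqrt_pos _) _)) => N; rewrite pow2_sqrt //.
apply: Rle_trans (wsum_minus b c c' N) _.
by have := wsum_le_normD N cD; have := wsum_le_normD N cD'; rewrite /B; lra.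
Qed.

Lemma term_le_wsum b c m N : (0 < m)%N -> (m <= N)%N -> Cmod (c m) ^ 2 / dpow b m <= wsum b c N.
Proof.
move=> m0 mN; have := @Rsum_subset _ [:: m] (iota 1 N) (fun m => Cmod (c m) ^ 2 / dpow b m).
rewrite big_seq1; apply; rewrite ?iota_uniq //.
  by move=> i; rewrite inE => /eqP ->; rewrite mem_iota m0 add1n ltnS.
move=> i _; apply: Rmult_le_pos; first exact: pow2_ge_0.
exact/Rlt_le/Rinv_0_lt_compat/dpow_gt0.
Qed.

(** This is what replaces the arbitrary images in [comp_compact] by [phi_image]; the coefficient at
    0 remains free. *)
Lemma comp_image_unique phi a b b' : comp_image phi a b -> comp_image phi a b' ->
  forall m, (0 < m)%N -> b m = b' m.
Proof.
move=> h h'; apply: dseries_unique => s hs.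
have [l [l1 l2]] := h s hs; have [l' [l1' l2']] := h' s hs.
exists l; split=> //; suff -> : l = l' by [].
move: l1 l1' => /is_series_C[p1 p2] /is_series_C[p1' p2'].
have e1 := is_series_unique _ _ p1; have e1' := is_series_unique _ _ p1'.
have e2 := is_series_unique _ _ p2; have e2' := is_series_unique _ _ p2'.
by rewrite [l]surjective_pairing [l']surjective_pairing -e1 -e1' -e2 -e2'.
Qed.

Lemma comp_bounded_mono phi a b b' : b <= b' ->
  comp_bounded phi a b -> comp_bounded phi a b'.
Proof.
move=> bb [K HK]; exists K => c cD; have [f [fD [fi fn]]] := HK c cD.
have [h1 h2] := in_D_mono bb fD.
by exists f; split=> //; split=> //; apply: Rle_trans h2 fn.
Qed.

Lemma comp_compact_mono phi a b b' : b <= b' ->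
  comp_compact phi a b -> comp_compact phi a b'.
Proof.
move=> bb [H1 H2]; split.
  move=> c cD; have [f [fD fi]] := H1 c cD.
  by exists f; split=> //; exact: (proj1 (in_D_mono bb fD)).
move=> c f M H.
(* The given images are known to lie only in the larger space; uniqueness identifies them with
   images in [D_b]. *)
have fD j : in_D b (f j).
  have [cD [_ [_ fi]]] := H j; have [f' [fD' fi']] := H1 _ cD.
  by apply: in_D_ext fD' => m m0; apply: comp_image_unique fi' fi m m0.
have [|s [g [s1 [gD lim]]]] := H2 c f M.
  by move=> j; have [? [? [? ?]]] := H j.
exists s, g; split=> //; split; first exact: (proj1 (in_D_mono bb gD)).
apply: is_lim_seq_le_le (is_lim_seq_const 0) lim => j; split; first exact: normD_ge0.
exact: (proj2 (in_D_mono bb (in_D_minus (fD _) gD))).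
Qed.

(** * Diagonal subsequences *)

Lemma increasing_ge (s : nat -> nat) : (forall j, (s j < s j.+1)%N) -> forall j, (j <= s j)%N.
Proof. by move=> H; elim=> // j IH; apply: leq_ltn_trans IH (H j). Qed.

Lemma increasing_mono (s : nat -> nat) : (forall j, (s j < s j.+1)%N) ->
  forall i j, (i < j)%N -> (s i < s j)%N.
Proof. by move=> H i j; apply: (homo_ltn (r := fun a b => a < b)%N) => // ? ? ?; exact: ltn_trans. Qed.

(** Bolzano-Weierstrass, with the subsequence returned as data so that the extraction can be
    iterated by recursion. *)
Lemma bounded_subsequence (u : nat -> R) B : (forall j, Rabs (u j) <= B) ->
  { s : nat -> nat | (forall j, (s j < s j.+1)%N) /\ ex_finite_lim_seq (fun j => u (s j)) }.
Proof.
move=> H; apply: constructive_indefinite_description.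
have [|l hl] := Bolzano_Weierstrass u _ (compact_P3 (- B) B).
  by move=> j; have := H j; split_Rabs; lra.
have pick i N : { p | (N <= p)%N /\ Rabs (u p - l) < / INR i.+1 }.
  apply: constructive_indefinite_description.
  have i0 : 0 < / INR i.+1 by apply/Rinv_0_lt_compat/INR_gt0.
  have [|p [/leP h1 h2]] := hl (disc l (mkposreal _ i0)) N; last by exists p.
  by exists (mkposreal _ i0) => x.
pose s := fix s i := if i is i'.+1 then sval (pick i (s i').+1) else sval (pick 0%N 0%N).
exists s; split=> [j /=|]; first by case: (pick _ _) => p [].
have hs j : Rabs (u (s j) - l) < / INR j.+1.
  by case: j => [|j]; rewrite [s _]/=; case: (pick _ _) => p [].
exists l; apply/is_lim_seq_spec => e.
have [N HN] := INR_unbounded (/ e).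
exists N => j /leP Nj; apply: Rlt_trans (hs j) _.
have e0 := cond_pos e; rewrite -[X in _ < X]Rinv_inv.
apply: Rinv_lt_contravar.
  by apply: Rmult_lt_0_compat; [exact: Rinv_0_lt_compat|exact: INR_gt0].
by apply: Rlt_le_trans HN _; apply: INR_leq; exact: leqW.
Qed.

Lemma diagonal_subsequence (X : nat -> nat -> R) (B : nat -> R) :
  (forall r j, Rabs (X r j) <= B r) ->
  exists s : nat -> nat, (forall j, (s j < s j.+1)%N) /\
    forall r, ex_finite_lim_seq (fun j => X r (s j)).
Proof.
move=> H.
pose next r (p : nat -> nat) :=
  sval (@bounded_subsequence (fun j => X r (p j)) (B r) (fun j => H r (p j))).
pose P := fix P r := if r is r'.+1 then (fun j => P r' (next r (P r') j)) else next 0%N id.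
have nextP r p : (forall j, (next r p j < next r p j.+1)%N) /\
    ex_finite_lim_seq (fun j => X r (p (next r p j))).
  by rewrite /next; case: bounded_subsequence.
have Pinc r j : (P r j < P r j.+1)%N.
  elim: r j => [|r IH] j; first exact: (proj1 (nextP 0%N id)).
  by apply: increasing_mono IH _ _ _; exact: (proj1 (nextP r.+1 (P r))).
have Plim r : ex_finite_lim_seq (fun j => X r (P r j)).
  by case: r => [|r]; [exact: (proj2 (nextP 0%N id))|exact: (proj2 (nextP r.+1 (P r)))].
exists (fun j => P j j); split.
  move=> j; apply: leq_ltn_trans (_ : (P j (next j.+1 (P j) j) < _)%N).
    have := increasing_ge (proj1 (nextP j.+1 (P j))) j; rewrite leq_eqVlt.
    by case/orP => [/eqP <- //|/(increasing_mono (Pinc j))/ltnW].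
  by apply: increasing_mono (Pinc j) _ _ _; exact: (proj1 (nextP j.+1 (P j))).
move=> r; have [l hl] := Plim r; exists l.
(* For [j >= r] the row [P j] refines [P r], so the diagonal is eventually made of values of [P r]
   at indices tending to infinity. *)
have sub j : (r <= j)%N -> exists i, (j <= i)%N /\ P j j = P r i.
  suff : (r <= j)%N -> forall k, exists i, (k <= i)%N /\ P j k = P r i by move=> h /h.
  elim: j => [|j IH]; first by rewrite leqn0 => /eqP -> k; exists k.
  rewrite leq_eqVlt => /orP[/eqP -> k|]; first by exists k.
  rewrite ltnS => /IH{}IH k; have [i [h1 h2]] := IH (next j.+1 (P j) k).
  exists i; split=> //; apply: leq_trans h1.
  exact: increasing_ge (proj1 (nextP j.+1 (P j))) k.
apply/is_lim_seq_spec => e; move/is_lim_seq_spec: hl => /(_ e) [N HN].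
exists (maxn r N) => j /leP; rewrite geq_max => /andP[rj Nj].
have [i [h1 ->]] := sub j rj; apply: HN; apply/leP; exact: leq_trans h1.
Qed.

(** * Uniformly small tails and compactness *)

Lemma dpow_add b e m : dpow (b + e) m = dpow b m * dpow e m.
Proof. exact: Rpower_plus. Qed.

Lemma ndiv_expn_ge n k : (2 <= n)%N -> (k.+1 <= ndiv (n ^ k))%N.
Proof.
move=> n2; have [K _ /(_ k)/andP[h _]] := ndiv_expn_bounds n2.
by apply: leq_trans h; rewrite -{1}(expn1 k.+1) leq_pexp2l // nprimefactors_gt0.
Qed.

(** The restriction to powers of [n] matters, since [ndiv] equals 2 at every prime; on powers,
    [ndiv (n ^ k) >= k + 1]. *)
Lemma dpow_powers_unbounded n e t : (2 <= n)%N -> 0 < e -> exists N, forall m,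
  (N <= m)%N -> is_power n m -> t <= dpow e m.
Proof.
move=> n2 e0; have [T HT] := INR_unbounded (Rpower (Rabs t + 1) (/ e)).
exists (n ^ T)%N => m hm /eqP em.
have Tm : (T <= trunc_log n m)%N by apply: trunc_log_max.
have t1 : 0 < Rabs t + 1 by have := Rabs_pos t; lra.
apply: Rle_trans (_ : Rabs t + 1 <= _); first by have := Rle_abs t; lra.
have -> : Rabs t + 1 = Rpower (Rpower (Rabs t + 1) (/ e)) e.
  by rewrite Rpower_mult Rinv_l ?Rpower_1 //; lra.
apply: Rpower_base_le; first lra.
split; first exact: Rpower_gt0.
apply: Rle_trans (Rlt_le _ _ HT) _; apply: INR_leq; rewrite em.
by apply: leq_trans (ndiv_expn_ge _ n2); apply: leqW.
Qed.

(** Beyond [N0] the extra exponent [e] shrinks each term by a factor at most [t]. As [N0] does not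
    depend on [c], the tails of a bounded family are uniformly small. *)
Lemma wsum_tail n b e t : (2 <= n)%N -> 0 < e -> 0 < t ->
  exists N0, forall c N, (forall m, (0 < m)%N -> ~~ is_power n m -> c m = RtoC 0) ->
    wsum (b + e) c N <= wsum (b + e) c N0 + t * wsum b c N.
Proof.
move=> n2 e0 t0; have [N0 H0] := dpow_powers_unbounded (/ t) n2 e0.
exists N0 => c N Hc.
case: (leqP N N0) => hN.
  have : wsum (b + e) c N <= wsum (b + e) c N0.
    rewrite !wsumE; apply: Rsum_subset; rewrite ?iota_uniq //; first exact: iota0_subset.
    by move=> *; exact: dweight_ge0.
  by have := wsum_ge0 b c N; nra.
have spl b' : wsum b' c N = wsum b' c N0 +
    \Rsum_(m <- iota N0.+1 (N - N0)) Cmod (c m) ^ 2 / dpow b' m.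
  by rewrite /wsum -Rsum_cat -[N0.+1]add1n -iotaD subnKC // ltnW.
rewrite [in X in X <= _]spl; apply: Rplus_le_compat_l.
rewrite (spl b); apply: Rle_trans (_ : t * (\Rsum_(m <- iota N0.+1 (N - N0)) Cmod (c m) ^ 2 / dpow b m) <= _); last first.
  by have := wsum_ge0 b c N0; nra.
rewrite Rmult_sumr; apply: Rsum_le => m; rewrite mem_iota => /andP[N0m _] _.
have m0 : (0 < m)%N by apply: leq_trans N0m.
case pm : (is_power n m); last by rewrite Hc ?pm // Cmod_0 /=; lra.
rewrite dpow_add /Rdiv Rinv_mult.
have h := H0 m (ltnW N0m) pm; have d1 := dpow_gt0 b m; have d2 := dpow_gt0 e m.
have h' : / dpow e m <= t.
  by rewrite -[t]Rinv_inv; apply: Rinv_le_contravar => //; exact: Rinv_0_lt_compat.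
rewrite -Rmult_assoc Rmult_comm; apply: Rmult_le_compat_r => //.
apply: Rmult_le_pos; first exact: pow2_ge_0.
exact/Rlt_le/Rinv_0_lt_compat.
Qed.

Lemma Cmod_lim_sqr (u : nat -> C) (x : C) :
  is_lim_seq (fun j => fst (u j)) (fst x) -> is_lim_seq (fun j => snd (u j)) (snd x) ->
  is_lim_seq (fun j => Cmod (u j) ^ 2) (Cmod x ^ 2).
Proof.
move=> h1 h2; rewrite Cmod_sqr.
have := is_lim_seq_plus' _ _ _ _ (is_lim_seq_mult' _ _ _ _ h1 h1) (is_lim_seq_mult' _ _ _ _ h2 h2).
rewrite (_ : fst x ^ 2 + snd x ^ 2 = fst x * fst x + snd x * snd x); last by rewrite /=; ring.
by apply: is_lim_seq_ext => j; rewrite Cmod_sqr /=; ring.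
Qed.

Lemma wsum_lim b (f : nat -> nat -> C) (g : nat -> C) N :
  (forall m, (0 < m)%N -> is_lim_seq (fun j => fst (f j m)) (fst (g m)) /\
     is_lim_seq (fun j => snd (f j m)) (snd (g m))) ->
  is_lim_seq (fun j => wsum b (f j) N) (wsum b g N).
Proof.
move=> H; rewrite /wsum -Rsum_shift.
apply: (is_lim_seq_ext (fun j => \Rsum_(i <- iota 0 N) Cmod (f j i.+1) ^ 2 / dpow b i.+1)).
  by move=> j; rewrite (Rsum_shift (fun m => Cmod (f j m) ^ 2 / dpow b m)).
apply: is_lim_seq_Rsum => i; have [h1 h2] := H i.+1 isT.
by apply: is_lim_seq_mult'; [exact: Cmod_lim_sqr|exact: is_lim_seq_const].
Qed.

Lemma image_coords_subsequence (f : nat -> nat -> C) b M :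
  (forall j N, wsum b (f j) N <= M) ->
  exists (s : nat -> nat) (g : nat -> C), (forall j, (s j < s j.+1)%N) /\
    forall m, (0 < m)%N -> is_lim_seq (fun j => fst (f (s j) m)) (fst (g m)) /\
       is_lim_seq (fun j => snd (f (s j) m)) (snd (g m)).
Proof.
move=> H.
(* Real and imaginary parts are interleaved so that one diagonal extraction serves both. The bound
   supplied next rests on [x <= x^2 + 1]. *)
pose X r j := if odd r then snd (f j (r./2).+1) else fst (f j (r./2).+1).
have [r j|s [s1 s2]] := @diagonal_subsequence X (fun r => M * dpow b (r./2).+1 + 1).
  have h : Cmod (f j (r./2).+1) ^ 2 <= M * dpow b (r./2).+1.
    have d0 := dpow_gt0 b (r./2).+1.
    have := Rle_trans _ _ _ (term_le_wsum b (f j) (ltn0Sn r./2) (leqnn _)) (H j _).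
    move/(Rmult_le_compat_r _ _ _ (Rlt_le _ _ d0)).
    by rewrite /Rdiv Rmult_assoc Rinv_l ?Rmult_1_r //; exact: Rgt_not_eq.
  have := Cmod_ge_0 (f j (r./2).+1); have := fst_le_Cmod (f j (r./2).+1).
  have := snd_le_Cmod (f j (r./2).+1); rewrite /X.
  by case: odd; nra.
exists s, (fun m => (real (Lim_seq (fun j => fst (f (s j) m))), real (Lim_seq (fun j => snd (f (s j) m))))).
split=> // -[//|m] _; split=> /=; apply: Lim_seq_correct'.
  by have := s2 m.*2; rewrite /X odd_double doubleK.
by have := s2 m.*2.+1; rewrite /X /= odd_double /= uphalf_double.
Qed.

(** The images are bounded in [D_b], so a subsequence converges coefficientwise, to a limit with the
    same bound. The strict inequality [b < b'] makes the tails uniformly small in [D_b'], which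
    upgrades this to convergence in norm. *)
Lemma comp_compact_of_bounded a n b b' : 0 <= a -> (2 <= n)%N -> b < b' ->
  comp_bounded (phi_n n) a b -> comp_compact (phi_n n) a b'.
Proof.
move=> a0 n2 bb [K HK]; split.
  move=> c cD; have [f [fD [fi _]]] := HK c cD.
  by exists f; split=> //; exact: (proj1 (in_D_mono (Rlt_le _ _ bb) fD)).
move=> c f M H; set B := (Rabs K * Rabs M) ^ 2.
have fB j N : wsum b (f j) N <= B.
  have [cD [cM [_ fi]]] := H j; have [f' [fD' [fi' fn']]] := HK _ cD.
  rewrite (wsum_ext b N (comp_image_unique fi fi')).
  apply: Rle_trans (wsum_le_normD N fD') _; apply: pow_incr.
  split; first exact: normD_ge0.
  apply: Rle_trans fn' _; apply: Rle_trans (_ : Rabs K * normD a (c j) <= _).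
    by apply: Rmult_le_compat_r; [exact: normD_ge0|exact: Rle_abs].
  apply: Rmult_le_compat_l; first exact: Rabs_pos.
  exact: Rle_trans cM (Rle_abs M).
have f0 j m : (0 < m)%N -> ~~ is_power n m -> f j m = RtoC 0.
  move=> m0 pm; have [cD [_ [_ fi]]] := H j.
  rewrite (comp_image_unique fi (image_comp_image a0 n2 cD) m0).
  by rewrite /phi_image (negbTE pm).
have [s [g [s1 hg]]] := image_coords_subsequence fB.
have g0 m : (0 < m)%N -> ~~ is_power n m -> g m = RtoC 0.
  move=> m0 pm; have [h1 h2] := hg m m0.
  have e1 := is_lim_seq_unique _ _ h1; have e2 := is_lim_seq_unique _ _ h2.
  have z1 : Lim_seq (fun j => fst (f (s j) m)) = Rbar.Finite 0.
    by rewrite (Lim_seq_ext _ (fun _ => 0)) ?Lim_seq_const // => j; rewrite f0.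
  have z2 : Lim_seq (fun j => snd (f (s j) m)) = Rbar.Finite 0.
    by rewrite (Lim_seq_ext _ (fun _ => 0)) ?Lim_seq_const // => j; rewrite f0.
  by rewrite [g m]surjective_pairing; move: e1 e2; rewrite z1 z2 => -[<-] [<-].
have gB N : wsum b g N <= B.
  have := is_lim_seq_le _ _ _ _ (fun j => fB (s j) N)
    (@wsum_lim b (fun j => f (s j)) g N hg) (is_lim_seq_const B).
  by [].
have B0 : 0 <= B by exact: pow2_ge_0.
have gD : in_D b g.
  by apply: (proj1 (@in_D_wsum b g (sqrt B) (sqrt_pos _) _)) => N; rewrite pow2_sqrt.
exists s, g; split=> [j|]; first exact/ltP.
split; first exact: (proj1 (in_D_mono (Rlt_le _ _ bb) gD)).
pose h j m := (f (s j) m - g m)%C.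
have hB j N : wsum b (h j) N <= 4 * B.
  by apply: Rle_trans (wsum_minus b _ _ N) _; have := fB (s j) N; have := gB N; lra.
apply/is_lim_seq_spec => e; have e0 := cond_pos e.
(* Makes the tail at most half of [(e / 2)^2], the other half being left for the head; adding 1
   covers [B = 0]. *)
set t := (e / 2) ^ 2 / (2 * (4 * B + 1)).
have e2 : 0 < (e / 2) ^ 2 by apply: pow_lt; lra.
have t0 : 0 < t by apply: Rdiv_lt_0_compat; lra.
have bb0 : 0 < b' - b by lra.
have [N0 HN0] := @wsum_tail n b (b' - b) t n2 bb0 t0.
rewrite (_ : b + (b' - b) = b') in HN0; last by ring.
have lim : is_lim_seq (fun j => wsum b' (h j) N0) 0.
  have := @wsum_lim b' h (fun _ => RtoC 0) N0 _.
  rewrite (_ : wsum b' (fun=> RtoC 0) N0 = 0).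
    apply=> m m0; have [h1 h2] := hg m m0; rewrite /h /=; split.
      rewrite -(Rplus_opp_r (fst (g m))).
      exact: (is_lim_seq_minus' _ _ _ _ h1 (is_lim_seq_const _)).
    rewrite -(Rplus_opp_r (snd (g m))).
    exact: (is_lim_seq_minus' _ _ _ _ h2 (is_lim_seq_const _)).
  by rewrite /wsum big1 // => m _; rewrite Cmod_0 /=; lra.
have e3 : 0 < (e / 2) ^ 2 / 2 by lra.
move/is_lim_seq_spec: lim => /(_ (mkposreal _ e3)) [J HJ].
exists J => j /HJ /= hj; rewrite Rminus_0_r Rabs_pos_eq; last exact: normD_ge0.
apply: Rle_lt_trans (_ : e / 2 < e); last lra.
apply: (proj2 (@in_D_wsum b' (h j) (e / 2) _ _)); first lra.
move=> N; apply: Rle_trans (HN0 (h j) N _) _.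
  move=> m m0 pm; rewrite /h f0 // g0 //; rewrite /Cminus /Cplus /Copp /RtoC /=.
  by congr pair; ring.
have : t * wsum b (h j) N <= (e / 2) ^ 2 / 2.
  apply: Rle_trans (Rmult_le_compat_l _ _ _ (Rlt_le _ _ t0) (hB j N)) _.
  rewrite (_ : (e / 2) ^ 2 / 2 = t * (4 * B + 1)); last by rewrite /t; field; lra.
  by apply: Rmult_le_compat_l; lra.
have h1 := Rle_abs (wsum b' (h j) N0 - 0); move=> h2.
rewrite /= in hj h1 h2 *; lra.
Qed.

(** * Test functions at the critical exponent *)

Lemma is_series_finite (F : nat -> R) N : (forall m, (N < m)%N -> F m = 0) ->
  is_series (fun j => F j.+1) (\Rsum_(m <- iota 1 N) F m).
Proof.
move=> H; apply/is_seriesE/(is_lim_seq_incr_n _ N).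
apply: (is_lim_seq_ext (fun _ => \Rsum_(m <- iota 1 N) F m)); last exact: is_lim_seq_const.
move=> r; rewrite (Rsum_shift F) plusE addnC iotaD Rsum_cat.
rewrite [X in _ = _ + X]big_seq [X in _ = _ + X]big1 ?Rplus_0_r // => m.
by rewrite mem_iota add1n => /andP[h _]; exact: H.
Qed.

Lemma exp_pois_series x : is_series (fun k => pois k x) (exp x).
Proof.
have [h _] := cexp_series (RtoC x); rewrite /cexp /= cos_0 Rmult_1_r in h.
by apply: is_series_ext h => k; rewrite -RtoC_pow /= /pois Rmult_comm.
Qed.

Section TestFunction.
Variables (a d : R) (N : nat).
Hypotheses (d0 : 0 < d) (N0 : (0 < N)%N).

(** The squared norm in [D_a] of the sequence [d(m)^a m^(-(1/2 + d))], [m <= N]. *)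
Let A := \Rsum_(m <- iota 1 N) dterm_pos a (1 + 2 * d) m.

(** The reproducing kernel of [D_a] at the point [1/2 + d], truncated at [N] and normalized. *)
Definition test_coef (m : nat) : R :=
  if (m <= N)%N then dpow a m * Rpower (INR m) (- (1/2 + d)) / sqrt A else 0.

Definition test_fun (m : nat) : C := RtoC (test_coef m).

Let A0 : 0 < A.
Proof.
rewrite /A; case: N N0 => // M _; rewrite [iota _ _]/= big_cons.
have : 0 <= \Rsum_(m <- iota 2 M) dterm_pos a (1 + 2 * d) m.
  by apply: Rsum_ge0 => *; exact/Rlt_le/dterm_pos_gt0.
have := dterm_pos_gt0 a (1 + 2 * d) 1; lra.
Qed.

Let sA0 : 0 < sqrt A. Proof. exact: sqrt_lt_R0. Qed.
Let sA2 : sqrt A ^ 2 = A. Proof. by rewrite pow2_sqrt //; exact: Rlt_le. Qed.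

Lemma test_fun_norm : in_D a test_fun /\ normD a test_fun <= 1.
Proof.
apply: in_D_wsum => [|M]; first lra.
pose F m := Cmod (test_fun m) ^ 2 / dpow a m.
have F0 j : 0 <= F j.
  apply: Rmult_le_pos; first exact: pow2_ge_0.
  exact/Rlt_le/Rinv_0_lt_compat/dpow_gt0.
have /is_seriesE h : is_series (fun j => F j.+1) (\Rsum_(m <- iota 1 N) F m).
  apply: is_series_finite => m; rewrite ltnNge /F /test_fun /test_coef => /negbTE ->.
  by rewrite Cmod_0 /=; lra.
have -> : wsum a test_fun M = \Rsum_(j <- iota 0 M) F j.+1 by rewrite (Rsum_shift F).
apply: Rle_trans (is_lim_seq_incr_compare _ _ h _ M) _.
  by move=> n; rewrite Rsum_iota0S; have := F0 n.+1; lra.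
apply: Req_le; transitivity (\Rsum_(m <- iota 1 N) dterm_pos a (1 + 2 * d) m * / A).
  rewrite big_seq [RHS]big_seq; apply: eq_bigr => m; rewrite mem_iota add1n ltnS => /andP[m0 mN].
  rewrite /F /test_fun /test_coef mN Cmod_R -[Rabs _ ^ 2]Rsqr_pow2 -Rsqr_abs Rsqr_pow2.
  rewrite /Rdiv !Rpow_mult_distr pow_inv sA2 Rpower_pow_nat /dterm_pos.
  rewrite (_ : INR 2 * - (1/2 + d) = - (1 + 2 * d)); last by rewrite /=; lra.
  by field; split; apply/Rgt_not_eq => //; exact: dpow_gt0.
by rewrite -Rmult_suml -/A Rinv_r ?pow1 //; exact: Rgt_not_eq.
Qed.

Let y k := \Rsum_(m <- iota 1 N) dterm_pos a (2 + d) m * pois k (ln (INR m)) / sqrt A.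

Lemma test_fun_coef k : image_coef test_fun k = RtoC (y k).
Proof.
congr pair; apply: is_series_unique.
  have -> : y k = \Rsum_(m <- iota 1 N) fst (test_fun m) * image_kernel k m.
    rewrite /y big_seq [RHS]big_seq; apply: eq_bigr => m; rewrite mem_iota add1n ltnS => /andP[m0 mN].
    rewrite /test_fun /test_coef mN /= /image_kernel /dterm_pos.
    rewrite (_ : - (2 + d) = - (1/2 + d) + - (3/2)); last lra.
    by rewrite Rpower_plus; field; exact: Rgt_not_eq.
  apply: (is_series_finite (F := fun m => fst (test_fun m) * image_kernel k m)) => m.
  by rewrite ltnNge /test_fun /test_coef => /negbTE -> /=; lra.
apply: (is_series_ext (fun _ => 0)); first by move=> j /=; lra.
by apply/is_seriesE; apply: (is_lim_seq_ext (fun _ => 0)) (is_lim_seq_const 0) => M; rewrite big1.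
Qed.

Let y_ge0 k : 0 <= y k.
Proof.
apply: Rsum_ge0 => m; rewrite mem_iota => /andP[m0 _] _.
apply: Rmult_le_pos; last exact/Rlt_le/Rinv_0_lt_compat.
by apply: Rmult_le_pos; [exact/Rlt_le/dterm_pos_gt0|exact/pois_ge0/ln_INR_ge0].
Qed.

(** Dropping [m^(-d)] leaves [dpois], which is bounded uniformly in [N]; so a large [A] forces each
    image coefficient to be small. *)
Lemma test_fun_coef_le k : Cmod (image_coef test_fun k) ^ 2 <= dpois a k N ^ 2 / A.
Proof.
rewrite test_fun_coef Cmod_R Rabs_pos_eq //.
have -> : dpois a k N ^ 2 / A = (dpois a k N * / sqrt A) ^ 2.
  by rewrite Rpow_mult_distr pow_inv sA2.
apply: pow_incr; split=> //; rewrite /y -Rmult_suml.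
apply: Rmult_le_compat_r; first exact/Rlt_le/Rinv_0_lt_compat.
apply: Rsum_le => m; rewrite mem_iota => /andP[m0 _] _.
apply: Rmult_le_compat_r; first exact/pois_ge0/ln_INR_ge0.
apply: Rmult_le_compat_l; first exact/Rlt_le/dpow_gt0.
by apply: Rle_Rpower; [exact: INR_ge1|lra].
Qed.

(* The generating function of the image coefficients at 1 - d is the test
   function evaluated at 3/2 - (1 - d). *)
Lemma test_fun_gen : is_lim_seq (fun T => \Rsum_(k <- iota 0 T) y k * (1 - d) ^ k) (sqrt A).
Proof.
have -> : sqrt A = \Rsum_(m <- iota 1 N) dterm_pos a (2 + d) m / sqrt A * exp ((1 - d) * ln (INR m)).
  transitivity (A * / sqrt A); first by rewrite -{2}sA2; field; exact: Rgt_not_eq.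
  rewrite /A Rmult_suml; apply: eq_bigr => m _.
  rewrite /dterm_pos -[exp _]/(Rpower (INR m) (1 - d)).
  rewrite (_ : - (1 + 2 * d) = - (2 + d) + (1 - d)); last by ring.
  by rewrite Rpower_plus /Rdiv; ring.
apply: (is_lim_seq_ext (fun T => \Rsum_(m <- iota 1 N) dterm_pos a (2 + d) m / sqrt A *
    \Rsum_(k <- iota 0 T) pois k ((1 - d) * ln (INR m)))).
  move=> T; transitivity (\Rsum_(m <- iota 1 N) \Rsum_(k <- iota 0 T)
      dterm_pos a (2 + d) m / sqrt A * pois k ((1 - d) * ln (INR m))).
    by apply: eq_bigr => m _; rewrite Rmult_sumr.
  rewrite exchange_big; apply: eq_bigr => k _; rewrite /y Rmult_suml.
  by apply: eq_bigr => m _; rewrite pois_scale /Rdiv; ring.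
apply: is_lim_seq_Rsum => m; apply: is_lim_seq_mult'; first exact: is_lim_seq_const.
exact/is_seriesE/exp_pois_series.
Qed.

(** Here [W] bounds the squared norm of the image and [V] that of the evaluation at
    [n^(-s) = 1 - d]. The evaluation equals [sqrt A], so Cauchy-Schwarz bounds the image norm from
    below. *)
Lemma test_fun_lower (D : nat -> R) (W V : R) : (forall k, 0 < D k) ->
  (forall T, \Rsum_(k <- iota 0 T) Cmod (image_coef test_fun k) ^ 2 / D k <= W) ->
  (forall T, \Rsum_(k <- iota 0 T) ((1 - d) ^ k) ^ 2 * D k <= V) -> A <= W * V.
Proof.
move=> D0 HW HV.
have sD k : 0 < sqrt (D k) by exact: sqrt_lt_R0.
have sD2 k : sqrt (D k) ^ 2 = D k by rewrite pow2_sqrt //; exact: Rlt_le.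
have W0 : 0 <= W by have := HW 0%N; rewrite big_nil.
have V0 : 0 <= V by have := HV 0%N; rewrite big_nil.
have H T : (\Rsum_(k <- iota 0 T) y k * (1 - d) ^ k) * (\Rsum_(k <- iota 0 T) y k * (1 - d) ^ k) <= W * V.
  have := Rsum_CauchySchwarz (iota 0 T) (fun k => y k / sqrt (D k)) (fun k => (1 - d) ^ k * sqrt (D k)).
  have -> : \Rsum_(k <- iota 0 T) y k / sqrt (D k) * ((1 - d) ^ k * sqrt (D k)) =
     \Rsum_(k <- iota 0 T) y k * (1 - d) ^ k.
    by apply: eq_bigr => k _; field; exact: Rgt_not_eq.
  have -> : \Rsum_(k <- iota 0 T) (y k / sqrt (D k)) ^ 2 =
     \Rsum_(k <- iota 0 T) Cmod (image_coef test_fun k) ^ 2 / D k.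
    apply: eq_bigr => k _; rewrite test_fun_coef Cmod_R Rabs_pos_eq //.
    by rewrite /Rdiv Rpow_mult_distr pow_inv sD2.
  have -> : \Rsum_(k <- iota 0 T) ((1 - d) ^ k * sqrt (D k)) ^ 2 =
     \Rsum_(k <- iota 0 T) ((1 - d) ^ k) ^ 2 * D k.
    by apply: eq_bigr => k _; rewrite Rpow_mult_distr sD2.
  rewrite (_ : forall x, x ^ 2 = x * x); last by move=> x /=; ring.
  move=> h; apply: Rle_trans h _; apply: Rmult_le_compat => //.
    apply: Rsum_ge0 => k _ _; apply: Rmult_le_pos; first exact: pow2_ge_0.
    exact/Rlt_le/Rinv_0_lt_compat.
  by apply: Rsum_ge0 => k _ _; apply: Rmult_le_pos; [exact: pow2_ge_0|exact/Rlt_le].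
have := is_lim_seq_le _ _ _ _ H (is_lim_seq_mult' _ _ _ _ test_fun_gen test_fun_gen) (is_lim_seq_const _).
by rewrite /Rbar_le -{3}sA2 /= Rmult_1_r.
Qed.

End TestFunction.

Lemma image_coef_le_normD n b c T : (2 <= n)%N -> in_D b (phi_image n c) ->
  \Rsum_(k <- iota 0 T) Cmod (image_coef c k) ^ 2 / dpow b (n ^ k) <= normD b (phi_image n c) ^ 2.
Proof.
move=> n2 cD; have p0 : (0 < n ^ T)%N by rewrite expn_gt0 ltnW.
apply: Rle_trans (wsum_le_normD (n ^ T) cD).
rewrite -(prednK p0) wsum_image // prednK // trunc_expnK //.
rewrite [X in _ <= X]Rsum_iota0S; set u := _ / _; suff : 0 <= u by lra.
apply: Rmult_le_pos; first exact: pow2_ge_0.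
exact/Rlt_le/Rinv_0_lt_compat/dpow_gt0.
Qed.

(** [A] is at least, and the squared norm of the evaluation at most, a constant times [d^(-2^a)]:
    the powers of [d] cancel in the lower bound for the image. Moreover [1 / A] is [O(d)], because
    [1 / (2 * d) >= 1] and [2^a >= 1], so the image coefficients vanish in the limit. *)
Lemma test_functions a n : 0 <= a -> (2 <= n)%N ->
  exists (c : R) (E : nat -> R), 0 < c /\ forall d, 0 < d <= 1/2 -> exists t,
    [/\ in_D a t, normD a t <= 1, c <= normD (critical_exp a n) (phi_image n t) ^ 2 &
      forall k, Cmod (image_coef t k) ^ 2 <= E k * d].
Proof.
move=> a0 n2; set q := Rpower 2 a.
have q1 : 1 <= q by exact: Rpower2_ge1.
have [c c0 Hc] := dseries_lower a0.
have [K K0 HK] := dpois_bound a0.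
have [L L0 HL] := dpow_expn_bounds a0 n2.
have [G G0 HG] := @geometric_weight_sum (q - 1) ltac:(lra).
have [B HB] := image_bounded a0 n2.
have h2 := Rpower_gt0 (1/2) q.
rewrite -/q in Hc HK HL.
exists (c * Rpower (1/2) q / (L * G)), (fun k => (K * Rpower (INR k.+1) (q - 1)) ^ 2 * (2 / c)).
split.
  by apply: Rdiv_lt_0_compat; exact: Rmult_lt_0_compat.
move=> d dh; have d0 : 0 < 2 * d by lra.
have [M HM] := Hc _ d0.
have N0 : (0 < M)%N.
  case: M HM => // ; rewrite big_nil => h; exfalso.
  by have := Rmult_lt_0_compat _ _ c0 (Rpower_gt0 (1 / (2 * d)) q); lra.
have dd : 0 < d by lra.
have d1 : d < 1 by lra.
have [tD tn] := test_fun_norm a d N0.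
exists (test_fun a d M).
have [iD _] := HB _ tD.
set A := bigop _ _ _ in HM.
have A0 : 0 < A by apply: Rlt_le_trans HM; apply: Rmult_lt_0_compat => //; exact: Rpower_gt0.
have Rd := Rpower_gt0 (1/d) q.
split=> //.
  set W := normD _ _ ^ 2.
  have := @test_fun_lower a d M N0 (fun k => dpow (critical_exp a n) (n ^ k)) W (L * (G * Rpower (1/d) q))
    (fun k => dpow_gt0 _ _) (fun T => image_coef_le_normD T n2 iD) _.
  rewrite -/A => h.
  have {}h : A <= W * (L * (G * Rpower (1 / d) q)).
    apply: h => T; apply: Rle_trans (_ : \Rsum_(k <- iota 0 T) L * (((1 - d) ^ k) ^ 2 * Rpower (INR k.+1) (q - 1)) <= _).
      apply: Rsum_le => k _ _; have [_ u] := HL k.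
      have := Rmult_le_compat_l _ _ _ (pow2_ge_0 ((1 - d) ^ k)) u; rewrite -/q; lra.
    rewrite -Rmult_sumr; apply: Rmult_le_compat_l; first lra.
    by have := HG d T (conj dd d1); rewrite (_ : q - 1 + 1 = q); [|ring].
  have e : Rpower (1 / (2 * d)) q = Rpower (1/2) q * Rpower (1/d) q.
    rewrite Rpower_mult_distr; [|lra|by apply: Rdiv_lt_0_compat; lra].
    by congr Rpower; field; lra.
  apply: (Rmult_le_reg_r (L * G * Rpower (1/d) q)).
    by repeat apply: Rmult_lt_0_compat.
  have -> : c * Rpower (1 / 2) q / (L * G) * (L * G * Rpower (1 / d) q) =
     c * (Rpower (1/2) q * Rpower (1/d) q) by field; lra.
  by rewrite -e; lra.
move=> k; apply: Rle_trans (test_fun_coef_le a dd N0 k) _; rewrite -/A.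
have hA : c / (2 * d) <= A.
  apply: Rle_trans HM; apply: Rmult_le_compat_l; first lra.
  rewrite -Rdiv_1_l -[X in X <= _]Rpower_1; last by apply: Rdiv_lt_0_compat; lra.
  apply: Rle_Rpower => //; rewrite -[X in X <= _](Rinv_r (2 * d)); last lra.
  by apply: Rmult_le_compat_r; [exact/Rlt_le/Rinv_0_lt_compat|lra].
have iA : / A <= 2 / c * d.
  have -> : 2 / c * d = / (c / (2 * d)) by field; lra.
  by apply: Rinv_le_contravar => //; apply: Rdiv_lt_0_compat; lra.
rewrite Rmult_assoc; apply: Rmult_le_compat; [exact: pow2_ge_0| | |exact: iA].
  exact/Rlt_le/Rinv_0_lt_compat.
by apply: pow_incr; split; [exact: dpois_ge0|exact: HK].
Qed.

(** * Failure of compactness at the critical exponent *)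

Lemma is_lim_seq_inv_S : is_lim_seq (fun j => / INR j.+1) 0.
Proof.
apply/is_lim_seq_spec => e; have e0 := cond_pos e.
have [N HN] := INR_unbounded (/ e); exists N => j /leP Nj.
have j0 : 0 < INR j.+1 by exact: INR_gt0.
rewrite Rminus_0_r Rabs_pos_eq; last exact/Rlt_le/Rinv_0_lt_compat.
rewrite -[X in _ < X]Rinv_inv; apply: Rinv_lt_contravar.
  by apply: Rmult_lt_0_compat => //; exact: Rinv_0_lt_compat.
by apply: Rlt_le_trans HN _; apply: INR_leq; exact: leqW.
Qed.

(** A norm limit is also a coefficientwise limit, hence zero at every [m >= 1]. The norms of the
    images would then tend to 0 along the subsequence, against their lower bound. *)
Lemma not_compact_critical a n : 0 <= a -> (2 <= n)%N ->
  ~ comp_compact (phi_n n) a (critical_exp a n).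
Proof.
move=> a0 n2 [_ H]; have [c [E [c0 HE]]] := test_functions a0 n2.
have [K HK] := image_bounded a0 n2.
have dj j : 0 < / INR j.+2 <= 1/2.
  split; first exact/Rinv_0_lt_compat/INR_gt0.
  by rewrite Rdiv_1_l; apply: Rinv_le_contravar; [lra|apply: (@INR_leq 2)].
pose t j := sval (constructive_indefinite_description _ (HE _ (dj j))).
have Ht j : [/\ in_D a (t j), normD a (t j) <= 1,
    c <= normD (critical_exp a n) (phi_image n (t j)) ^ 2 &
    forall k, Cmod (image_coef (t j) k) ^ 2 <= E k * / INR j.+2].
  by rewrite /t; case: constructive_indefinite_description.
set b := critical_exp a n.
have fD j : in_D b (phi_image n (t j)) by have [tD _ _ _] := Ht j; have [] := HK _ tD.
have [|s [g [s1 [gD lim]]]] := H t (fun j => phi_image n (t j)) 1.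
  move=> j; have [tD tn _ _] := Ht j; split=> //; split=> //; split=> //.
  exact: image_comp_image a0 n2 tD.
have s2 j : (s j < s j.+1)%N by apply/ltP.
have g0 m : (0 < m)%N -> g m = RtoC 0.
  move=> m0.
  have [F [F0 HF]] : exists F, 0 <= F /\ forall j, Cmod (phi_image n (t j) m) ^ 2 <= F * / INR j.+2.
    case pm : (is_power n m); last first.
      by exists 0; split=> [|j]; [lra|rewrite /phi_image pm Cmod_0 /=; lra].
    exists (Rabs (E (trunc_log n m))); split=> [|j]; first exact: Rabs_pos.
    rewrite /phi_image pm; have [_ _ _ h] := Ht j; apply: Rle_trans (h _) _.
    by apply: Rmult_le_compat_r (Rle_abs _); have := dj j; lra.
  (* Write [g] as the image minus their difference: the first is small coefficientwise, the second
     is controlled by its norm. *)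
  have bnd j : Cmod (g m) ^ 2 <= 2 * F * / INR j.+1 +
      2 * dpow b m * (normD b (fun i => (phi_image n (t (s j)) i - g i)%C) *
                      normD b (fun i => (phi_image n (t (s j)) i - g i)%C)).
    set h := fun i => _.
    have -> : g m = (phi_image n (t (s j)) m - h m)%C.
      rewrite /h; move: (g m) (phi_image _ _ _) => [u v] [u' v'].
      by rewrite /Cminus /Cplus /Copp /=; congr pair; ring.
    apply: Rle_trans (Cmod_minus_sqr _ _) _.
    have h1 : Cmod (phi_image n (t (s j)) m) ^ 2 <= F * / INR j.+1.
      apply: Rle_trans (HF _) _; apply: Rmult_le_compat_l => //.
      apply: Rinv_le_contravar; first exact: INR_gt0.
      by apply: INR_leq; rewrite ltnS; apply: leqW; exact: increasing_ge.
    have h2 : Cmod (h m) ^ 2 <= dpow b m * (normD b h * normD b h).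
      have d0 := dpow_gt0 b m.
      have := Rle_trans _ _ _ (term_le_wsum b h m0 (leqnn m)) (wsum_le_normD m (in_D_minus (fD (s j)) gD)).
      move/(Rmult_le_compat_r _ _ _ (Rlt_le _ _ d0)).
      rewrite /Rdiv Rmult_assoc Rinv_l; last exact: Rgt_not_eq.
      by rewrite Rmult_1_r => u; apply: Rle_trans u _; apply: Req_le; rewrite -/h /=; ring.
    by lra.
  have L := is_lim_seq_plus' _ _ _ _
     (is_lim_seq_mult' _ _ _ _ (is_lim_seq_const (2 * F)) is_lim_seq_inv_S)
     (is_lim_seq_mult' _ _ _ _ (is_lim_seq_const (2 * dpow b m)) (is_lim_seq_mult' _ _ _ _ lim lim)).
  have := is_lim_seq_le _ _ _ _ bnd (is_lim_seq_const _) L.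
  rewrite /Rbar_le !Rmult_0_r Rplus_0_r => z; apply: Cmod_eq_0.
  have := Cmod_ge_0 (g m); rewrite /= in z; nra.
have nE j : normD b (fun i => (phi_image n (t (s j)) i - g i)%C) = normD b (phi_image n (t (s j))).
  apply: normD_ext => m m0; rewrite g0 //; move: (phi_image _ _ _) => [u v].
  by rewrite /Cminus /Cplus /Copp /RtoC /=; congr pair; ring.
have := is_lim_seq_le (fun _ => c) _ _ _ _ (is_lim_seq_const c) (is_lim_seq_mult' _ _ _ _ lim lim).
rewrite /Rbar_le Rmult_0_r => h; suff : c <= 0 by lra.
apply: h => j; rewrite nE; have [_ _ h _] := Ht (s j).
by move: h; rewrite -/b /= Rmult_1_r.
Qed.

(* ssrnat rebinds [<=] in [nat_scope]; [%coq_nat] is the order of Peano. *)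
Theorem theorem4p5 (alpha : R) (n : nat) (Halpha : 0 <= alpha) (Hn : (2 <= n)%coq_nat) :
  (forall beta : R,
     comp_bounded (phi_n n) alpha beta <->
     (Rpower 2 alpha - 1) / INR (nprimefactors n) <= beta) /\
  (alpha = 0 -> ~ comp_compact (phi_n n) 0 0) /\
  (0 < alpha -> forall beta : R,
     comp_compact (phi_n n) alpha beta <->
     (Rpower 2 alpha - 1) / INR (nprimefactors n) < beta).
Proof.
have n2 : (2 <= n)%N by apply/leP.
rewrite -/(critical_exp alpha n).
have bdd := comp_bounded_critical Halpha n2.
have ncpt := not_compact_critical Halpha n2.
split; [|split].
- move=> beta; split=> [hb|h]; last exact: comp_bounded_mono h bdd.
  apply: Rnot_lt_le => h; apply: ncpt; exact: comp_compact_of_bounded Halpha n2 h hb.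
(* At [alpha = 0] the critical exponent is 0, so the target space is [D_0] itself. *)
- move=> e; rewrite e /critical_exp Rpower2_0 in ncpt.
  by rewrite (_ : (1 - 1) / INR (nprimefactors n) = 0) in ncpt; last by rewrite /Rdiv; ring.
- move=> _ beta; split=> [hc|h]; last exact: comp_compact_of_bounded Halpha n2 h bdd.
  apply: Rnot_le_lt => h; apply: ncpt; exact: comp_compact_mono h hc.
Qed.
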